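(* Let $\mathcal{H}$ be a complex Hilbert space and $T\in\boldsymbol{B}(\mathcal{H})$. Then the following statements are equivalent: (i) $T$ is CPD; (ii) there exist operators $B,C\in\boldsymbol{B}(\mathcal{H})$ and a compactly supported semispectral measure $F\colon\mathfrak{B}(\mathbb{R}_+)\to\boldsymbol{B}(\mathcal{H})$ such that $B=B^*$, $C\geq0$, $F(\{1\})=0$ and $$T^{*n}T^n=I+nB+n^2C+\int_{\mathbb{R}_+}Q_n(x)\,F(\mathrm{d}x),\quad n\in\mathbb{Z}_+.$$ Moreover, if (ii) holds, then the triplet $(B,C,F)$ is unique and (1) $\operatorname{supp}(F)\subseteq[0,r(T)^2]$; (2) if $C\neq0$, then $r(T)\geq1$; (3) if $\sup\operatorname{supp}(F)\geq1$, then $r(T)^2=\sup\operatorname{supp}(F)$. Furthermore, $(\langle Bh,h\rangle,\langle Ch,h\rangle,\langle F(\cdot)h,h\rangle)$ is the representing triplet of the CPD sequence $\{\|T^nh\|^2\}_{n=0}^\infty$ for every $h\in\mathcal{H}$.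
   Context: $\boldsymbol{B}(\mathcal{H})$ is the algebra of bounded linear operators on $\mathcal{H}$; $\mathbb{Z}_+=\{0,1,2,\ldots\}$, $\mathbb{R}_+=[0,\infty)$; $\mathfrak{B}(\mathbb{R}_+)$ is the Borel $\sigma$-algebra; $r(T)$ is the spectral radius ($r(T)=0$ if $\mathcal{H}=\{0\}$); $\operatorname{supp}$ is the closed support; $\sup\emptyset=-\infty$. A real sequence $\{\gamma_n\}_{n=0}^\infty$ is conditionally positive definite (CPD) if $\sum_{i,j=0}^k \gamma_{i+j}\lambda_i\bar\lambda_j\geq 0$ for all finite complex sequences $\lambda_0,\ldots,\lambda_k$ with $\sum_{i=0}^k\lambda_i=0$. An operator $T\in\boldsymbol{B}(\mathcal{H})$ is CPD if $\{\|T^nh\|^2\}_{n=0}^\infty$ is CPD for every $h\in\mathcal{H}$. A semispectral measure $F\colon\mathfrak{B}(\mathbb{R}_+)\to\boldsymbol{B}(\mathcal{H})$ is a map that is $\sigma$-additive in the weak operator topology with $F(\Delta)\geq0$ for all $\Delta$ (no normalization); $\int\zeta\,\mathrm{d}F$ is the unique bounded operator with $\langle(\int\zeta\,\mathrm{d}F)h,h\rangle=\int\zeta(x)\langle F(\mathrm{d}x)h,h\rangle$ for all $h$. Let $Q_0=Q_1=0$ and $Q_n(x)=\sum_{j=0}^{n-2}(n-j-1)x^j$ for $n\geq2$. For a CPD sequence $\{\gamma_n\}$ with $\limsup_{n\to\infty}|\gamma_n|^{1/n}<\infty$ the representing triplet is the unique triplet $(b,c,\nu)$ with $b\in\mathbb{R}$,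 $c\in\mathbb{R}_+$ and $\nu$ a finite compactly supported Borel measure on $\mathbb{R}$ with $\nu(\{1\})=0$ such that $\gamma_n=\gamma_0+bn+cn^2+\int_{\mathbb{R}}Q_n\,\mathrm{d}\nu$ for all $n\in\mathbb{Z}_+$ (measures on $\mathbb{R}_+$ are regarded as measures on $\mathbb{R}$ concentrated on $\mathbb{R}_+$). *)

(* Defs.v *)
From HB Require Import structures.
From mathcomp Require Import all_boot all_order all_algebra.
From mathcomp Require Import sesquilinear complex.
From mathcomp Require Import all_classical all_reals all_analysis.

Set Implicit Arguments.
Unset Strict Implicit.
Unset Printing Implicit Defensive.

Import Order.TTheory GRing.Theory Num.Theory.
Import numFieldNormedType.Exports.

Local Open Scope classical_set_scope.
Local Open Scope ring_scope.
Local Open Scope complex_scope.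

(* The inner product is linear in its first argument. *)
HB.mixin Record CompleteNormedModule_isHilbert (R : realType) H
    & CompleteNormedModule R[i] H := {
  inner : {dot H for @Num.conj R[i]} ;
  inner_norm : forall x : H, inner x x = `|x| ^+ 2 }.

#[short(type="hilbertType")]
HB.structure Definition Hilbert (R : realType) :=
  {H of CompleteNormedModule R[i] H & CompleteNormedModule_isHilbert R H}.

Notation "''[' x , y ]" := (inner x y) : ring_scope.

Section bounded_operators.
Variables (R : realType) (H : hilbertType R).

Record bounded_op := BoundedOp {
  bop_fun :> H -> H ;
  bop_linear : linear bop_fun ;
  bop_bounded : exists M : R[i], forall x, `|bop_fun x| <= M * `|x| }.

HB.instance Definition _ (S : bounded_op) :=
  GRing.isLinear.Build R[i] H H _ S (bop_linear S).

Lemma bop_ext (S S' : bounded_op) : S =1 S' -> S = S'.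
Proof.
case: S S' => [f fl fb] [g gl gb] /= /funext fg; subst g.
by congr BoundedOp; apply: Prop_irrelevance.
Qed.

HB.instance Definition _ := gen_eqMixin bounded_op.
HB.instance Definition _ := gen_choiceMixin bounded_op.

Lemma bop_bound (S : bounded_op) :
  exists2 M : R[i], 0 <= M & forall x, `|S x| <= M * `|x|.
Proof.
have [M SM] := bop_bounded S; exists `|M| => // x.
rewrite (le_trans (SM x))// -[X in _ <= _ * X]normr_id -normrM.
by rewrite real_ler_norm// ger0_real// (le_trans _ (SM x)).
Qed.

Definition bop0_def (x : H) : H := 0.
Fact bop0_linear : linear bop0_def.
Proof. by move=> a x y; rewrite /bop0_def scaler0 addr0. Qed.
Fact bop0_bounded : exists M : R[i], forall x, `|bop0_def x| <= M * `|x|.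
Proof. by exists 0 => x; rewrite normr0 mul0r. Qed.
Definition bop0 := BoundedOp bop0_linear bop0_bounded.

Definition bop1_def (x : H) : H := x.
Fact bop1_linear : linear bop1_def. Proof. by []. Qed.
Fact bop1_bounded : exists M : R[i], forall x, `|bop1_def x| <= M * `|x|.
Proof. by exists 1 => x; rewrite mul1r. Qed.
Definition bop1 := BoundedOp bop1_linear bop1_bounded.

Section binary.
Variables (a : R[i]) (S T : bounded_op).

Definition bop_add_def x := S x + T x.
Fact bop_add_linear : linear bop_add_def.
Proof. by move=> b x y; rewrite /bop_add_def !linearP scalerDr addrACA. Qed.
Fact bop_add_bounded : exists M : R[i], forall x, `|bop_add_def x| <= M * `|x|.
Proof.
have [[M _ SM] [N _ TN]] := (bop_bound S, bop_bound T).
by exists (M + N) => x; rewrite mulrDl (le_trans (ler_normD _ _))// lerD.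
Qed.
Definition bop_add := BoundedOp bop_add_linear bop_add_bounded.

Definition bop_scale_def x := a *: S x.
Fact bop_scale_linear : linear bop_scale_def.
Proof.
by move=> b x y; rewrite /bop_scale_def linearP scalerDr !scalerA mulrC.
Qed.
Fact bop_scale_bounded :
  exists M : R[i], forall x, `|bop_scale_def x| <= M * `|x|.
Proof.
have [M _ SM] := bop_bound S.
by exists (`|a| * M) => x; rewrite normrZ -mulrA ler_wpM2l.
Qed.
Definition bop_scale := BoundedOp bop_scale_linear bop_scale_bounded.

Definition bop_comp_def x := S (T x).
Fact bop_comp_linear : linear bop_comp_def.
Proof. by move=> b x y; rewrite /bop_comp_def !linearP. Qed.
Fact bop_comp_bounded :
  exists M : R[i], forall x, `|bop_comp_def x| <= M * `|x|.
Proof.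
have [[M M0 SM] [N _ TN]] := (bop_bound S, bop_bound T).
by exists (M * N) => x; rewrite (le_trans (SM _))// -mulrA ler_wpM2l.
Qed.
Definition bop_comp := BoundedOp bop_comp_linear bop_comp_bounded.
End binary.

Definition bop_opp S := bop_scale (-1) S.

Fact bop_addA : associative bop_add.
Proof. by move=> S T U; apply: bop_ext => x; apply: addrA. Qed.
Fact bop_addC : commutative bop_add.
Proof. by move=> S T; apply: bop_ext => x; apply: addrC. Qed.
Fact bop_add0 : left_id bop0 bop_add.
Proof. by move=> S; apply: bop_ext => x; apply: add0r. Qed.
Fact bop_addN : left_inverse bop0 bop_opp bop_add.
Proof.
move=> S; apply: bop_ext => x.
by rewrite /= /bop_add_def /= /bop_scale_def scaleN1r addNr.
Qed.
HB.instance Definition _ :=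
  GRing.isZmodule.Build bounded_op bop_addA bop_addC bop_add0 bop_addN.

Fact bop_compA : associative bop_comp.
Proof. by move=> S T U; apply: bop_ext. Qed.
Fact bop_comp1l : left_id bop1 bop_comp.
Proof. by move=> S; apply: bop_ext. Qed.
Fact bop_comp1r : right_id bop1 bop_comp.
Proof. by move=> S; apply: bop_ext. Qed.
Fact bop_compDl : left_distributive bop_comp +%R.
Proof. by move=> S T U; apply: bop_ext. Qed.
Fact bop_compDr : right_distributive bop_comp +%R.
Proof. by move=> S T U; apply: bop_ext => x; apply: linearD. Qed.
HB.instance Definition _ := GRing.Zmodule_isPzRing.Build bounded_op
  bop_compA bop_comp1l bop_comp1r bop_compDl bop_compDr.

Fact bop_scaleA a b S : bop_scale a (bop_scale b S) = bop_scale (a * b) S.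
Proof. by apply: bop_ext => x; apply: scalerA. Qed.
Fact bop_scale1 : left_id 1 bop_scale.
Proof. by move=> S; apply: bop_ext => x; apply: scale1r. Qed.
Fact bop_scaleDr : right_distributive bop_scale +%R.
Proof. by move=> a S T; apply: bop_ext => x; apply: scalerDr. Qed.
Fact bop_scaleDl S : {morph bop_scale^~ S : a b / a + b}.
Proof. by move=> a b; apply: bop_ext => x; apply: scalerDl. Qed.
HB.instance Definition _ := GRing.Zmodule_isLmodule.Build R[i] bounded_op
  bop_scaleA bop_scale1 bop_scaleDr bop_scaleDl.

End bounded_operators.

Notation "''B' ( H )" := (bounded_op H) (format "''B' ( H )") : type_scope.

Section operators.
Variables (R : realType) (H : hilbertType R).
Implicit Types (S T : 'B(H)) (h : H).

Definition rnorm h : R := complex.Re `|h|.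

(* The set below is a singleton, by the Riesz representation theorem. *)
Definition adjoint T : 'B(H) :=
  xget 0 [set S : 'B(H) | forall x y, '[T x, y] = '[x, S y]].

(* The order of R[i] makes this say that '[T h, h] is a nonnegative real. *)
Definition op_ge0 T := forall h, 0 <= '[T h, h].

Definition spectrum T : set R[i] :=
  [set z | let Tz : 'B(H) := T - z *: (1 : 'B(H)) in
     ~ exists S, S * Tz = 1 /\ Tz * S = 1].

(* The spectrum is bounded, and empty only if H is zero, in which case the
   value is sup set0 = 0. *)
Definition spectral_radius T : R := sup [set complex.Re `|z| | z in spectrum T].

End operators.

Lemma Re_cvg (R : realType) (u : R[i]^nat) (l : R[i]) :
  (u : nat -> R[i]^o) @ \oo --> (l : R[i]^o) ->
  complex.Re (u n) @[n --> \oo] --> complex.Re l.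
Proof.
move=> /cvgrPdist_lt ul; apply/cvgrPdist_lt => e e0.
have := ul e%:C; rewrite ltcR => /(_ e0); apply: filterS => n.
rewrite -raddfB/= => /(le_lt_trans _); rewrite -ltcR; apply.
by case: (l - u n) => a b; rewrite normc_ge_Re.
Qed.

Section semispectral_measures.
Variables (R : realType) (H : hilbertType R).

Definition Rplus : set R := `[0, +oo[.

(* Only the values at the Borel subsets of Rplus matter. *)
Record semispectral := Semispectral {
  sm_fun :> set R -> 'B(H) ;
  sm_ge0 : forall D, measurable D -> D `<=` Rplus -> op_ge0 (sm_fun D) ;
  sm_sigma_additive : forall D : (set R)^nat,
    (forall i, measurable (D i)) -> (forall i, D i `<=` Rplus) ->
    trivIset setT D ->
    forall x y, (fun n => \sum_(0 <= i < n) '[sm_fun (D i) x, y] : R[i]^o)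
      @ \oo --> ('[sm_fun (\bigcup_i D i) x, y] : R[i]^o) }.

(* The measure '[F(-) h, h], regarded as a Borel measure on R concentrated on
   Rplus; the value 0 at nonmeasurable sets is a convention. *)
Definition quad_measure (F : semispectral) (h : H) (D : set R) : \bar R :=
  if `[< measurable D >] then (complex.Re '[F (D `&` Rplus) h, h])%:E else 0%E.

Variable F : semispectral.

Let measurable_Rplus : measurable Rplus.
Proof. exact: measurable_itv. Qed.

Lemma sm0 x y : '[F set0 x, y] = 0.
Proof.
have F0 : (fun n => '[F set0 x, y] *+ n : R[i]^o) @ \oo -->
    ('[F set0 x, y] : R[i]^o).
  have -> : (fun n => '[F set0 x, y] *+ n) =
      (fun n => \sum_(0 <= i < n) '[F set0 x, y]).
    by apply/funext => n; rewrite sumr_const_nat subn0.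
  have := @sm_sigma_additive F (fun=> set0) (fun=> measurable0)
    (fun=> @sub0set _ _) (@trivIset_set0 _ _ _) x y.
  by rewrite bigcup0.
have F1 : (fun n => '[F set0 x, y] *+ n.+1 : R[i]^o) @ \oo -->
    ('[F set0 x, y] : R[i]^o) by rewrite (cvg_shiftS (fun n => _ *+ n)).
have := cvgB F1 F0; rewrite subrr.
have -> : (fun n => '[F set0 x, y] *+ n.+1 : R[i]^o) -
    (fun n => '[F set0 x, y] *+ n : R[i]^o) = (fun=> '[F set0 x, y]).
  by apply/funext => n; rewrite fctE mulrS addrK.
have F00 : (fun=> '[F set0 x, y] : R[i]^o) @ \oo --> ('[F set0 x, y] : R[i]^o).
  exact: cvg_cst.
move=> F01; exact: (cvg_unique (@norm_hausdorff _ R[i]^o) F00 (F01 _)).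
Qed.

Lemma sm_quad_ge0 D h : measurable D ->
  0 <= complex.Re '[F (D `&` Rplus) h, h].
Proof.
move=> mD; have : 0 <= '[F (D `&` Rplus) h, h].
  by apply: sm_ge0 => //; exact: measurableI.
by rewrite lecE /= => /andP[].
Qed.

Section quad_measure.
Variable h : H.
Let mu := quad_measure F h.

Let mu0 : mu set0 = 0%E.
Proof. by rewrite /mu /quad_measure asboolT// set0I sm0. Qed.

Let mu_ge0 D : (0 <= mu D)%E.
Proof.
rewrite /mu /quad_measure; case: asboolP => // mD.
by rewrite lee_fin sm_quad_ge0.
Qed.

Let mu_sigma_additive : semi_sigma_additive mu.
Proof.
move=> D mD tD mUD.
have -> : mu (\bigcup_n D n) =
    (complex.Re '[F (\bigcup_n (D n `&` Rplus)) h, h])%:E.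
  by rewrite /mu /quad_measure asboolT// setI_bigcupl.
under eq_fun => n.
  under eq_bigr => i _ do rewrite /mu /quad_measure asboolT//.
  rewrite sumEFin -raddf_sum/=.
  over.
apply: cvg_EFin; first by near=> n.
apply: Re_cvg.
apply: (@sm_sigma_additive F (fun n => D n `&` Rplus)) => //.
- by move=> i; exact: measurableI.
- exact: trivIset_setIr.
Unshelve. all: by end_near. Qed.

HB.instance Definition _ := isMeasure.Build _ R R (quad_measure F h)
  mu0 mu_ge0 mu_sigma_additive.

Let mu_fin : fin_num_fun mu.
Proof. by move=> D mD; rewrite /mu /quad_measure asboolT. Qed.

HB.instance Definition _ := Measure_isFinite.Build _ R R (quad_measure F h)
  mu_fin.
End quad_measure.

(* The set below has at most one element, since H is a complex space. *)
Definition op_integral (f : R -> R) : 'B(H) :=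
  xget 0 [set S : 'B(H) | forall h,
    '[S h, h] = (\int[quad_measure F h]_(x in Rplus) f x)%:C].

Definition op_supp : set R :=
  [set x | Rplus x /\ forall U, open U -> U x -> F (U `&` Rplus) <> 0].

End semispectral_measures.

Section cpd.
Variable R : realType.

Definition cpd (g : R^nat) := forall (k : nat) (l : 'I_k.+1 -> R[i]),
  \sum_(i < k.+1) l i = 0 ->
  0 <= \sum_(i < k.+1) \sum_(j < k.+1) (g (i + j)%N)%:C * l i * (l j)^*.

(* The sum is empty if n is 0 or 1. *)
Definition Qpoly (n : nat) (x : R) : R :=
  \sum_(0 <= j < n.-1) (n - j - 1)%N%:R * x ^+ j.

Definition measure_supp (nu : set R -> \bar R) : set R :=
  [set x | forall U, open U -> U x -> nu U <> 0%E].

Definition represents (g : R^nat) (b c : R)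
    (nu : {finite_measure set R -> \bar R}) :=
  [/\ 0 <= c, compact (measure_supp nu), nu [set 1] = 0%E &
    forall n, g n = g 0%N + b * n%:R + c * n%:R ^+ 2 + \int[nu]_x Qpoly n x].

(* The last clause expresses uniqueness; measures are compared on Borel sets,
   as their values elsewhere are irrelevant. *)
Definition representing_triplet (g : R^nat) (b c : R)
    (nu : {finite_measure set R -> \bar R}) :=
  [/\ cpd g, (limn_esup (fun n => (`|g n| `^ n%:R^-1)%:E) < +oo)%E,
    represents g b c nu &
    forall b' c' nu', represents g b' c' nu' ->
      [/\ b' = b, c' = c & forall D, measurable D -> nu' D = nu D]].

End cpd.

Section cpd_operators.
Variables (R : realType) (H : hilbertType R).

Definition cpd_op (T : 'B(H)) :=
  forall h : H, cpd (fun n => rnorm ((T ^+ n) h) ^+ 2).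

Definition op_represents (T B C : 'B(H)) (F : semispectral H) :=
  [/\ adjoint B = B, op_ge0 C, compact (op_supp F), F [set 1] = 0 &
    forall n, adjoint T ^+ n * T ^+ n =
      1 + B *+ n + C *+ (n ^ 2)%N + op_integral F (@Qpoly R n)].

End cpd_operators.

(* Main.v *)
(* Let a_n(h) be the second difference of n |-> |T^n h|^2. If T is CPD, the
   sequences a_n(h) and a_(n+1)(h) = a_n(T h) are positive definite and grow at
   most geometrically, so a_n(h) = int x^n d(mu_h) with mu_h carried by some
   [0, r] (Stieltjes, reduced to Hausdorff). Each a_n is the quadratic form of
   an operator; so is h |-> mu_h(]-oo, t[), as a limit of such forms, and Dynkin
   induction yields a semispectral measure with quadratic forms mu_h. Its atom
   at 1 is 2 C, the rest is F, and B = T^* T - 1 - C. Conversely the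
   representation says that a_n(h) = 2 <C h, h> + int x^n <F(dx) h, h>, so that
   determinacy of moments on a compact interval gives uniqueness.
   If rho > r(T), then a_n(h) = O(rho^(2 n)) along n = 2^m, which forces F to
   vanish on ]rho^2, +oo[, and C = 0 if rho < 1. If F is carried by [0, s] with
   s >= 1, then |T^n h|^2 = O(n^2 s^n), and the Neumann series shows that the
   spectrum lies in |z|^2 <= s. *)

Require Import Defs.
From HB Require Import structures.
From mathcomp Require Import all_boot all_order all_algebra.
From mathcomp Require Import sesquilinear complex ring lra zify.
From mathcomp Require Import all_classical all_reals all_analysis measurable_realfun.

Set Implicit Arguments.
Unset Strict Implicit.
Unset Printing Implicit Defensive.

Import Order.TTheory GRing.Theory Num.Theory.
Import numFieldNormedType.Exports.

Local Open Scope classical_set_scope.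
Local Open Scope ring_scope.

(** * The moment problem on an interval *)

(** Second differences are the right coordinates because a polynomial whose coefficients sum to 0 is
    a multiple of X - 1: testing the sequence on (X - 1) q is testing its second difference on q^2.
    The term c n^2 then becomes 2 c, the moments of an atom of mass 2 c at 1, which is why F itself
    must not charge 1. The obstacle is that the measures mu_h are found one vector at a time, with
    no information on how they depend on h. It is overcome by recovering mu_h(]-oo, t[) from the
    moments through polynomials that depend neither on h nor on mu_h: evaluated at the operator
    moments, they have a weak limit. The same polynomials give determinacy. The spectral radius
    controls T^n only along n = 2^m, because averages over roots of unity are built by repeated
    squaring. This is enough, since t^n mu_h(]t, +oo[) <= a_n(h) for every n, so that one
    subsequence already forces the tail to vanish. *)

Section moment_functional.
Variable R : realType.
Implicit Types (a b : nat -> R) (p q w : {poly R}).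

(** The Riesz functional of the sequence [a]: linear in [p], with value [a n] at ['X^n]. *)
Definition mom a p : R := \sum_(i < size p) p`_i * a i.

Lemma momE a p n : (size p <= n)%N -> mom a p = \sum_(i < n) p`_i * a i.
Proof.
move=> pn; rewrite /mom [RHS](bigID (fun i : 'I_n => (i < size p)%N))/=.
rewrite [X in _ = _ + X]big1 ?addr0; last first.
  by move=> i; rewrite -leqNgt => pi; rewrite nth_default ?mul0r.
by rewrite (big_ord_widen_cond n predT (fun i => p`_i * a i) pn).
Qed.

Fact mom_scalar a : scalar (mom a).
Proof.
move=> k p q; pose n := maxn (size p) (size q).
rewrite (@momE _ (k *: p + q) n); last first.
  rewrite (leq_trans (size_polyD _ _))// geq_max leq_maxr andbT.
  by rewrite (leq_trans (size_scale_leq _ _))// leq_maxl.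
rewrite (@momE _ p n) ?leq_maxl// (@momE _ q n) ?leq_maxr//.
rewrite /GRing.scale/= mulr_sumr -big_split/=; apply: eq_bigr => i _.
by rewrite coefD coefZ mulrDl mulrA.
Qed.
HB.instance Definition _ a :=
  GRing.isLinear.Build R {poly R} R *%R (mom a) (mom_scalar a).

Lemma momXn a n : mom a 'X^n = a n.
Proof.
rewrite (@momE _ _ n.+1) ?size_polyXn// (bigD1 ord_max)//= coefXn eqxx mul1r.
rewrite big1 ?addr0// => i; rewrite -val_eqE/= => ni.
by rewrite coefXn (negbTE ni) mul0r.
Qed.

Lemma mom_mulr a w p : mom (fun n => mom a (w * 'X^n)) p = mom a (w * p).
Proof.
rewrite -{2}[p]coefK poly_def mulr_sumr linear_sum /mom; apply: eq_bigr => i _.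
by rewrite -/(mom _ _) -scalerAr linearZ.
Qed.

Lemma mom_shift a k p : mom (fun n => a (k + n)%N) p = mom a ('X^k * p).
Proof.
rewrite -mom_mulr; congr mom; apply/funext => n.
by rewrite -exprD momXn.
Qed.

Lemma mom_bound a p c :
  (forall n, `|a n| <= c) -> `|mom a p| <= (\sum_(i < size p) `|p`_i|) * c.
Proof.
move=> ac; rewrite (le_trans (ler_norm_sum _ _ _))// mulr_suml ler_sum// => i _.
by rewrite normrM ler_wpM2l.
Qed.

(** Positive semidefiniteness of the Hankel matrices a (i + j), tested on real coefficient
    vectors. *)
Definition pos_def a := forall q, 0 <= mom a (q ^+ 2).

(** Keeping the form homogeneous in s and t covers a vanishing leading coefficient. The lemma serves
    the Cauchy-Schwarz inequalities for moments and for vectors and, with z = 0, the vanishing of a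
    first variation. *)
Lemma disc_le0 (x y z : R) :
  (forall s t, 0 <= s ^+ 2 * x + s * t * y *+ 2 + t ^+ 2 * z) -> y ^+ 2 <= x * z.
Proof.
move=> h; rewrite leNgt; apply/negP => xzy.
have x0 : 0 <= x by have := h 1 0; lra.
have z0 : 0 <= z by have := h 0 1; lra.
move: x0; rewrite le_eqVlt => /predU1P[x0|x0].
  have y2 : 0 < y ^+ 2 by move: xzy; rewrite -x0 mul0r.
  (* For x = 0 the form is affine in s, and this choice makes it equal to - (z + 2) y^2 < 0. *)
  have := h (- (z + 1)) y; rewrite -x0.
  have -> : (- (z + 1)) ^+ 2 * 0 + - (z + 1) * y * y *+ 2 +
    y ^+ 2 * z = - (y ^+ 2 * z + y ^+ 2 *+ 2) by ring.
  have := mulr_ge0 (ltW y2) z0; lra.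
have := h (- y) x.
have -> : (- y) ^+ 2 * x + - y * x * y *+ 2 + x ^+ 2 * z =
  x * (x * z - y ^+ 2) by ring.
by rewrite pmulr_rge0//; lra.
Qed.

Lemma pos_def_cauchy a p q : pos_def a ->
  mom a (p * q) ^+ 2 <= mom a (p ^+ 2) * mom a (q ^+ 2).
Proof.
move=> pa; apply: disc_le0 => s t.
have := pa (s *: p + t *: q); congr (0 <= _).
have -> : (s *: p + t *: q) ^+ 2 =
    s ^+ 2 *: p ^+ 2 + (s * t *+ 2) *: (p * q) + t ^+ 2 *: q ^+ 2.
  by rewrite -!mul_polyC; rewrite !(rmorphXn, rmorphM, rmorphMn)/=; ring.
by rewrite !linearD !linearZ/=; ring.
Qed.

(* Otherwise b (2 ^ k) grows at least like b 0 * (b 1 / b 0) ^ (2 ^ k). *)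
Lemma bounded_le_of_square b c : 0 <= b 0%N ->
  (forall n, b n ^+ 2 <= b 0%N * b n.*2) -> (forall n, `|b n| <= c) ->
  b 1%N <= b 0%N.
Proof.
move=> b0 bsq bc; rewrite leNgt; apply/negP => b01.
have {}b0 : 0 < b 0%N.
  rewrite lt_neqAle b0 andbT; apply/eqP => b00.
  by have := bsq 1%N; move: b01; rewrite -b00 mul0r; nra.
pose t := b 1%N / b 0%N.
have t1 : 1 < t by rewrite ltr_pdivlMr ?mul1r.
have bt : b 0%N * t = b 1%N by rewrite mulrC divfK// gt_eqF.
have step k : b 0%N * t ^+ (2 ^ k)%N <= b (2 ^ k)%N.
  elim: k => [|k IH]; first by rewrite expn0 expr1 bt.
  have := bsq (2 ^ k)%N; rewrite -mul2n -expnS => h.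
  rewrite -(ler_pM2l b0) (le_trans _ h)// expnS mulnC exprM.
  have -> : b 0%N * (b 0%N * (t ^+ (2 ^ k)%N) ^+ 2) =
    (b 0%N * t ^+ (2 ^ k)%N) ^+ 2 by ring.
  by rewrite ler_sqr ?nnegrE// ?(le_trans _ IH)//;
     rewrite mulr_ge0 ?exprn_ge0 ?ltW// (lt_trans _ t1).
have bern n : 1 + n%:R * (t - 1) <= t ^+ n.
  elim: n => [|n IH]; first by rewrite mul0r addr0 expr0.
  rewrite exprS -natr1.
  have : 0 <= n%:R * (t - 1) ^+ 2 by rewrite mulr_ge0// sqr_ge0.
  have : t * (1 + n%:R * (t - 1)) <= t * t ^+ n by rewrite ler_wpM2l//; lra.
  by lra.
have key k : b 0%N * (k%:R * (t - 1)) <= c.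
  rewrite (le_trans _ (bc (2 ^ k)%N))// (le_trans _ (ler_norm _))//.
  rewrite (le_trans _ (step k))// ler_pM2l// (le_trans _ (bern _))//.
  have kk : (k%:R : R) <= (2 ^ k)%:R by rewrite ler_nat ltnW// ltn_expl.
  have : k%:R * (t - 1) <= (2 ^ k)%:R * (t - 1) by rewrite ler_wpM2r//; lra.
  by lra.
have bt0 : 0 < b 0%N * (t - 1) by rewrite mulr_gt0// subr_gt0.
have := key (Num.bound `|c / (b 0%N * (t - 1))|).
rewrite leNgt mulrCA => /negP; apply; rewrite -ltr_pdivrMr//.
by rewrite (le_lt_trans (ler_norm _))// archi_boundP.
Qed.

(** Put b n = mom a (X^n q^2). Cauchy-Schwarz for q and X^n q gives b n ^ 2 <= b 0 * b (2 n), and a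
    bounded sequence of this kind has b 1 <= b 0. This is how boundedness of the moments confines
    the measure to x <= 1. *)
Lemma pos_def_1subX a c q : pos_def a -> (forall n, `|a n| <= c) ->
  0 <= mom a ((1 - 'X) * q ^+ 2).
Proof.
move=> pa ac; rewrite mulrBl mul1r linearB subr_ge0.
have := @bounded_le_of_square (fun n => mom a ('X^n * q ^+ 2))
  ((\sum_(i < size (q ^+ 2)) `|(q ^+ 2)`_i|) * c).
rewrite /= expr0 mul1r expr1; apply; first exact: pa.
- move=> n; have := pos_def_cauchy q ('X^n * q) pa.
  by rewrite exprMn -exprM muln2 mulrCA -expr2.
- by move=> n; rewrite -mom_shift mom_bound.
Qed.

(* Up to squares, X ^ j (1 - X) ^ k is one of 1, X, 1 - X and X (1 - X). *)
Lemma mom_hausdorff a c : pos_def a -> pos_def (fun n => a n.+1) ->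
  (forall n, `|a n| <= c) ->
  forall j k, 0 <= mom a ('X^j * (1 - 'X) ^+ k).
Proof.
move=> pa pSa ac j k.
rewrite -(odd_double_half j) -(odd_double_half k) !exprD -!muln2 !exprM.
set j' := (j./2); set k' := (k./2); pose q : {poly R} := 'X^j' * (1 - 'X) ^+ k'.
have momS p : mom (fun n => a n.+1) p = mom a ('X * p).
  by rewrite -(mom_shift a 1).
case: (odd j) (odd k) => [] []; rewrite /= ?expr1 ?expr0.
- have -> : 'X * 'X^j' ^+ 2 * ((1 - 'X) * (1 - 'X) ^+ k' ^+ 2) =
    'X * ((1 - 'X) * q ^+ 2) by rewrite /q; ring.
  by rewrite -momS; apply: (@pos_def_1subX _ c) => // n.
- have -> : 'X * 'X^j' ^+ 2 * (1 * (1 - 'X) ^+ k' ^+ 2) =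
    'X * q ^+ 2 by rewrite /q; ring.
  by rewrite -momS; exact: pSa.
- have -> : 1 * 'X^j' ^+ 2 * ((1 - 'X) * (1 - 'X) ^+ k' ^+ 2) =
    (1 - 'X) * q ^+ 2 by rewrite /q; ring.
  exact: pos_def_1subX pa ac.
- have -> : 1 * 'X^j' ^+ 2 * (1 * (1 - 'X) ^+ k' ^+ 2) =
    q ^+ 2 by rewrite /q; ring.
  exact: pa.
Qed.

End moment_functional.

(** * Integrals of monotone functions and their limits along filters *)

Section monotone_riemann.
Variable R : realType.
Local Notation leb := (@lebesgue_measure R).
Implicit Types f g : R -> R.

Definition unit_nd f :=
  (forall x y, x <= y -> f x <= f y) /\ forall x, 0 <= f x <= 1.

Lemma unit_nd_measurable f D : measurable D -> unit_nd f -> measurable_fun D f.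
Proof. by move=> mD [fnd _]; apply: nondecreasing_measurable => // x y; exact: fnd. Qed.

Lemma leb_oc_lty (a b : R) : (leb `]a, b]%classic < +oo)%E.
Proof. by rewrite lebesgue_measure_itv/=; case: ifPn; rewrite ?ltry. Qed.

Lemma fine_leb_oc (a b : R) : a <= b -> fine (leb `]a, b]%classic) = b - a.
Proof.
rewrite lebesgue_measure_itv/= lte_fin le_eqVlt => /predU1P[->|->//].
by rewrite ltxx subrr.
Qed.

Lemma unit_nd_integrable f (a b : R) : unit_nd f ->
  leb.-integrable `]a, b]%classic (EFin \o f).
Proof.
move=> fnd; apply: measurable_bounded_integrable => //.
- exact: leb_oc_lty.
- exact: unit_nd_measurable.
- exists 1; split => // M M1 x _.
  by case: fnd => _ /(_ x)/andP[f0 f1]; rewrite /= ger0_norm// (le_trans f1)// ltW.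
Qed.

Lemma Rintegral_oc_cat f (a b c : R) : unit_nd f -> a <= b -> b <= c ->
  \int[leb]_(x in `]a, c]) f x =
  \int[leb]_(x in `]a, b]) f x + \int[leb]_(x in `]b, c]) f x.
Proof.
move=> fnd ab bc; rewrite (@itv_bndbnd_setU _ _ _ (BRight b)) ?bnd_simp//.
rewrite Rintegral_setU//.
  by rewrite -itv_bndbnd_setU ?bnd_simp//; exact: unit_nd_integrable.
apply/disj_setPS => x [] /=; rewrite !in_itv/= => /andP[_ xb] /andP[bx _].
by move: (lt_le_trans bx xb); rewrite ltxx.
Qed.

Lemma Rintegral_oc_bounds f (a b : R) : unit_nd f -> a <= b ->
  f a * (b - a) <= \int[leb]_(x in `]a, b]) f x <= f b * (b - a).
Proof.
move=> fnd ab; rewrite -(fine_leb_oc ab) -!Rintegral_cst//.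
have ic c : leb.-integrable `]a, b]%classic (EFin \o (fun=> c : R)).
  apply: measurable_bounded_integrable => //; first exact: leb_oc_lty.
  by exists `|c|; split => // M M1 x _; exact: ltW.
have If := unit_nd_integrable a b fnd.
by apply/andP; split; apply: le_Rintegral => // x /=;
  rewrite in_itv/= => /andP[ax xb]; apply: (fnd.1) => //; exact: ltW.
Qed.

(** On each cell a monotone function varies by its increment, and the increments add up to at most
    1. The error is therefore the mesh, whatever the function. *)
Lemma riemann_bounds f (A : R) (N : nat) : 0 <= A -> (0 < N)%N -> unit_nd f ->
  `|\int[leb]_(x in `]0, A]) f x - \sum_(i < N) f (A * (i%:R / N%:R)) * (A / N%:R)|
  <= A / N%:R.
Proof.
move=> A0 N0 fnd; have [h hE] : exists h, h = A / N%:R by eexists.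
have h0 : 0 <= h by rewrite hE divr_ge0.
have N0R : (N%:R : R) != 0 by rewrite pnatr_eq0 -lt0n.
(* The gaps between lower and upper sums telescope to (f (h k) - f 0) h. *)
suff hk k : \sum_(i < k) f (h * i%:R) * h <= \int[leb]_(x in `]0, h * k%:R]) f x
    <= \sum_(i < k) f (h * i%:R) * h + (f (h * k%:R) - f 0) * h.
  have hN : h * N%:R = A by rewrite hE divfK.
  have hi (i : nat) : h * i%:R = A * (i%:R / N%:R) by rewrite hE mulrAC mulrA.
  have hs : \sum_(i < N) f (h * i%:R) * h =
      \sum_(i < N) f (A * (i%:R / N%:R)) * h.
    by apply: eq_bigr => i _; rewrite hi.
  have := hk N; rewrite hN hs {hs hi}.
  have /andP[f00 f01] := fnd.2 0; have /andP[fA0 fA1] := fnd.2 A.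
  have fAh : (f A - f 0) * h <= 1 * h by rewrite ler_wpM2r//; lra.
  rewrite -hE ler_norml.
  move: (\sum_(i < N) _) (Rintegral _ _ _) => S I /andP[h1 h2].
  by apply/andP; split; lra.
elim: k => [|k /andP[IH1 IH2]].
  by rewrite !big_ord0 mulr0 subrr mul0r addr0 set_itv_ge ?bnd_simp ?ltxx//
    Rintegral_set0 lexx.
have hk0 : 0 <= h * k%:R by rewrite mulr_ge0.
have hk1 : h * k%:R <= h * k.+1%:R by rewrite ler_wpM2l// ler_nat.
rewrite (Rintegral_oc_cat fnd hk0 hk1) big_ord_recr/=.
have := Rintegral_oc_bounds fnd hk1.
have -> : h * k.+1%:R - h * k%:R = h by rewrite -natr1; ring.
move: IH1 IH2; move: (\sum_(i < k) _) (Rintegral _ _ _) (Rintegral _ _ _).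
by move=> S I J IH1 IH2 /andP[b1 b2]; apply/andP; split; lra.
Qed.

(** Dominated convergence can fail along an ultrafilter. For monotone functions the uniform Riemann
    bound replaces it: only finitely many values of the functions matter. *)
Lemma cvg_Rintegral_unit_nd (A : R) (U : set_system nat) {PU : ProperFilter U}
    (F : nat -> R -> R) f : 0 <= A ->
  (forall n, unit_nd (F n)) -> unit_nd f ->
  (forall x, F n x @[n --> U] --> f x) ->
  \int[leb]_(x in `]0, A]) F n x @[n --> U] --> \int[leb]_(x in `]0, A]) f x.
Proof.
move=> A0 Fnd fnd Ff; apply/cvgrPdist_le => e e0.
(* Two Riemann errors of at most e / 4 each, and e / 2 for the difference of the finite sums. *)
pose N := (Num.bound (A * 4 / e)).+1.
have hN : A / N%:R <= e / 4.
  rewrite ler_pdivrMr// mulrC mulrA ler_pdivlMr// -ler_pdivrMr//.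
  by rewrite ltW// (lt_le_trans (archi_boundP _)) ?ler_nat// divr_ge0 ?mulr_ge0// ltW.
pose S g := \sum_(i < N) g (A * (i%:R / N%:R)) * (A / N%:R).
have SF : S (F n) @[n --> U] --> S f.
  apply: cvg_big => [|i _]; first exact: add_continuous.
  by apply: cvgMr_tmp; exact: Ff.
have e20 : 0 < e / 2 by rewrite divr_gt0.
move/cvgrPdist_le/(_ _ e20) : SF.
apply: filterS => n.
have := riemann_bounds A0 (ltn0Sn _ : 0 < N)%N (Fnd n).
have := riemann_bounds A0 (ltn0Sn _ : 0 < N)%N fnd.
rewrite -!/(S _) !ler_norml.
move: (S _) (S _) (Rintegral _ _ _) (Rintegral _ _ _) => s1 s2 i1 i2.
move=> /andP[a1 a2] /andP[b1 b2] /andP[c1 c2].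
by apply/andP; split; lra.
Qed.

End monotone_riemann.

Lemma ultra_fmap (T S : Type) (f : T -> S) (F : set_system T) :
  UltraFilter F -> UltraFilter (f @ F).
Proof.
move=> FU; split; first exact: fmap_proper_filter.
move=> G PG FG; rewrite predeqE => A; split; last exact: FG.
move=> GA; have [//|FnA] := in_ultra_setVsetC (f @^-1` A) FU.
have GnA : G (~` A) by exact: FG.
have GI : G (A `&` ~` A) by exact: filterI.
by move: GI; rewrite setICr => GI; case: (filter_not_empty G).
Qed.

Lemma integral_mrestr d (T : measurableType d) (R : realType) (mu : {measure set T -> \bar R})
    (D : set T) (mD : measurable D) (f : T -> \bar R) :
  measurable_fun setT f -> (forall x, 0 <= f x)%E ->
  (\int[mrestr mu mD]_x f x = \int[mu]_(x in D) f x)%E.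
Proof.
move=> mf f0; rewrite -(setUv D) ge0_integral_setU//=; last 3 first.
- exact: measurableC.
- by rewrite setUv.
- by apply/disj_setPS; rewrite setICr.
rewrite [X in (_ + X)%E](_ : _ = 0)%E ?adde0; last first.
  rewrite -(integral_measure_zero (~` D) f); apply: eq_measure_integral => A mA AD.
  change (mu (A `&` D) = 0%E); rewrite (_ : A `&` D = set0) ?measure0//.
  by apply/seteqP; split => // x [/AD].
apply: eq_measure_integral => A mA AD.
by change (mu (A `&` D) = mu A); rewrite setIidl.
Qed.

Section finite_copy.
Context d (T : measurableType d) (R : realType).
Variables (mu : {measure set T -> \bar R}) (mu_fin : fin_num_fun mu).

(** An alias of [mu] indexed by the proof of finiteness, to which the structure of finite measure
    can be attached. *)
Definition finite_copy of fin_num_fun mu : set T -> \bar R := mu.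
HB.instance Definition _ := Measure.copy (finite_copy mu_fin) mu.
HB.instance Definition _ :=
  Measure_isFinite.Build d T R (finite_copy mu_fin) mu_fin.

End finite_copy.

(** * The Hausdorff moment problem *)

Section hausdorff.
Variables (R : realType) (a : nat -> R).
Hypothesis a_ge0 : forall j k, 0 <= mom a ('X^j * (1 - 'X) ^+ k).
Local Notation leb := (@lebesgue_measure R).

(** The functional [mom a] at the k-th Bernstein basis polynomial of degree n, thought of as the
    mass to be placed at k / n. *)
Definition bernstein_weight n k : R :=
  'C(n, k)%:R * mom a ('X^k * (1 - 'X) ^+ (n - k)).

Lemma bernstein_weight_ge0 n k : 0 <= bernstein_weight n k.
Proof. by rewrite mulr_ge0. Qed.

Lemma a0_ge0 : 0 <= a 0%N.
Proof. by have := a_ge0 0 0; rewrite !expr0 mulr1 -(expr0 'X) momXn. Qed.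

(** Trinomial revision: both sides count pairs of nested subsets of sizes m and k in a set of size
    n. *)
Lemma mul_bin_bin n k m : (m <= k)%N -> (k <= n)%N ->
  ('C(k, m) * 'C(n, k) = 'C(n, m) * 'C(n - m, k - m))%N.
Proof.
move=> mk kn; have mn := leq_trans mk kn.
apply/eqP; rewrite -(eqn_pmul2r (fact_gt0 m)) -(eqn_pmul2r (fact_gt0 (k - m))).
rewrite -(eqn_pmul2r (fact_gt0 (n - k))).
have h1 := bin_fact mk; have h2 := bin_fact kn; have h3 := bin_fact mn.
have := @bin_fact (n - m) (k - m) (leq_sub2r m kn).
have -> : (n - m - (k - m) = n - k)%N by lia.
move=> h4.
have -> : ('C(k, m) * 'C(n, k) * m`! * (k - m)`! * (n - k)`! =
  'C(n, k) * ('C(k, m) * (m`! * (k - m)`!) * (n - k)`!))%N by lia.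
rewrite h1 h2 -h3 -h4; apply/eqP; lia.
Qed.

(** Expanding X^m ((1 - X) + X)^(n - m) shows that the coefficients of X^m in the Bernstein basis of
    degree n are the ratios C(k, m) / C(n, m). *)
Lemma bernstein_moment n m : (m <= n)%N ->
  \sum_(k < n.+1) ('C(k, m)%:R / 'C(n, m)%:R) * bernstein_weight n k = a m.
Proof.
move=> mn.
have Cnm : ('C(n, m)%:R : R) != 0 by rewrite pnatr_eq0 -lt0n bin_gt0.
have pE : \sum_(0 <= k < n.+1) ('C(k, m) * 'C(n, k))%:R *:
    ('X^k * (1 - 'X : {poly R}) ^+ (n - k)) = 'C(n, m)%:R *: 'X^m.
  rewrite (@big_cat_nat _ _ _ m)//=; last exact: leqW.
  rewrite big_nat_cond big1 ?add0r; last first.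
    by move=> k /andP[/andP[_ km] _]; rewrite bin_small// mul0n scale0r.
  rewrite -{1}[m]add0n big_addn big_mkord subSn//.
  have -> : 'X^m = 'X^m * ((1 - 'X) + 'X) ^+ (n - m) :> {poly R}.
    by rewrite subrK expr1n mulr1.
  rewrite exprDn mulr_sumr scaler_sumr; apply: eq_bigr => k _.
  have kn : (k <= n - m)%N by rewrite -ltnS.
  rewrite mul_bin_bin ?leq_addl//; last by lia.
  rewrite addnK natrM -scalerA; congr (_ *: _).
  have -> : (n - (k + m) = n - m - k)%N by lia.
  by rewrite exprD scaler_nat mulrnAr; congr (_ *+ _); ring.
apply: (mulfI Cnm); rewrite -[in RHS](momXn a) -linearZ/= -pE linear_sum mulr_sumr.
rewrite big_mkord; apply: eq_bigr => k _.
by rewrite linearZ/= natrM /bernstein_weight; field.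
Qed.

Lemma bin_ratioS n k m : (m < n)%N -> (k <= n)%N ->
  'C(k, m.+1)%:R / 'C(n, m.+1)%:R =
  'C(k, m)%:R / 'C(n, m)%:R * ((k - m)%:R / (n - m)%:R) :> R.
Proof.
move=> mn kn.
have c1 : ('C(n, m)%:R : R) != 0 by rewrite pnatr_eq0 -lt0n bin_gt0 ltnW.
have c2 : ('C(n, m.+1)%:R : R) != 0 by rewrite pnatr_eq0 -lt0n bin_gt0.
have c3 : ((n - m)%:R : R) != 0 by rewrite pnatr_eq0 subn_eq0 -ltnNge.
have c4 : (m.+1%:R : R) != 0 by rewrite pnatr_eq0.
have h1 : m.+1%:R * 'C(k, m.+1)%:R = (k - m)%:R * 'C(k, m)%:R :> R.
  by rewrite -!natrM mul_bin_left.
have h2 : m.+1%:R * 'C(n, m.+1)%:R = (n - m)%:R * 'C(n, m)%:R :> R.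
  by rewrite -!natrM mul_bin_left.
rewrite mulrACA [_ * (k - m)%:R]mulrC -h1 -invfM [_ * (n - m)%:R]mulrC -h2.
by field; rewrite ?c2 ?c4 ?nat1r.
Qed.

(** The ratio is the product over i < m of (k - i) / (n - i). Each factor lies in [0, 1] and within
    i / n of k / n, so the errors simply add up. *)
Lemma bin_ratio_approx n k m : (m <= n)%N -> (0 < n)%N -> (k <= n)%N ->
  (0 <= ('C(k, m)%:R / 'C(n, m)%:R : R) <= 1) /\
  `|'C(k, m)%:R / 'C(n, m)%:R - (k%:R / n%:R) ^+ m : R| <= (m ^ 2)%:R / n%:R.
Proof.
move=> + n0 kn; elim: m => [_|m IH mn].
  by rewrite !bin0 expr0 divr1 subrr normr0 mul0r lexx ler01.
have [/andP[c0 c1] IH2] := IH (ltnW mn).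
rewrite bin_ratioS//.
set c := 'C(k, m)%:R / 'C(n, m)%:R in c0 c1 IH2 *.
set x := (k%:R / n%:R : R) in IH2 *; set y := ((k - m)%:R / (n - m)%:R : R).
have n0' : 0 < (n%:R : R) by rewrite ltr0n.
have nm0' : 0 < ((n - m)%:R : R) by rewrite ltr0n subn_gt0.
have y0 : 0 <= y by rewrite divr_ge0.
have y1 : y <= 1 by rewrite ler_pdivrMr// mul1r ler_nat leq_sub2r.
have x0 : 0 <= x by rewrite divr_ge0.
have x1 : x <= 1 by rewrite ler_pdivrMr// mul1r ler_nat.
have xy : `|y - x| <= m%:R / n%:R.
  (* For k < m the truncated difference k - m is 0, and k / n is itself at most m / n. *)
  have [mk|km] := leqP m k; last first.
    rewrite /y (eqP (ltnW km : k - m == 0)%N) mul0r sub0r normrN ger0_norm//.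
    by rewrite ler_wpM2r ?invr_ge0// ler_nat ltnW.
  have -> : y - x = - (m%:R / n%:R * ((n - k)%:R / (n - m)%:R)).
    rewrite /y /x !natrB// ?(ltnW mn)//; field.
    by rewrite -natrB ?(ltnW mn)// !gt_eqF.
  rewrite normrN ger0_norm ?mulr_ge0 ?divr_ge0// ler_piMr ?divr_ge0//.
  by rewrite ler_pdivrMr// mul1r ler_nat leq_sub2l.
split; first by rewrite mulr_ge0//= mulr_ile1.
rewrite exprSr.
have -> : c * y - x ^+ m * x = c * (y - x) + (c - x ^+ m) * x by ring.
apply: (le_trans (ler_normD _ _)); rewrite (normrM c) (normrM _ x) (ger0_norm c0) (ger0_norm x0).
have h1 : c * `|y - x| <= m%:R / n%:R by rewrite (le_trans _ xy)// ler_piMl.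
have h2 : `|c - x ^+ m| * x <= (m ^ 2)%:R / n%:R.
  by rewrite (le_trans _ IH2)// ler_piMr.
rewrite (le_trans (lerD h1 h2))// -mulrDl ler_wpM2r ?invr_ge0// -natrD ler_nat.
by clear; rewrite -[m.+1]addn1 sqrnD; lia.
Qed.

Lemma bernstein_sum_cvg m :
  \sum_(k < n.+1) (k%:R / n%:R) ^+ m * bernstein_weight n k @[n --> \oo] --> a m.
Proof.
apply/cvgrPdist_le => e e0.
near=> n.
have mn : (m <= n)%N by near: n; exact: nbhs_infty_ge.
have n0 : (0 < n)%N by near: n; exact: nbhs_infty_gt.
rewrite -{1}(bernstein_moment mn) -sumrB.
rewrite (le_trans (ler_norm_sum _ _ _))//.
(* The factor C(k, 0) / C(n, 0) is 1; it lets [bernstein_moment] at exponent 0 sum the weights to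
   [a 0]. *)
have b k : (k < n.+1)%N ->
    `|'C(k, m)%:R / 'C(n, m)%:R * bernstein_weight n k -
      (k%:R / n%:R) ^+ m * bernstein_weight n k| <=
    (m ^ 2)%:R / n%:R * ('C(k, 0)%:R / 'C(n, 0)%:R * bernstein_weight n k).
  move=> kn; rewrite -mulrBl normrM (ger0_norm (bernstein_weight_ge0 _ _)).
  rewrite !bin0 divr1 mul1r ler_wpM2r ?bernstein_weight_ge0//.
  by have [] := @bin_ratio_approx n k m mn n0 kn.
rewrite (le_trans (ler_sum _ (fun (k : 'I_n.+1) _ => b k (ltn_ord k))))//.
rewrite -mulr_sumr bernstein_moment// mulrAC ler_pdivrMr ?ltr0n// [e * _]mulrC.
rewrite -ler_pdivrMr//.
near: n; apply: nbhs_infty_ger.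
Unshelve. all: by end_near. Qed.

Definition bernstein_cdf n k := \sum_(j < k) bernstein_weight n j.

Lemma bernstein_cdf_nd n : {homo bernstein_cdf n : i j / (i <= j)%N >-> i <= j}.
Proof.
apply: homo_leq => [//|y x z|k]; first exact: le_trans.
by rewrite /bernstein_cdf big_ord_recr/= lerDl bernstein_weight_ge0.
Qed.

Lemma bernstein_cdf_max n : bernstein_cdf n n.+1 = a 0%N.
Proof.
rewrite -(bernstein_moment (leq0n n)); apply: eq_bigr => k _.
by rewrite !bin0 divr1 mul1r.
Qed.

(** The generalized inverse of the distribution function, in counting form: it is k / n on ]cdf k,
    cdf (k + 1)]. Counting over k < n keeps it at most 1 for every real u, including u > a 0. *)
Definition bernstein_quantile n (u : R) : R :=
  (\sum_(k < n) (bernstein_cdf n k.+1 < u)%R : nat)%:R / n%:R.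

Lemma bernstein_quantile_unit_nd n m :
  unit_nd (fun u => bernstein_quantile n u ^+ m).
Proof.
have q01 u : 0 <= bernstein_quantile n u <= 1.
  rewrite /bernstein_quantile divr_ge0//=; have [->|n0] := posnP n.
    by rewrite invr0 mulr0.
  rewrite ler_pdivrMr ?ltr0n// mul1r ler_nat -[leqRHS]card_ord -sum1_card.
  by apply: leq_sum => i _; exact: leq_b1.
split => [u v uv|u]; last first.
  by have /andP[q0 q1] := q01 u; rewrite exprn_ge0// exprn_ile1.
have /andP[qu _] := q01 u; have /andP[qv _] := q01 v.
apply: lerXn2r; rewrite ?nnegrE//.
rewrite ler_wpM2r ?invr_ge0// ler_nat; apply: leq_sum => k _.
by case: ltP => // /lt_le_trans/(_ uv) ->.
Qed.

Lemma bernstein_quantileE n k u : (k <= n)%N ->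
  bernstein_cdf n k < u <= bernstein_cdf n k.+1 ->
  bernstein_quantile n u = k%:R / n%:R.
Proof.
move=> kn /andP[ku uk]; rewrite /bernstein_quantile; congr (_%:R / _).
have -> : (\sum_(j < n) (bernstein_cdf n j.+1 < u)%R = \sum_(j < n | j < k) 1)%N.
  rewrite [RHS]big_mkcond/=; apply: eq_bigr => j _; case: ltnP => jk.
    by rewrite (le_lt_trans (bernstein_cdf_nd n jk) ku).
  by rewrite ltNge (le_trans uk)// bernstein_cdf_nd.
by rewrite -(big_ord_widen _ (fun=> 1%N) kn) sum1_card card_ord.
Qed.

Lemma Rintegral_bernstein_quantile n m :
  \int[leb]_(u in `]0, a 0%N]) bernstein_quantile n u ^+ m =
  \sum_(k < n.+1) (k%:R / n%:R) ^+ m * bernstein_weight n k.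
Proof.
rewrite -(bernstein_cdf_max n).
suff : forall j, (j <= n.+1)%N ->
    \int[leb]_(u in `]0, bernstein_cdf n j]) bernstein_quantile n u ^+ m =
    \sum_(k < j) (k%:R / n%:R) ^+ m * bernstein_weight n k by exact.
elim=> [_|j IH jn].
  by rewrite /bernstein_cdf !big_ord0 set_itv_ge ?bnd_simp ?ltxx// Rintegral_set0.
have j0 : 0 <= bernstein_cdf n j by apply: sumr_ge0 => i _; exact: bernstein_weight_ge0.
rewrite (Rintegral_oc_cat (bernstein_quantile_unit_nd _ _) j0); last exact: bernstein_cdf_nd.
rewrite IH 1?ltnW// big_ord_recr/=; congr (_ + _).
under eq_Rintegral.
  move=> u; rewrite inE/= in_itv/= => uj; rewrite (bernstein_quantileE _ uj)//.
  over.
rewrite Rintegral_cst// fine_leb_oc ?bernstein_cdf_nd//.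
by rewrite /bernstein_cdf big_ord_recr/= addrAC subrr add0r.
Qed.

(* The Bernstein weights are discrete measures on the points k / n, and their
   moments tend to a. Helly's selection theorem is replaced by a pointwise
   ultrafilter limit Q of their quantile functions: the solution is the image
   of Lebesgue measure on ]0, a 0] under r Q. *)
Lemma hausdorff_moment (r : R) : 0 < r ->
  exists mu : {finite_measure set R -> \bar R},
  mu (~` `[0, r]%classic) = 0%E /\ forall n, \int[mu]_x x ^+ n = a n * r ^+ n.
Proof.
move=> r0.
have [U [UU ooU]] := @ultraFilterLemma _ (\oo : set_system nat) _.
have PU : ProperFilter U by exact: ultra_proper.
have q01 n u : bernstein_quantile n u \in `[0, 1].
  have [_ /(_ u)] := bernstein_quantile_unit_nd n 1.
  by rewrite in_itv/= expr1.
have /choice[Q Qlim] u : exists l : R, bernstein_quantile n u @[n --> U] --> l.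
  have : compact (`[0, 1]%classic : set R) by exact: segment_compact.
  rewrite compact_ultra => /(_ (bernstein_quantile n u @[n --> U])).
  have fU : UltraFilter (bernstein_quantile n u @[n --> U]) by exact: ultra_fmap.
  case/(_ fU); last by move=> l [_]; exists l.
  by apply: (@filterE _ U) => n; exact: q01.
have Q_nd m : unit_nd (fun u => Q u ^+ m).
  have Q01 u : 0 <= Q u <= 1.
    have : Q u \in `[0, 1]; last by rewrite in_itv.
    have cl : closed (`[0, 1]%classic : set R) by exact: interval_closed.
    apply: (closed_cvg _ cl _ _ (Qlim u)).
    by apply: (@filterE _ U) => n; exact: q01.
  split => [u v uv|u]; last first.
    by have /andP[q0 q1] := Q01 u; rewrite exprn_ge0// exprn_ile1.
  have /andP[qu _] := Q01 u; have /andP[qv _] := Q01 v.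
  apply: lerXn2r; rewrite ?nnegrE// -subr_ge0.
  have cl : closed [set x : R | 0 <= x] by exact: closed_ge.
  apply: (closed_cvg _ cl _ _ (cvgB (Qlim v) (Qlim u))).
  apply: (@filterE _ U) => n /=; rewrite fctE/= subr_ge0.
  by have [/(_ u v uv)] := bernstein_quantile_unit_nd n 1.
have QlimX m u : bernstein_quantile n u ^+ m @[n --> U] --> Q u ^+ m.
  exact: (cvg_comp _ _ (Qlim u) (@exprn_continuous _ m (Q u))).
(* The same integrals have two limits along [U]: the integral of the limit, by monotonicity, and
   [a m], because they are Bernstein sums and [U] refines the filter at infinity. *)
have Qint m : \int[leb]_(u in `]0, a 0%N]) Q u ^+ m = a m.
  have h1 : \int[leb]_(u in `]0, a 0%N]) bernstein_quantile n u ^+ m @[n --> U]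
      --> \int[leb]_(u in `]0, a 0%N]) Q u ^+ m.
    apply: (@cvg_Rintegral_unit_nd _ _ U _ (fun n u => bernstein_quantile n u ^+ m)).
    - exact: a0_ge0.
    - by move=> n; exact: bernstein_quantile_unit_nd.
    - exact: Q_nd.
    - by move=> u; exact: QlimX.
  have h2 : \int[leb]_(u in `]0, a 0%N]) bernstein_quantile n u ^+ m @[n --> U]
      --> a m.
    under eq_fun do rewrite Rintegral_bernstein_quantile.
    by apply: cvg_trans (@bernstein_sum_cvg m); exact: cvg_app ooU.
  by apply: (cvg_unique _ h1 h2); exact: norm_hausdorff.
have mQ : measurable_fun setT Q.
  by have := unit_nd_measurable measurableT (Q_nd 1%N).
have mD : measurable (`]0, a 0%N]%classic : set R) by [].
have mrQ : measurable_fun setT (fun u => r * Q u) by exact: measurable_funM.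
have mQV A : measurable A -> measurable ((fun u => r * Q u) @^-1` A).
  by move=> mA; rewrite -[X in measurable X]setTI; exact: mrQ.
pose mu : {measure set R -> \bar R} :=
  measure_function_pushforward__canonical__measure_function_Measure
    (mrestr leb mD) mrQ.
have mu_fin : fin_num_fun mu.
  move=> A mA; rewrite ge0_fin_numE//.
  apply: le_lt_trans (leb_oc_lty 0 (a 0%N)); apply: le_measure; rewrite ?inE//.
  by apply: measurableI => //; exact: mQV.
exists (finite_copy mu_fin); split.
  change (leb ((fun u => r * Q u)%R @^-1` (~` `[0%R, r]) `&` `]0%R, a 0%N]) = 0)%E.
  rewrite (_ : _ `&` _ = set0) ?measure0//; apply/seteqP; split => // u [+ _].
  move=> /=; have [_ /(_ u)/andP[q0 q1]] := Q_nd 1%N.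
  rewrite !expr1 in q0 q1; apply.
  rewrite in_itv/=; apply/andP; split; first exact: mulr_ge0 (ltW r0) q0.
  by rewrite ger_pMr.
move=> n.
have -> : \int[finite_copy mu_fin]_x x ^+ n = fine (\int[mu]_x (x ^+ n)%:E)%E.
  by congr fine; apply: eq_measure_integral.
have mQn : measurable_fun setT (fun u => Q u ^+ n).
  exact: unit_nd_measurable (Q_nd n).
rewrite integral_pushforward//; last 2 first.
- by apply/measurable_EFinP; exact: exprn_measurable.
- rewrite preimage_setT; apply: measurable_bounded_integrable => //.
  + by change (leb (setT `&` `]0%R, a 0%N]) < +oo)%E; rewrite setTI leb_oc_lty.
  + exact: measurable_funX.
  exists (r ^+ n); split; [exact: num_real|move=> M M1 u _ /=].
  have [_ /(_ u)/andP[q0 q1]] := Q_nd n.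
  have rn := exprn_ge0 n (ltW r0).
  rewrite exprMn ger0_norm; last exact: mulr_ge0.
  by rewrite (le_trans _ (ltW M1))// ler_piMr.
rewrite ?preimage_setT integral_mrestr.
- transitivity (\int[leb]_(u in `]0, a 0%N]) (r ^+ n * Q u ^+ n)).
    by apply: eq_Rintegral => u _ /=; rewrite exprMn.
  by rewrite RintegralZl ?Qint 1?mulrC//; exact: unit_nd_integrable (Q_nd n).
- by apply/measurable_EFinP; exact: measurable_funX.
- move=> u /=; have [_ /(_ u)/andP[q0 q1]] := Q_nd n.
  by rewrite lee_fin exprMn mulr_ge0// exprn_ge0// ltW.
Qed.

End hausdorff.

Section stieltjes.
Variable R : realType.
Implicit Types (a : nat -> R) (p q : {poly R}).

Lemma momZl a k p : mom (fun n => k * a n) p = k * mom a p.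
Proof. by rewrite /mom mulr_sumr; apply: eq_bigr => i _; rewrite mulrCA. Qed.

Lemma mom_scale a s p :
  mom (fun n => a n * s ^+ n) p = mom a (p \Po (s *: 'X)).
Proof.
rewrite comp_polyE linear_sum /mom; apply: eq_bigr => i _.
by rewrite linearZ/= exprZn linearZ/= momXn; ring.
Qed.

(** The dilation x -> x / r turns geometric growth into boundedness and preserves both positivity
    conditions; [mom_hausdorff] then applies. *)
Lemma stieltjes_moment a (c r : R) : 0 < r ->
  pos_def a -> pos_def (fun n => a n.+1) -> (forall n, `|a n| <= c * r ^+ n) ->
  exists mu : {finite_measure set R -> \bar R},
    mu (~` `[0, r]%classic) = 0%E /\ forall n, \int[mu]_x x ^+ n = a n.
Proof.
move=> r0 pa pSa ac; pose b n := a n * r^-1 ^+ n.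
have rn0 n : r ^+ n != 0 by rewrite expf_neq0// gt_eqF.
have pb : pos_def b.
  by move=> q; rewrite mom_scale rmorphXn; exact: pa.
have pSb : pos_def (fun n => b n.+1).
  move=> q.
  have -> : (fun n => b n.+1) = (fun n => r^-1 * (a n.+1 * r^-1 ^+ n)).
    by apply/funext => n; rewrite /b exprS; ring.
  rewrite momZl mulr_ge0 ?invr_ge0 ?(ltW r0)// (mom_scale (fun n => a n.+1)).
  by rewrite rmorphXn; exact: pSa.
have bc n : `|b n| <= c.
  have rn : 0 < r ^+ n by rewrite exprn_gt0.
  by rewrite /b exprVn normrM (@gtr0_norm _ _^-1) ?invr_gt0// ler_pdivrMr.
have [mu [mu0 mub]] := hausdorff_moment (mom_hausdorff pb pSb bc) r0.
exists mu; split => // n.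
by rewrite mub /b exprVn mulfVK.
Qed.

End stieltjes.

Section concentrated.
Context d (T : measurableType d) (R : realType).
Variables (mu : {finite_measure set T -> \bar R}) (D : set T).
Hypotheses (mD : measurable D) (muD : mu (~` D) = 0%E).

Lemma measure_concentrated (A : set T) : measurable A -> mu (A `&` D) = mu A.
Proof.
move=> mA; rewrite [RHS](measureDI mu mA mD) [X in (X + _)%E](_ : _ = 0%E) ?add0e//.
apply: (subset_measure0 _ _ _ muD).
- exact: measurableD.
- exact: measurableC.
- by move=> x [].
Qed.

Lemma bounded_on_integrable (f : T -> R) M : measurable_fun setT f ->
  (forall x, D x -> `|f x| <= M) -> mu.-integrable setT (EFin \o f).
Proof.
move=> mf fM.
have iD : mu.-integrable D (EFin \o f).
  apply: measurable_bounded_integrable => //.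
  - by rewrite ltey_eq fin_num_measure.
  - exact: measurable_funTS.
  - by exists M; split; [exact: num_real|move=> N MN x Dx /=; rewrite (le_trans (fM _ Dx))// ltW].
apply/(@negligible_integrable _ _ _ mu setT (~` D)) => //.
- exact: measurableC.
- by apply/measurable_EFinP.
- by rewrite setTD setCK.
Qed.

Lemma Rintegral_concentrated (f : T -> R) M : measurable_fun setT f ->
  (forall x, D x -> `|f x| <= M) -> \int[mu]_x f x = \int[mu]_(x in D) f x.
Proof.
move=> mf fM; congr fine.
rewrite (@negligible_integral _ _ _ mu setT (~` D)) ?setTD ?setCK//.
- exact: measurableC.
- exact: bounded_on_integrable mf fM.
Qed.

End concentrated.

(** * Determinacy of moments on a compact interval *)

Section determinacy.
Variable R : realType.
Implicit Types mu nu : {finite_measure set R -> \bar R}.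

Lemma concentrated_itv_integrable mu (r : R) (p : {poly R}) :
  mu (~` `[- r, r]%classic) = 0%E -> mu.-integrable setT (EFin \o horner p).
Proof.
move=> mur.
apply: (@bounded_on_integrable _ _ _ mu `[- r, r]%classic _ mur _
   (\sum_(i < size p) `|p`_i| * r ^+ i)) => //.
- apply: continuous_measurable_fun; exact: continuous_horner.
- move=> x; rewrite /= in_itv/= -ler_norml => xr.
  rewrite horner_coef (le_trans (ler_norm_sum _ _ _))// ler_sum// => i _.
  by rewrite normrM normrX ler_wpM2l// lerXn2r ?nnegrE// (le_trans _ xr).
Qed.

Lemma Rintegral_horner mu (r : R) (p : {poly R}) :
  mu (~` `[- r, r]%classic) = 0%E ->
  \int[mu]_x p.[x] = mom (fun n => \int[mu]_x x ^+ n) p.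
Proof.
move=> mur.
have iX k : mu.-integrable setT (EFin \o (fun x => x ^+ k)).
  have := concentrated_itv_integrable 'X^k mur.
  by rewrite (_ : horner 'X^k = fun x => x ^+ k)//; apply/funext => x; rewrite hornerXn.
suff h n : (n <= size p)%N -> \int[mu]_x (\sum_(i < n) p`_i * x ^+ i) =
    \sum_(i < n) p`_i * \int[mu]_x x ^+ i.
  rewrite /mom -h//; apply: eq_Rintegral => x _; exact: horner_coef.
elim: n => [_|n IH np].
  by under eq_Rintegral do rewrite big_ord0; rewrite Rintegral_cst// mul0r big_ord0.
under eq_Rintegral do rewrite big_ord_recr/=.
rewrite RintegralD//.
- by rewrite IH 1?ltnW// big_ord_recr/= RintegralZl.
- have := concentrated_itv_integrable (\poly_(i < n) p`_i) mur.
  rewrite (_ : horner _ = fun x => \sum_(i < n) p`_i * x ^+ i)//.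
  by apply/funext => x; rewrite horner_poly.
- have := concentrated_itv_integrable (p`_n *: 'X^n) mur.
  rewrite (_ : horner _ = fun x => p`_n * x ^+ n)//.
  by apply/funext => x; rewrite hornerZ hornerXn.
Qed.

(* On [0, 1] these polynomials in y stay in [0, 1] and converge to the
   indicator function of y < 1/2. *)
Definition bump (n : nat) (y : R) : R := (1 - y ^+ n) ^+ (n * 2 ^ n).

Lemma bump_ge (n m : nat) (z : R) : 0 <= z <= 1 -> 1 - m%:R * z <= (1 - z) ^+ m.
Proof.
move=> /andP[z0 z1]; elim: m => [|m IH]; first by rewrite mul0r subr0 expr0.
rewrite exprSr; have : (1 - m%:R * z) * (1 - z) <= (1 - z) ^+ m * (1 - z).
  by rewrite ler_wpM2r// subr_ge0.
have : 0 <= m%:R * z * z by rewrite !mulr_ge0.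
rewrite -natr1; lra.
Qed.

Lemma bump_le (m : nat) (z : R) : 0 <= z <= 1 ->
  (1 - z) ^+ m * (1 + m%:R * z) <= 1.
Proof.
move=> /andP[z0 z1].
have h : 1 + m%:R * z <= (1 + z) ^+ m.
  elim: m => [|m IH]; first by rewrite mul0r addr0 expr0.
  rewrite exprSr; have : (1 + m%:R * z) * (1 + z) <= (1 + z) ^+ m * (1 + z).
    by rewrite ler_wpM2r// addr_ge0.
  have : 0 <= m%:R * z * z by rewrite !mulr_ge0.
  rewrite -natr1; lra.
rewrite (le_trans (ler_wpM2l _ h)) ?exprn_ge0 ?subr_ge0// -exprMn.
rewrite exprn_ile1//; nra.
Qed.

Lemma bump01 n y : 0 <= y <= 1 -> 0 <= bump n y <= 1.
Proof.
move=> /andP[y0 y1]; have yn := exprn_ile1 n y0 y1.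
have yn0 := exprn_ge0 n y0.
by rewrite exprn_ge0 ?exprn_ile1//; lra.
Qed.

(** Write q = s^2: the factor n s^n stays below 1 / (1 - s), and the remaining s^n tends to 0. *)
Lemma cvg_natmul_exprn (q : R) : 0 <= q < 1 -> n%:R * q ^+ n @[n --> \oo] --> 0.
Proof.
move=> /andP[q0 q1]; pose s := Num.sqrt q.
have s0 : 0 <= s by exact: sqrtr_ge0.
have s1 : s < 1 by rewrite -[ltRHS]sqrtr1 ltr_sqrt.
have ss : q = s * s by rewrite -expr2 sqr_sqrtr.
have h n : n%:R * s ^+ n * (1 - s) + s ^+ n <= 1.
  elim: n => [|n IH]; first by rewrite !mul0r expr0 add0r.
  rewrite exprS -natr1.
  have sn1 : s * s ^+ n <= 1 by rewrite -exprS exprn_ile1// ltW.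
  have -> : (n%:R + 1) * (s * s ^+ n) * (1 - s) + s * s ^+ n =
    s * (n%:R * s ^+ n * (1 - s) + s ^+ n) + s * s ^+ n * (1 - s) by ring.
  have := ler_wpM2l s0 IH; have : s * s ^+ n * (1 - s) <= 1 * (1 - s).
    by rewrite ler_wpM2r// subr_ge0 ltW.
  lra.
apply: (@squeeze_cvgr _ _ _ _ (fun=> 0) (geometric (1 - s)^-1 s)).
- near=> n; rewrite mulr_ge0 ?exprn_ge0//= ss exprMn mulrA ler_wpM2r ?exprn_ge0//.
  rewrite -[leRHS]mul1r ler_pdivlMr ?subr_gt0//.
  by apply: le_trans (h n); rewrite lerDl exprn_ge0.
- exact: cvg_cst.
- by apply: cvg_geometric; rewrite ger0_norm.
Unshelve. all: by end_near. Qed.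

(** With m = n 2^n and z = y^n, Bernoulli gives 1 - m z <= (1 - z)^m <= 1 / (1 + m z), where m z = n
    (2 y)^n. This tends to 0 for y < 1/2 and is at least n for y >= 1/2; the extra factor n in the
    exponent sends y = 1/2 to 0, so that the limit is the indicator of an open half-line. *)
Lemma bump_cvg y : 0 <= y <= 1 ->
  bump n y @[n --> \oo] --> ((y < 2^-1)%R%:R : R).
Proof.
move=> /andP[y0 y1].
have yn n : 0 <= y ^+ n <= 1 by rewrite exprn_ge0//= exprn_ile1.
case: ltP => y2.
  apply: (@squeeze_cvgr _ _ _ _ (fun n => 1 - n%:R * (2 * y) ^+ n) (fun=> 1)).
  - near=> n; have := @bump_ge n (n * 2 ^ n) (y ^+ n) (yn n).
    rewrite natrM natrX -mulrA -exprMn => ->/=.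
    by have /andP[] : 0 <= bump n y <= 1 by apply: bump01; rewrite y0.
  - rewrite -[X in _ --> X]subr0; apply: cvgB; first exact: cvg_cst.
    by apply: cvg_natmul_exprn; lra.
  - exact: cvg_cst.
apply: (@squeeze_cvgr _ _ _ _ (fun=> 0) (fun n => n.+1%:R^-1)).
- near=> n; have /andP[-> _] : 0 <= bump n y <= 1 by apply: bump01; rewrite y0.
  rewrite /= -[leRHS]mul1r ler_pdivlMr ?ltr0n//.
  apply: le_trans (bump_le (n * 2 ^ n) (yn n)).
  rewrite ler_wpM2l//; first by rewrite exprn_ge0// subr_ge0; case/andP: (yn n).
  rewrite -nat1r lerD2l natrM natrX -mulrA -exprMn ler_peMr//.
  by rewrite exprn_ege1// -ler_pdivrMl// mulr1.
- exact: cvg_cst.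
- exact: cvg_harmonic.
Unshelve. all: by end_near. Qed.

(* The polynomials do not depend on mu, so evaluating them at operator moments
   produces operators. *)
Lemma half_line_moments (r t : R) : exists p : nat -> {poly R},
  forall mu, mu (~` `[- r, r]%classic) = 0%E ->
  mom (fun n => \int[mu]_x x ^+ n) (p n) @[n --> \oo] -->
    fine (mu `]-oo, t[%classic).
Proof.
pose c : R := 2 * (`|r| + `|t|) + 1.
(* The scale [c] ensures |x - t| <= c / 2 on [- r, r], so that the affine map [l] sends this
   interval into [0, 1] and [t] to 1/2; the summand 1 keeps it positive. *)
have c0 : 0 < c by rewrite ltr_pwDr// mulr_ge0// addr_ge0.
pose l (x : R) := c^-1 * (x - t) + 2^-1.
have [L LE] : exists L : {poly R}, forall x, L.[x] = l x.
  by exists (c^-1 *: ('X - t%:P) + 2^-1%:P) => x; rewrite !hornerE.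
have l01 x : x \in `[- r, r] -> 0 <= l x <= 1.
  rewrite in_itv/= -ler_norml => xr.
  have : `|x - t| <= c / 2.
    rewrite (le_trans (ler_normB _ _))// ler_pdivlMr// /c.
    have := ler_norm r; lra.
  rewrite ler_norml -[c / 2]mulrC => /andP[h1 h2].
  have : - 2^-1 <= c^-1 * (x - t) <= 2^-1.
    by rewrite ler_pdivlMl// ler_pdivrMl// [c * 2^-1]mulrC mulrN [c * 2^-1]mulrC h1.
  rewrite /l; lra.
have lt x : (l x < 2^-1) = (x < t).
  by rewrite /l -subr_gt0 opprD addrCA subrr addr0 -mulrN pmulr_rgt0 ?invr_gt0// opprB subr_gt0.
exists (fun n => (1 - L ^+ n) ^+ (n * 2 ^ n)) => mu mur.
have pE n x : ((1 - L ^+ n) ^+ (n * 2 ^ n)).[x] = bump n (l x).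
  by rewrite /bump !(horner_exp, hornerE) LE.
have mb n : measurable_fun setT (fun x => bump n (l x)).
  rewrite (_ : (fun x => _) = horner ((1 - L ^+ n) ^+ (n * 2 ^ n))).
    by apply: continuous_measurable_fun; exact: continuous_horner.
  by apply/funext => x; rewrite pE.
have mD : measurable (`[- r, r]%classic : set R) by [].
have iE : (\int[mu]_(x in `[(- r)%R, r]) (\1_(`]-oo, t[%classic) x)%:E =
    mu `]-oo, t[%classic)%E.
  by rewrite integral_indic//; exact: measure_concentrated.
have mE n : mom (fun n => \int[mu]_x x ^+ n) ((1 - L ^+ n) ^+ (n * 2 ^ n)) =
    \int[mu]_(x in `[- r, r]) bump n (l x).
  rewrite -(Rintegral_horner _ mur).
  under eq_Rintegral do rewrite pE.
  apply: (@Rintegral_concentrated _ _ _ mu `[- r, r]%classic mD mur _ 1) => // x.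
  by move=> /l01 /(bump01 n)/andP[b0 b1]; rewrite ger0_norm.
rewrite (_ : (fun n => _) = (fun n => \int[mu]_(x in `[- r, r]) bump n (l x))); last first.
  exact/funext.
apply: fine_cvg.
rewrite fineK ?fin_num_measure// -iE.
apply: (@dominated_cvg _ _ _ mu _ mD _ _ (cst 1%E)).
- by move=> n; apply/measurable_EFinP; exact: measurable_funTS.
- move=> x /= /l01 lx; apply: cvg_EFin; first by near=> n.
  have := bump_cvg lx; rewrite lt indicE mem_setE in_itv/=.
  exact.
- by [].
- apply: (@measurable_bounded_integrable _ _ _ mu (cst 1)) => //.
    by rewrite ltey_eq fin_num_measure.
  by exists 1; split => // M M1 x _; rewrite /= normr1 ltW.
- by move=> n x /l01 /(bump01 n)/andP[b0 b1]; rewrite lee_fin ger0_norm.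
Unshelve. all: by end_near. Qed.

End determinacy.

Local Open Scope complex_scope.

(** * Hilbert space operators and quadratic forms *)

Section complex_modulus.
Variable R : realType.
Implicit Types (z w : R[i]) (r s : R).

(** Norms over R[i] take their values in R[i]; taking real parts brings estimates and limits back to
    R. *)
Definition cmod z : R := complex.Re `|z|.

Lemma norm_cmod z : `|z| = (cmod z)%:C.
Proof. by rewrite /cmod RRe_real// ger0_real. Qed.

Lemma complexr_inj : injective (@real_complex R).
Proof. by move=> x y []. Qed.

Lemma cmod_ge0 z : 0 <= cmod z.
Proof. by rewrite -lecR -norm_cmod normr_ge0. Qed.

Lemma cmodM z w : cmod (z * w) = cmod z * cmod w.
Proof. by apply: complexr_inj; rewrite rmorphM/= -!norm_cmod normrM. Qed.

Lemma cmodX z n : cmod (z ^+ n) = cmod z ^+ n.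
Proof. by apply: complexr_inj; rewrite rmorphXn/= -!norm_cmod normrX. Qed.

Lemma cmodV z : cmod z^-1 = (cmod z)^-1.
Proof. by apply: complexr_inj; rewrite fmorphV/= -!norm_cmod normfV. Qed.

Lemma cmodD z w : cmod (z + w) <= cmod z + cmod w.
Proof. by rewrite -lecR rmorphD/= -!norm_cmod ler_normD. Qed.

Lemma cmodN z : cmod (- z) = cmod z.
Proof. by rewrite /cmod normrN. Qed.

Lemma cmod_real r : cmod r%:C = `|r|.
Proof. by rewrite /cmod normc_def/= expr0n/= addr0 sqrtr_sqr. Qed.

Lemma cmod0 : cmod 0 = 0. Proof. by rewrite /cmod normr0. Qed.

Lemma cmod1 : cmod 1 = 1. Proof. by rewrite /cmod normr1. Qed.

Definition ci : R[i] := 0 +i* 1.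

Lemma cmod_i : cmod ci = 1.
Proof. by rewrite /cmod normc_def/= expr0n/= expr1n add0r sqrtr1. Qed.

Lemma cmod_eq0 z : cmod z = 0 -> z = 0.
Proof. by move=> z0; apply/eqP; rewrite -normr_eq0 norm_cmod z0. Qed.

Lemma Re_le_cmod z : `|complex.Re z| <= cmod z.
Proof. by rewrite -lecR -norm_cmod normc_ge_Re. Qed.

Lemma cmod_conj z : cmod (z^*)%R = cmod z.
Proof. by rewrite /cmod normcJ. Qed.

Lemma cmodsq z : (cmod z ^+ 2)%:C = z * z^*.
Proof. by rewrite rmorphXn/= -norm_cmod sqr_normc. Qed.

Lemma Re_scale r z : complex.Re (r%:C * z) = r * complex.Re z.
Proof. by case: z => a b /=; rewrite mul0r subr0. Qed.

Lemma conj_real r : ((r%:C)^*)%R = r%:C.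
Proof. by change (r%:C^*%C = r%:C); rewrite /= oppr0. Qed.

Lemma Re_add z w : complex.Re (z + w) = complex.Re z + complex.Re w.
Proof. by rewrite raddfD. Qed.

Lemma Re_conj z : complex.Re (z^*)%R = complex.Re z.
Proof. by case: z. Qed.

Lemma conj_i : (ci^*)%R = - ci.
Proof. by change (ci^*%C = - ci); rewrite /ci; apply/eqP; rewrite eq_complex/= oppr0 !eqxx. Qed.

Lemma ci_sq : ci * ci = -1.
Proof.
rewrite /ci; apply/eqP; rewrite eq_complex/=.
by rewrite !(mul0r, mulr0, mul1r, sub0r, addr0, oppr0) !eqxx.
Qed.

Lemma Re_mulNi z : complex.Re (- ci * z) = complex.Im z.
Proof. by case: z => a b /=; rewrite !(mul0r, mulN1r, oppr0, sub0r, mul1r, opprK). Qed.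

(** Multiplication by [- ci] exposes the imaginary part, so complex-linear functionals with equal
    real parts coincide. *)
Lemma complex_eq_Re z w :
  complex.Re z = complex.Re w -> complex.Re (- ci * z) = complex.Re (- ci * w) ->
  z = w.
Proof.
by rewrite !Re_mulNi => e1 e2; apply/eqP; rewrite eq_complex e1 e2 !eqxx.
Qed.

Lemma cvg_complex_cmod (T : Type) (F : set_system T) {FF : Filter F}
    (f : T -> R[i]) z :
  (f : T -> R[i]^o) @ F --> (z : R[i]^o) <-> cmod (z - f x) @[x --> F] --> 0.
Proof.
split => [/cvgrPdist_lt fz|/cvgrPdist_lt fz]; apply/cvgrPdist_lt => e e0.
  have := fz e%:C; rewrite ltcR => /(_ e0); apply: filterS => x.
  by rewrite norm_cmod ltcR sub0r normrN ger0_norm ?cmod_ge0.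
have er : (complex.Re e)%:C = e by rewrite RRe_real// gtr0_real.
have := fz (complex.Re e); rewrite -ltcR er => /(_ e0); apply: filterS => x.
by rewrite sub0r normrN ger0_norm ?cmod_ge0// -ltcR er norm_cmod.
Qed.

Lemma cvg_complexr (T : Type) (F : set_system T) {FF : Filter F}
    (f : T -> R) r : f x @[x --> F] --> r ->
  ((fun x => (f x)%:C) : T -> R[i]^o) @ F --> (r%:C : R[i]^o).
Proof.
move=> fr; apply/cvg_complex_cmod.
have : `|r - f x| @[x --> F] --> `|r - r|.
  by apply: cvg_norm; apply: cvgB => //; exact: cvg_cst.
by rewrite subrr normr0; under eq_fun do rewrite -cmod_real rmorphB/=.
Qed.

End complex_modulus.

Section inner_product.
Variables (R : realType) (H : hilbertType R).
Implicit Types (x y z : H) (a : R[i]).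

Lemma innerC x y : '[x, y] = ('[y, x]^*)%R.
Proof. by rewrite hermC expr0 mul1r. Qed.
Lemma innerDl x y z : '[x + y, z] = '[x, z] + '[y, z].
Proof. by rewrite linearDl. Qed.
Lemma innerDr x y z : '[x, y + z] = '[x, y] + '[x, z].
Proof. by rewrite linearDr. Qed.
Lemma innerZl a x y : '[a *: x, y] = a * '[x, y].
Proof. by rewrite linearZl_LR. Qed.
Lemma innerZr a x y : '[x, a *: y] = a^* * '[x, y].
Proof. by rewrite linearZr_LR. Qed.
Lemma innerNl x y : '[- x, y] = - '[x, y].
Proof. by rewrite linearNl. Qed.
Lemma innerNr x y : '[x, - y] = - '[x, y].
Proof. by rewrite linearNr. Qed.
Lemma inner0l x : '[0, x] = 0. Proof. by rewrite linear0l. Qed.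
Lemma norm_rnorm x : `|x| = (rnorm x)%:C.
Proof. by rewrite /rnorm RRe_real// ger0_real. Qed.

Lemma rnorm_ge0 x : 0 <= rnorm x.
Proof. by rewrite -lecR -norm_rnorm normr_ge0. Qed.

Lemma inner_rnorm x : '[x, x] = (rnorm x ^+ 2)%:C.
Proof. by rewrite inner_norm norm_rnorm rmorphXn. Qed.

Lemma rnorm0 : rnorm (0 : H) = 0. Proof. by rewrite /rnorm normr0. Qed.

Lemma rnorm_eq0 x : rnorm x = 0 -> x = 0.
Proof. by move=> x0; apply/eqP; rewrite -normr_eq0 norm_rnorm x0. Qed.

Lemma rnormZ a x : rnorm (a *: x) = cmod a * rnorm x.
Proof.
by apply: complexr_inj; rewrite rmorphM/= -norm_cmod -!norm_rnorm normrZ.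
Qed.

Lemma rnormD x y : rnorm (x + y) <= rnorm x + rnorm y.
Proof. by rewrite -lecR rmorphD/= -!norm_rnorm ler_normD. Qed.

Lemma rnormN x : rnorm (- x) = rnorm x.
Proof. by rewrite /rnorm normrN. Qed.

Lemma rnormB x y : rnorm (x - y) <= rnorm x + rnorm y.
Proof. by rewrite -(rnormN y) rnormD. Qed.

Lemma rnorm_sqrD x y :
  rnorm (x + y) ^+ 2 = rnorm x ^+ 2 + rnorm y ^+ 2 + complex.Re '[x, y] *+ 2.
Proof.
apply: complexr_inj; rewrite !(rmorphD, rmorphMn)/= -!inner_rnorm.
rewrite innerDl !innerDr (innerC y x) -[(_^*)%R]/(_^*%C).
move: '[x, x] '[y, y] '[x, y] => [p q] [p' q'] [a b] /=.
by apply/eqP; rewrite eq_complex/=; apply/andP; split; apply/eqP; ring.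
Qed.

Lemma rnorm_parallelogram x y :
  rnorm (x + y) ^+ 2 + rnorm (x - y) ^+ 2 = (rnorm x ^+ 2 + rnorm y ^+ 2) *+ 2.
Proof. by rewrite !rnorm_sqrD rnormN innerNr raddfN/=; ring. Qed.

Lemma Re_inner_le x y : complex.Re '[x, y] <= rnorm x * rnorm y.
Proof.
have [x0 y0] := (rnorm_ge0 x, rnorm_ge0 y).
suff : `|complex.Re '[x, y]| <= rnorm x * rnorm y by apply: le_trans; exact: ler_norm.
rewrite -(@ler_pXn2r _ 2)// ?nnegrE// ?mulr_ge0// real_normK ?num_real// exprMn.
apply: disc_le0 => s t.
have := sqr_ge0 (rnorm (s%:C *: x + t%:C *: y)); congr (0 <= _).
rewrite rnorm_sqrD !rnormZ !cmod_real innerZl innerZr.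
rewrite conj_real !Re_scale.
by rewrite !exprMn !real_normK ?num_real//; ring.
Qed.

Lemma cmod_inner_le x y : cmod '[x, y] <= rnorm x * rnorm y.
Proof.
have [e|xy0] := eqVneq (cmod '[x, y]) 0.
  by rewrite e mulr_ge0 ?rnorm_ge0.
have {}xy0 : 0 < cmod '[x, y] by rewrite lt_neqAle eq_sym xy0 cmod_ge0.
(* Multiplying [x] by the conjugate of the inner product makes that product real, equal to its
   squared modulus. *)
have := Re_inner_le (('[x, y]^*)%R *: x) y.
rewrite innerZl mulrC -cmodsq/= rnormZ cmod_conj expr2 -mulrA.
by rewrite ler_pM2l.
Qed.

Lemma eq_innerr x y : (forall z, '[z, x] = '[z, y]) -> x = y.
Proof.
move=> xy; apply/eqP; rewrite -subr_eq0; apply/eqP/rnorm_eq0/eqP.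
rewrite -sqrf_eq0; apply/eqP/complexr_inj.
by rewrite -inner_rnorm innerDr innerNr xy subrr.
Qed.

Lemma eq_innerl x y : (forall z, '[x, z] = '[y, z]) -> x = y.
Proof. by move=> xy; apply: eq_innerr => z; rewrite innerC xy -innerC. Qed.

Lemma cvg_rnorm (T : Type) (F : set_system T) {FF : Filter F} (f : T -> H) z :
  f x @[x --> F] --> z <-> rnorm (z - f x) @[x --> F] --> 0.
Proof.
split => [/cvgrPdist_lt fz|/cvgrPdist_lt fz]; apply/cvgrPdist_lt => e e0.
  have := fz e%:C; rewrite ltcR => /(_ e0); apply: filterS => x.
  by rewrite norm_rnorm ltcR sub0r normrN ger0_norm ?rnorm_ge0.
have er : (complex.Re e)%:C = e by rewrite RRe_real// gtr0_real.
have := fz (complex.Re e); rewrite -ltcR er => /(_ e0); apply: filterS => x.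
by rewrite sub0r normrN ger0_norm ?rnorm_ge0// -ltcR er norm_rnorm.
Qed.

Lemma rnorm_cauchy_cvg (u : nat -> H) :
  (forall e, 0 < e -> exists N, forall m n, (N <= m)%N -> (N <= n)%N ->
     rnorm (u m - u n) < e) ->
  exists l, rnorm (l - u n) @[n --> \oo] --> 0.
Proof.
move=> uc.
suff : cvg (u n @[n --> \oo]) by move=> /cvg_ex[l /cvg_rnorm ul]; exists l.
apply: cauchy_cvg; apply/cauchyP => e e0.
have er : (complex.Re e)%:C = e by rewrite RRe_real// gtr0_real.
have [N uN] := uc (complex.Re e) ltac:(by rewrite -ltcR er).
exists (u N); exists N => // n /= Nn.
by rewrite -ball_normE /ball_/= norm_rnorm -er ltcR uN.
Qed.

End inner_product.

Section operators_forms.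
Variables (R : realType) (H : hilbertType R).
Implicit Types (x y z : H) (S T : 'B(H)) (a : R[i]).
Local Notation ci := (ci R).

(** Polarization recovers a form that is linear in its first and conjugate-linear in its second
    variable from its diagonal. This is where complex scalars matter: quadratic forms determine
    operators. *)
Definition polar (q : H -> R[i]) x y : R[i] :=
  4^-1 * (q (x + y) - q (x - y) + ci * (q (x + ci *: y) - q (x - ci *: y))).

Lemma op_polar S x y : '[S x, y] = polar (fun h => '[S h, h]) x y.
Proof.
have SD u v : S (u + v) = S u + S v by exact: linearD.
have SN u : S (- u) = - S u by exact: linearN.
have SZ u : S (ci *: u) = ci *: S u by exact: linearZ.
rewrite /polar !(SD, SN, SZ).
rewrite !(innerDl, innerDr, innerNl, innerNr, innerZl, innerZr) conj_i.
move: '[S x, x] '[S x, y] '[S y, x] '[S y, y] => p r q s.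
transitivity (4^-1 * (2 * (q + r) + 2 * (ci * ci) * (q - r))).
  by rewrite ci_sq; field.
by congr (_ * _); ring.
Qed.

Lemma bop_eq S T : (forall h, '[S h, h] = '[T h, h]) -> S = T.
Proof.
move=> ST; apply: bop_ext => x; apply: eq_innerl => y.
by rewrite !op_polar; congr polar; apply/funext.
Qed.

Lemma bop_rbound S : exists2 M, 0 <= M & forall x, rnorm (S x) <= M * rnorm x.
Proof.
have [M M0 SM] := bop_bound S; exists (complex.Re M) => [|x].
  by rewrite -lecR RRe_real// ger0_real.
by have := SM x; rewrite !norm_rnorm -{1}(RRe_real (ger0_real M0)) -rmorphM lecR.
Qed.

Lemma bop_of_linear (f : H -> H) M : linear f ->
  (forall x, rnorm (f x) <= M * rnorm x) -> exists S : 'B(H), S =1 f.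
Proof.
move=> fl fM.
have fb : exists M : R[i], forall x, `|f x| <= M * `|x|.
  by exists M%:C => x; rewrite !norm_rnorm -rmorphM lecR.
by exists (BoundedOp fl fb).
Qed.

(* The minimizer z of |x|^2 - 2 Re g(x) represents g. *)
Lemma riesz (g : H -> R[i]) M :
  (forall a x y, g (a *: x + y) = a * g x + g y) ->
  (forall x, cmod (g x) <= M * rnorm x) -> exists z, forall x, g x = '[x, z].
Proof.
move=> glin gM.
have gD x y : g (x + y) = g x + g y by rewrite -[x]scale1r glin mul1r scale1r.
have g0 : g 0 = 0 by apply: (addrI (g 0)); rewrite -gD !addr0.
have gZ a x : g (a *: x) = a * g x by rewrite -[a *: x]addr0 glin g0 addr0.
pose J x := rnorm x ^+ 2 - 2 * complex.Re (g x).
have gRe x : `|complex.Re (g x)| <= M * rnorm x by exact: le_trans (Re_le_cmod _) (gM x).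
have JM x : - M ^+ 2 <= J x.
  have := gRe x; rewrite ler_norml /J => /andP[_ h].
  have := sqr_ge0 (rnorm x - M); nra.
have JE : has_inf (range J).
  by split; [exists (J 0); exists 0|exists (- M ^+ 2) => _ [x _ <-]].
pose m := inf (range J).
have mJ x : m <= J x by apply: ge_inf; [case: JE|exists x].
(* The parallelogram law, with J at the midpoint bounded below by m: minimizing sequences are
   Cauchy. *)
have Jpar x y : rnorm (x - y) ^+ 2 <= 2 * (J x - m) + 2 * (J y - m).
  have := mJ ((2^-1)%:C *: (x + y)); rewrite /J rnormZ cmod_real.
  rewrite gZ Re_scale gD Re_add exprMn real_normK ?num_real//.
  have := rnorm_parallelogram x y; lra.
have /choice[u um] n : exists x, J x < m + n.+1%:R^-1.
  have n1 : 0 < (n.+1%:R^-1 : R) by rewrite invr_gt0.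
  have [_ [x _ <-] xm] := inf_adherent n1 JE; by exists x.
have [z uz] : exists l, rnorm (l - u n) @[n --> \oo] --> 0.
  apply: rnorm_cauchy_cvg => e e0.
  pose N := Num.bound (4 / e ^+ 2); exists N => i j Ni Nj.
  have e2 : 0 < e ^+ 2 by rewrite exprn_gt0.
  have inv k : (N <= k)%N -> J (u k) - m < e ^+ 2 / 4.
    move=> Nk; rewrite ltrBlDl (lt_le_trans (um k))// lerD2l.
    rewrite -[leRHS]invf_div lef_pV2 ?posrE ?divr_gt0//.
    have NN : 4 / e ^+ 2 < N%:R by rewrite archi_boundP// divr_ge0// ltW.
    by rewrite (le_trans (ltW NN))// ler_nat ltnW.
  rewrite -(@ltr_pXn2r _ 2)// ?nnegrE ?rnorm_ge0 ?ltW//.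
  have := inv _ Ni; have := inv _ Nj; have := Jpar (u i) (u j); lra.
have zm : J z <= m.
  pose e n := rnorm (z - u n).
  (* Quantitative continuity of J at z along the minimizing sequence, with e n the distance from z
     to [u n]. *)
  have Je n : J z <= m + harmonic n + (e n ^+ 2 + 2 * (e n * (rnorm z + e n + M))).
    have ed : z = u n + (z - u n) by rewrite addrC subrK.
    have {1}-> : J z = J (u n) +
        (e n ^+ 2 + 2 * (complex.Re '[u n, z - u n] - complex.Re (g (z - u n)))).
      by rewrite {1}ed /J rnorm_sqrD gD Re_add /e; ring.
    have := um n; rewrite /harmonic/= => h.
    have h1 := Re_inner_le (u n) (z - u n).
    have := gRe (z - u n); rewrite ler_norml => /andP[h2 _].
    have h3 : rnorm (u n) <= rnorm z + e n.
      by rewrite (_ : u n = z - (z - u n)) ?rnormB// opprB addrC subrK.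
    have e0 : 0 <= e n by exact: rnorm_ge0.
    have h4 : rnorm (u n) * e n <= (rnorm z + e n) * e n by rewrite ler_wpM2r.
    rewrite -/(e n) in h1 h2.
    move: h h1 h2 h3 h4.
    move: (e n) (J _) (complex.Re _) (complex.Re _) (rnorm _) (rnorm _).
    move: (n.+1%:R^-1) (m) => i k; clear.
    by move=> a b c d f l h1 h2 h3 h4 h5; lra.
  have : m + harmonic n + (e n ^+ 2 + 2 * (e n * (rnorm z + e n + M))) @[n --> \oo]
     --> m + 0 + (0 ^+ 2 + 2 * (0 * (rnorm z + 0 + M))).
    apply: cvgD; first by apply: cvgD; [exact: cvg_cst|exact: cvg_harmonic].
    apply: cvgD; first exact: (cvg_comp _ _ uz (@exprn_continuous _ 2 0)).
    apply: cvgMl_tmp; apply: cvgM => //; apply: cvgD; last exact: cvg_cst.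
    by apply: cvgD => //; exact: cvg_cst.
  rewrite !(addr0, mul0r, expr0n, mulr0)/=.
  move=> h; apply: (@closed_cvg _ _ \oo _ _ [set x | J z <= x] _ _ _ h).
    exact: closed_ge.
  exact: nearW.
have key x : complex.Re (g x) = complex.Re '[x, z].
  (* J (z + t x) >= J z for all real t: a quadratic in t with no constant term stays nonnegative
     only if its linear coefficient vanishes. Clearing denominators in [q (s / t)] brings this to
     [disc_le0]. *)
  have q t : 0 <= t ^+ 2 * rnorm x ^+ 2 +
      2 * t * (complex.Re '[x, z] - complex.Re (g x)).
    have := le_trans zm (mJ (z + t%:C *: x)).
    rewrite /J rnorm_sqrD rnormZ cmod_real exprMn real_normK ?num_real//.
    rewrite innerZr conj_real Re_scale innerC Re_conj gD gZ Re_add Re_scale.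
    lra.
  apply/esym/eqP; rewrite -subr_eq0 -sqrf_eq0 eq_le sqr_ge0 andbT.
  rewrite -(mulr0 (rnorm x ^+ 2)); apply: disc_le0 => s t.
  have [->|t0] := eqVneq t 0.
    by rewrite expr0n !(mulr0, mul0r, mul0rn, addr0) mulr_ge0 ?sqr_ge0.
  have := mulr_ge0 (sqr_ge0 t) (q (s / t)); congr (0 <= _).
  by field.
exists z => x; apply: complex_eq_Re => //.
by rewrite -gZ -innerZl.
Qed.

Lemma op_of_form (f : H -> H -> R[i]) M :
  (forall a x y z, f (a *: x + y) z = a * f x z + f y z) ->
  (forall a x y z, f z (a *: x + y) = (a^*)%R * f z x + f z y) ->
  (forall x y, cmod (f x y) <= M * (rnorm x * rnorm y)) ->
  exists S : 'B(H), forall x y, '[S x, y] = f x y.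
Proof.
move=> fl fr fM.
have conjK (w : R[i]) : ((w^*)^*)%R = w by exact: conjCK.
have /choice[S Sf] x : exists z, forall y, f x y = '[z, y].
  have [||z fz] := @riesz (fun y => (f x y)^*%R) (M * rnorm x).
  - by move=> a y z; rewrite fr rmorphD rmorphM/= conjCK.
  - by move=> y; rewrite cmod_conj -mulrA.
  - by exists z => y; rewrite innerC -fz conjK.
have Sl : linear S.
  by move=> a x y; apply: eq_innerl => z; rewrite innerDl innerZl -!Sf fl.
have SM x : rnorm (S x) <= M * rnorm x.
  have := fM x (S x); rewrite Sf inner_rnorm cmod_real ger0_norm ?sqr_ge0//.
  rewrite mulrA expr2; have := rnorm_ge0 (S x); rewrite le_eqVlt.
  move=> /predU1P[<- _|S0]; last by rewrite ler_pM2r.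
  have := fM x x; have := cmod_ge0 (f x x).
  have := rnorm_ge0 x; rewrite le_eqVlt => /predU1P[<-|x0]; first by rewrite !mulr0.
  by move=> h1 h2; have := le_trans h1 h2; rewrite mulrA pmulr_lge0.
have [S' SS'] := bop_of_linear Sl SM.
by exists S' => x y; rewrite SS' Sf.
Qed.

Lemma adjointP T x y : '[T x, y] = '[x, adjoint T y].
Proof.
suff : [set S : 'B(H) | forall x y, '[T x, y] = '[x, S y]] (adjoint T) by apply.
rewrite /adjoint; apply: xgetPex.
have [M M0 TM] := bop_rbound T.
have [|||S Sf] := @op_of_form (fun y x => '[y, T x]) M.
- by move=> a u v w; rewrite innerDl innerZl.
- by move=> a u v w; rewrite linearD linearZ/= innerDr innerZr.
- move=> u v; rewrite (le_trans (cmod_inner_le _ _))// mulrCA ler_wpM2l ?rnorm_ge0//.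
- by exists S => u v /=; rewrite innerC -Sf -innerC.
Qed.

(** By polarization all the forms '[S i x, y] converge, so their limit inherits sesquilinearity. Its
    boundedness comes from the bound on [phi], through the parallelogram law and homogeneity. Every
    operator obtained below as a limit comes from here. *)
Lemma quad_limit (I : Type) (F : set_system I) {PF : ProperFilter F}
    (S : I -> 'B(H)) (q : I -> H -> R) (phi : H -> R) M :
  (forall i h, '[S i h, h] = (q i h)%:C) ->
  (forall h, q i h @[i --> F] --> phi h) ->
  (forall h, `|phi h| <= M * rnorm h ^+ 2) ->
  exists L : 'B(H), forall h, '[L h, h] = (phi h)%:C.
Proof.
move=> Sq qphi phiM; pose f := polar (fun h => (phi h)%:C).
have Sf x y : ((fun i => '[S i x, y]) : I -> R[i]^o) @ F --> (f x y : R[i]^o).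
  under eq_fun do rewrite op_polar.
  have qc h : ((fun i => '[S i h, h]) : I -> R[i]^o) @ F --> ((phi h)%:C : R[i]^o).
    by under eq_fun do rewrite Sq; exact: cvg_complexr.
  rewrite /f /polar.
  apply: (@cvgMl_tmp R[i]); apply: (@cvgD R[i] R[i]^o).
    by apply: (@cvgB R[i] R[i]^o); exact: qc.
  apply: (@cvgMl_tmp R[i]); apply: (@cvgB R[i] R[i]^o); exact: qc.
have uniq (u : I -> R[i]) (v w : R[i]) : (u : I -> R[i]^o) @ F --> (v : R[i]^o) ->
    (u : I -> R[i]^o) @ F --> (w : R[i]^o) -> v = w.
  by move=> uv uw; apply: (cvg_unique _ uv uw); exact: norm_hausdorff.
have fl a x y z : f (a *: x + y) z = a * f x z + f y z.
  apply: uniq (Sf _ _) _.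
  under eq_fun do rewrite linearD linearZ/= innerDl innerZl.
  by apply: (@cvgD R[i] R[i]^o) => //; exact: (@cvgMl_tmp R[i]).
have fr a x y z : f z (a *: x + y) = (a^*)%R * f z x + f z y.
  apply: uniq (Sf _ _) _.
  under eq_fun do rewrite innerDr innerZr.
  by apply: (@cvgD R[i] R[i]^o) => //; exact: (@cvgMl_tmp R[i]).
have fM1 x y : cmod (f x y) <= M * (rnorm x ^+ 2 + rnorm y ^+ 2).
  rewrite /f /polar cmodM cmodV.
  have -> : cmod (4 : R[i]) = 4.
    by rewrite (_ : 4 = (4 : R)%:C) ?cmod_real ?ger0_norm// rmorph_nat.
  rewrite ler_pdivrMl//.
  rewrite (le_trans (cmodD _ _))// cmodM cmod_i mul1r.
  have p4 u v w w' : cmod ((phi u)%:C - (phi v)%:C) + cmod ((phi w)%:C - (phi w')%:C)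
     <= M * (rnorm u ^+ 2 + rnorm v ^+ 2 + (rnorm w ^+ 2 + rnorm w' ^+ 2)).
    rewrite -!rmorphB/= !cmod_real !mulrDr.
    by rewrite !lerD// (le_trans (ler_normB _ _))// lerD.
  rewrite (le_trans (p4 _ _ _ _))// !rnorm_parallelogram rnormZ cmod_i mul1r.
  by rewrite le_eqVlt; apply/orP; left; apply/eqP; ring.
have f0l y : f 0 y = 0.
  have := fl 1 0 0 y; rewrite scale1r addr0 mul1r => /(congr1 (fun w => w - f 0 y)).
  by rewrite subrr addrK.
have f0r x : f x 0 = 0.
  have := fr 1 0 0 x; rewrite scale1r addr0 rmorph1 mul1r.
  by move=> /(congr1 (fun w => w - f x 0)); rewrite subrr addrK.
(* On unit vectors the sum of squares in [fM1] is 2, whence 2 M; homogeneity extends the bound to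
   all vectors. *)
have [|L Lf] := @op_of_form f (2 * M) fl fr.
  move=> x y; have [x0 y0] := (rnorm_ge0 x, rnorm_ge0 y).
  move: x0; rewrite le_eqVlt => /predU1P[/esym x0|x0].
    by rewrite x0 (rnorm_eq0 x0) f0l cmod0 mul0r mulr0.
  move: y0; rewrite le_eqVlt => /predU1P[/esym y0|y0].
    by rewrite y0 (rnorm_eq0 y0) f0r cmod0 !mulr0.
  have nz u : 0 < rnorm u -> rnorm ((rnorm u)^-1%:C *: u) = 1.
    by move=> u0; rewrite rnormZ cmod_real gtr0_norm ?invr_gt0// mulVf// gt_eqF.
  have := fM1 ((rnorm x)^-1%:C *: x) ((rnorm y)^-1%:C *: y).
  rewrite !nz// expr1n -[_ *: x]addr0 -[_ *: y]addr0 fl f0l fr f0r !addr0.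
  rewrite conj_real (cmodM (rnorm x)^-1%:C) (cmodM (rnorm y)^-1%:C).
  rewrite !cmod_real !gtr0_norm ?invr_gt0// !ler_pdivrMl// => h.
  by rewrite (le_trans h)// le_eqVlt; apply/orP; left; apply/eqP; ring.
exists L => h; rewrite Lf.
by apply: uniq (Sf _ _) _; under eq_fun do rewrite Sq; exact: cvg_complexr.
Qed.

End operators_forms.

(** * Resolvents and powers of an operator *)

Section spectral.
Variables (R : realType) (H : hilbertType R).
Implicit Types (x y z : H) (S T X P : 'B(H)) (w : R[i]).

Definition opb S (M : R) := forall x, rnorm (S x) <= M * rnorm x.

Lemma op_D S x y : S (x + y) = S x + S y. Proof. exact: linearD. Qed.

Lemma op_B S x y : S (x - y) = S x - S y. Proof. exact: linearB. Qed.

Lemma op_Z S w x : S (w *: x) = w *: S x. Proof. exact: linearZ. Qed.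

Lemma op_0 S : S 0 = 0. Proof. exact: linear0. Qed.

Lemma opb_le S M N : M <= N -> opb S M -> opb S N.
Proof. by move=> MN SM x; rewrite (le_trans (SM x))// ler_wpM2r// rnorm_ge0. Qed.

Lemma bopM S T x : (S * T) x = S (T x). Proof. by []. Qed.

Lemma bopD S T x : (S + T) x = S x + T x. Proof. by []. Qed.

Lemma bop1E x : (1 : 'B(H)) x = x. Proof. by []. Qed.

Lemma bopZ w S x : (w *: S) x = w *: S x. Proof. by []. Qed.

Lemma bopN S x : (- S) x = - S x. Proof. by change ((-1) *: S x = - S x); rewrite scaleN1r. Qed.

Lemma bopB S T x : (S - T) x = S x - T x. Proof. by rewrite bopD bopN. Qed.

Lemma bopMn S n x : (S *+ n) x = S x *+ n.
Proof. by elim: n => [|n IH] //; rewrite !mulrSr bopD IH. Qed.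

Lemma bop_expS T n x : (T ^+ n.+1) x = T ((T ^+ n) x).
Proof. by rewrite exprS. Qed.

Lemma bop_expSr T n x : (T ^+ n.+1) x = (T ^+ n) (T x).
Proof. by rewrite exprSr. Qed.

Lemma bop_expD T m n x : (T ^+ (m + n)) x = (T ^+ m) ((T ^+ n) x).
Proof. by rewrite exprD. Qed.

Lemma opbX S M n : 0 <= M -> opb S M -> opb (S ^+ n) (M ^+ n).
Proof.
move=> M0 SM x; elim: n => [|n IH]; first by rewrite !expr0 mul1r.
by rewrite bop_expS exprS (le_trans (SM _))// -mulrA ler_wpM2l.
Qed.

Lemma bop_expZ w T n x : ((w *: T) ^+ n) x = w ^+ n *: (T ^+ n) x.
Proof.
elim: n => [|n IH]; first by rewrite !expr0 scale1r.
by rewrite !bop_expS bopZ IH op_Z scalerA exprS.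
Qed.

(** The resolvent of T at 1 / w enters as the inverse of 1 - w T, which makes sense at w = 0 and
    turns the exterior of the spectrum into a disc of values w. *)
Definition inv1 X P := (forall x, P (x - X x) = x) /\ (forall x, P x - X (P x) = x).

Lemma squeeze0 (u v : nat -> R) : (forall n, 0 <= u n <= v n) ->
  v n @[n --> \oo] --> 0 -> u n @[n --> \oo] --> 0.
Proof.
move=> uv v0; apply: (@squeeze_cvgr _ _ _ _ (fun=> 0) v) => //.
  exact: nearW.
exact: cvg_cst.
Qed.

Lemma le0_of_cvg (r : R) (u : nat -> R) : (forall n, r <= u n) ->
  u n @[n --> \oo] --> 0 -> r <= 0.
Proof.
move=> ru u0; apply: (@closed_cvg _ _ \oo _ _ [set x | r <= x] _ _ _ u0).
  exact: closed_ge.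
exact: nearW.
Qed.

Lemma cvg_expr0 (q : R) : 0 <= q < 1 -> q ^+ n @[n --> \oo] --> 0.
Proof.
move=> /andP[q0 q1]; have := @cvg_geometric R 1 q; rewrite ger0_norm// => /(_ q1).
by apply: cvg_trans; apply: near_eq_cvg; near=> n; rewrite /= mul1r.
Unshelve. all: by end_near. Qed.

(** The hypothesis bears on the powers rather than on S, because for T / z only the growth of the
    powers is known. The inverse is the pointwise limit of the partial sums V n. *)
Lemma neumann S (c q : R) : 0 <= q < 1 -> (forall n, opb (S ^+ n) (c * q ^+ n)) ->
  exists P, inv1 S P.
Proof.
move=> /andP[q0 q1] Sn; pose V n x := \sum_(i < n) (S ^+ i) x.
have VS n x : V n.+1 x = V n x + (S ^+ n) x by rewrite /V big_ord_recr.
have Vd n x : V n x - S (V n x) = x - (S ^+ n) x.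
  elim: n => [|n IH]; first by rewrite /V big_ord0 op_0 expr0 bop1E !subrr.
  rewrite VS op_D opprD addrACA IH bop_expS addrA subrK.
  by [].
have Vl n x : V n (S x) = S (V n x).
  elim: n => [|n IH]; first by rewrite /V !big_ord0 op_0.
  by rewrite !VS op_D IH -bop_expSr bop_expS.
have q1' : 0 < 1 - q by rewrite subr_gt0.
(* The bound on a block of the geometric series, multiplied through by 1 - q. *)
have Vb m k x : rnorm (V (m + k)%N x - V m x) * (1 - q) <=
    c * rnorm x * (q ^+ m - q ^+ (m + k)).
  elim: k => [|k IH]; first by rewrite addn0 !subrr rnorm0 mul0r mulr0.
  rewrite addnS VS addrAC.
  have := ler_wpM2r (ltW q1') (rnormD (V (m + k)%N x - V m x) ((S ^+ (m + k)) x)).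
  have := ler_wpM2r (ltW q1') (Sn (m + k)%N x).
  rewrite exprS; lra.
have c0 x : 0 <= c * rnorm x.
  by have := le_trans (rnorm_ge0 _) (Sn 0%N x); rewrite expr0 mulr1.
have /choice[L VL] x : exists l, rnorm (l - V n x) @[n --> \oo] --> 0.
  apply: rnorm_cauchy_cvg => e e0.
  have : c * rnorm x / (1 - q) * q ^+ n @[n --> \oo] --> 0.
    rewrite -[X in _ --> X](mulr0 (c * rnorm x / (1 - q))); apply: cvgMl_tmp.
    by apply: cvg_expr0; rewrite q0.
  move=> /cvgrPdist_lt/(_ (e / 2)); rewrite divr_gt0// => /(_ isT)[N _ NP].
  have hN k : rnorm (V (N + k)%N x - V N x) < e / 2.
    have /= := NP N (leqnn N); rewrite sub0r normrN ger0_norm; last first.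
      by rewrite mulr_ge0 ?exprn_ge0// divr_ge0// ltW.
    apply: le_lt_trans; rewrite mulrAC ler_pdivlMr// (le_trans (Vb _ _ _))//.
    by rewrite ler_wpM2l// gerBl exprn_ge0.
  exists N => m n Nm Nn.
  have -> : V m x - V n x = (V m x - V N x) - (V n x - V N x).
    by rewrite opprB addrA subrK.
  rewrite (le_lt_trans (rnormB _ _))// [ltRHS]splitr ltrD//.
    by have := hN (m - N)%N; rewrite subnKC.
  by have := hN (n - N)%N; rewrite subnKC.
have Lunique x l : rnorm (l - V n x) @[n --> \oo] --> 0 -> l = L x.
  move=> h; apply/eqP; rewrite -subr_eq0; apply/eqP/rnorm_eq0/le_anti.
  rewrite rnorm_ge0 andbT.
  apply: (@le0_of_cvg _ (fun n => rnorm (l - V n x) + rnorm (L x - V n x))).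
    move=> n; have -> : l - L x = (l - V n x) - (L x - V n x).
      by rewrite opprB addrA subrK.
    exact: rnormB.
  by rewrite -[X in _ --> X](addr0 0); apply: cvgD => //; exact: VL.
have VD n a x y : V n (a *: x + y) = a *: V n x + V n y.
  elim: n => [|n IH]; first by rewrite /V !big_ord0 scaler0 addr0.
  have Sl : (S ^+ n) (a *: x + y) = a *: (S ^+ n) x + (S ^+ n) y by exact: linearP.
  by rewrite !VS IH Sl scalerDr addrACA.
have Llin : linear L.
  move=> a x y; apply/esym/Lunique.
  apply: (@squeeze0 _ (fun n => cmod a * rnorm (L x - V n x) + rnorm (L y - V n y))).
    move=> n; rewrite rnorm_ge0/= VD opprD addrACA -scalerBr.
    by rewrite (le_trans (rnormD _ _))// rnormZ.
  rewrite -[X in _ --> X](addr0 0); apply: cvgD; last exact: VL.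
  by rewrite -[X in _ --> X](mulr0 (cmod a)); apply: cvgMl_tmp; exact: VL.
have Lb x : rnorm (L x) <= c / (1 - q) * rnorm x.
  rewrite -subr_le0; apply: le0_of_cvg (VL x) => n.
  have := Vb 0%N n x; rewrite add0n {2}/V big_ord0 subr0 expr0 => h.
  have {}h : rnorm (V n x) <= c / (1 - q) * rnorm x.
    rewrite mulrAC ler_pdivlMr// (le_trans h)// -[leRHS]mulr1 ler_wpM2l//.
    by rewrite gerBl exprn_ge0.
  rewrite lerBlDr (le_trans _ (lerD (lexx _) h))//.
  by rewrite -{1}[L x](subrK (V n x)) rnormD.
have [P PL] := bop_of_linear Llin Lb.
have Sn0 x : rnorm ((S ^+ n) x) @[n --> \oo] --> 0.
  apply: (@squeeze0 _ (fun n => c * rnorm x * q ^+ n)).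
    by move=> n; rewrite rnorm_ge0/= (le_trans (Sn n x))// mulrAC.
  rewrite -[X in _ --> X](mulr0 (c * rnorm x)); apply: cvgMl_tmp.
  by apply: cvg_expr0; rewrite q0.
have [K K0 SK] := bop_rbound S.
exists P; split => x; rewrite !PL.
  apply/esym/Lunique; under eq_fun => n.
    have -> : V n (x - S x) = x - (S ^+ n) x.
      by rewrite addrC -scaleN1r VD Vl scaleN1r addrC Vd.
    rewrite subKr.
    over.
  exact: Sn0.
apply/eqP; rewrite -subr_eq0; apply/eqP/rnorm_eq0/le_anti.
rewrite rnorm_ge0 andbT.
apply: (@le0_of_cvg _ (fun n => rnorm (L x - V n x) + K * rnorm (L x - V n x) +
  rnorm ((S ^+ n) x))) => [n|].
  have -> : L x - S (L x) - x =
      (L x - V n x) - S (L x - V n x) - (S ^+ n) x.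
    have xE : x = V n x - S (V n x) + (S ^+ n) x by rewrite Vd subrK.
    rewrite op_B [X in _ - X = _]xE opprD opprB opprD opprK !addrA; congr (_ - _).
    by rewrite addrAC -!addrA; congr (_ + _); rewrite addrCA addrC -!addrA.
  by rewrite (le_trans (rnormB _ _))// lerD2r (le_trans (rnormB _ _))// lerD2l.
rewrite -[X in _ --> X](addr0 0) -[X in _ --> X + _](addr0 0).
apply: cvgD => //; apply: cvgD; first exact: VL.
by rewrite -[X in _ --> X](mulr0 K); apply: cvgMl_tmp; exact: VL.
Qed.

(** The partial fraction 1 / (1 - X^2) = (1 / (1 - X) + 1 / (1 + X)) / 2. *)
Lemma average_inv1 X P1 P2 : inv1 X P1 -> inv1 (- X) P2 ->
  inv1 (X * X) ((2^-1 : R[i]) *: (P1 + P2)).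
Proof.
move=> [P1l P1r] [P2l P2r].
have half x : (2^-1 : R[i]) *: (x + x) = x.
  by rewrite scalerDr -scalerDl -[RHS]scale1r; congr (_ *: _); field.
have e1 y : y - X (X y) = (y + X y) - X (y + X y).
  by rewrite op_D opprD addrA addrK.
have e2 y : y - X (X y) = (y - X y) - (- X) (y - X y).
  by rewrite bopN opprK op_B addrA subrK.
split => x; rewrite bopM bopZ bopD.
  rewrite {1}e1 P1l e2 P2l -[RHS]half; congr (_ *: _).
  by rewrite addrACA subrr addr0.
have h1 : P1 x - X (X (P1 x)) = x + X x.
  by move: (P1 x) (P1r x) => p <-; rewrite op_B addrA subrK.
have h2 : P2 x - X (X (P2 x)) = x - X x.
  move: (P2 x) (P2r x) => p; rewrite bopN opprK => <-.
  by rewrite op_D opprD addrA addrK.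
have XZ v : X (X ((2^-1 : R[i]) *: v)) = (2^-1 : R[i]) *: X (X v).
  by rewrite !op_Z.
have XD u v : X (X (u + v)) = X (X u) + X (X v) by rewrite !op_D.
rewrite XZ -scalerBr XD opprD addrACA h1 h2 -[RHS]half; congr (_ *: _).
by rewrite addrACA subrr addr0.
Qed.

(* Rickart's proof of the spectral radius formula: no contour integrals. *)
Section rickart.
Variables (T : 'B(H)) (K M d : R).
Hypotheses (K_gt0 : 0 < K) (TK : opb T K) (M_gt0 : 0 < M) (d_gt0 : 0 < d).
Hypothesis resolvent : forall w, cmod w <= d ->
  exists P, inv1 (w *: T) P /\ opb P M.

(** The resolvent identity P - P' = (w - w') P T P'. *)
Lemma resolvent_lipschitz w w' P P' : inv1 (w *: T) P -> inv1 (w' *: T) P' ->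
  opb P M -> opb P' M -> opb (P - P') (cmod (w - w') * (K * M ^+ 2)).
Proof.
move=> [Pl Pr] [Pl' Pr'] PM PM' x.
have -> : (P - P') x = (w - w') *: P (T (P' x)).
  rewrite bopB; move: (P' x) (Pr' x) => y <-.
  have -> : y - (w' *: T) y = (y - (w *: T) y) + (w - w') *: T y.
    by rewrite scalerBl addrA subrK.
  by rewrite op_D Pl op_Z addrC addrA addNr add0r.
rewrite rnormZ expr2 -!mulrA ler_wpM2l ?cmod_ge0//.
apply: (le_trans (PM _)); rewrite mulrCA ler_pM2l// .
apply: (le_trans (TK _)); rewrite ler_pM2l//.
Qed.

(* Averaging the resolvents of T at the points s u e, e ^ (2 ^ m) = 1, gives the
   resolvent of T ^ (2 ^ m), with bounds that do not depend on m. *)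
Lemma resolvent_pow2 m (u : R[i]) (s s' : R) : cmod u = 1 -> 0 <= s <= d -> 0 <= s' <= d ->
  exists P P', [/\ inv1 ((s%:C * u) ^+ (2 ^ m) *: T ^+ (2 ^ m)) P,
    inv1 ((s'%:C * u) ^+ (2 ^ m) *: T ^+ (2 ^ m)) P',
    opb P M, opb P' M & opb (P - P') (`|s - s'| * (K * M ^+ 2))].
Proof.
move=> u1 /andP[s0 sd] /andP[s0' sd'].
(* A root of order 2^m of -1, by iterated square roots: passing from [u] to [u * zeta m] changes the
   sign of the 2^m-th power, as [average_inv1] requires. *)
have [zeta zetaP] : exists z : nat -> R[i], forall m, z m ^+ (2 ^ m) = -1.
  exists (fun m => iter m sqrtC (-1)); elim => [|k IH]; first by rewrite expn0 expr1.
  by rewrite expnS exprM /= sqrtCK.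
have zeta1 k : cmod (zeta k) = 1.
  have : cmod (zeta k) ^+ (2 ^ k) = 1 by rewrite -cmodX zetaP cmodN cmod1.
  by move/eqP; rewrite pexpr_eq1 ?cmod_ge0 ?expn_gt0//= => /eqP.
elim: m u u1 => [|m IH] u u1.
  rewrite expn0 !expr1.
  have [|P [PI PM]] := @resolvent (s%:C * u).
    by rewrite cmodM u1 mulr1 cmod_real ger0_norm.
  have [|P' [PI' PM']] := @resolvent (s'%:C * u).
    by rewrite cmodM u1 mulr1 cmod_real ger0_norm.
  exists P, P'; split => //.
  have := resolvent_lipschitz PI PI' PM PM'.
  by rewrite -mulrBl cmodM u1 mulr1 -rmorphB cmod_real.
have [P1 [P1' [I1 I1' B1 B1' D1]]] := IH u u1.
have uz1 : cmod (u * zeta m) = 1 by rewrite cmodM u1 zeta1 mulr1.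
have [P2 [P2' [I2 I2' B2 B2' D2]]] := IH _ uz1.
have eX (t : R) : (t%:C * u) ^+ (2 ^ m.+1) *: T ^+ (2 ^ m.+1) =
    ((t%:C * u) ^+ (2 ^ m) *: T ^+ (2 ^ m)) * ((t%:C * u) ^+ (2 ^ m) *: T ^+ (2 ^ m)) :> 'B(H).
  apply: bop_ext => x; rewrite bopM !bopZ op_Z scalerA -bop_expD.
  by rewrite -exprD addnn -mul2n -expnS.
have eN (t : R) : (t%:C * (u * zeta m)) ^+ (2 ^ m) *: T ^+ (2 ^ m) =
    - ((t%:C * u) ^+ (2 ^ m) *: T ^+ (2 ^ m)) :> 'B(H).
  by rewrite mulrA exprMn zetaP mulrN1 scaleNr.
rewrite eN in I2; rewrite eN in I2'.
have avg A B (N : R) : opb A N -> opb B N -> opb ((2^-1 : R[i]) *: (A + B)) N.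
  move=> AN BN x; rewrite bopZ bopD rnormZ.
  have -> : cmod (2^-1 : R[i]) = 2^-1.
    by rewrite cmodV (_ : 2 = (2 : R)%:C) ?cmod_real ?ger0_norm// rmorph_nat.
  rewrite ler_pdivrMl// (le_trans (rnormD _ _))//.
  by rewrite (le_trans (lerD (AN x) (BN x)))// mulrDl mul1r.
exists ((2^-1 : R[i]) *: (P1 + P2)), ((2^-1 : R[i]) *: (P1' + P2')); split.
- by rewrite eX; exact: average_inv1.
- by rewrite eX; exact: average_inv1.
- exact: avg.
- exact: avg.
- by rewrite -scalerBr opprD addrACA; exact: avg.
Qed.

(** It says that (w T)^n is a contraction for all large n = 2^m. *)
Definition pow2_bounded (w : R) := exists N : nat, forall m, (N <= m)%N ->
  opb (T ^+ (2 ^ m)) (w^-1 ^+ (2 ^ m)).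

(** At w = w1 - delta the operator (w T)^n is small, since (w / w1)^n tends to 0, so the averaged
    resolvent P' there is close to 1. The one at w0 differs from P' by at most 2 delta K M^2 <= 1/4,
    whence |P y - y| <= |y| / 2. For y = x - (w0 T)^n x this reads |x - y| <= |y| / 2 <= (|x| + |x -
    y|) / 2, that is |(w0 T)^n x| <= |x|. *)
Lemma pow2_bounded_step (delta w1 w0 : R) : 0 < delta -> delta *+ 2 <= w1 ->
  delta * (K * M ^+ 2) <= 8^-1 -> w1 <= w0 -> w0 <= w1 + delta -> w0 <= d ->
  pow2_bounded w1 -> pow2_bounded w0.
Proof.
move=> delta0 dw1 dK w10 w01 w0d [N NP].
have w1_gt0 : 0 < w1 by rewrite (lt_le_trans _ dw1)// pmulrn_lgt0.
have w0_gt0 : 0 < w0 by exact: lt_le_trans w10.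
pose w := w1 - delta.
have w_gt0 : 0 < w by rewrite subr_gt0 (lt_le_trans _ dw1)// mulr2n ltrDl.
have wd : w <= d by rewrite (le_trans _ w0d)// (le_trans _ w10)// gerBl ltW.
have q01 : 0 <= w / w1 < 1.
  by rewrite divr_ge0 ?ltW//= ltr_pdivrMr// mul1r gtrBl.
have M4 : 0 < (4 * M)^-1 by rewrite invr_gt0 mulr_gt0.
have [N2 _ N2P] : \forall n \near \oo, (w / w1) ^+ n < (4 * M)^-1.
  have /cvgrPdist_lt/(_ _ M4) := cvg_expr0 q01; apply: filterS => n.
  rewrite sub0r normrN ger0_norm// exprn_ge0//; by case/andP: q01.
exists (maxn N N2) => m; rewrite geq_max => /andP[Nm N2m].
set n := (2 ^ m)%N.
have N2n : (N2 <= n)%N by rewrite (leq_trans N2m)// ltnW// ltn_expl.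
have [|||P [P' [[Pl Pr] [Pl' Pr'] PM PM' PP']]] := @resolvent_pow2 m 1 w0 w.
- exact: cmod1.
- by rewrite w0d ltW.
- by rewrite wd ltW.
rewrite mulr1 -/n in Pl Pr; rewrite mulr1 -/n in Pl' Pr'.
have P1 y : rnorm (P y - y) <= 2^-1 * rnorm y.
  have -> : P y - y = (P - P') y + P' (w%:C ^+ n *: (T ^+ n) y).
    have e : y = P' y - P' (w%:C ^+ n *: (T ^+ n) y) by rewrite -op_B; exact/esym/Pl'.
    by rewrite bopB [X in _ - X = _]e opprB addrA addrAC.
  apply: (le_trans (rnormD _ _)).
  have h1 : rnorm ((P - P') y) <= 4^-1 * rnorm y.
    rewrite (le_trans (PP' y))// ler_wpM2r ?rnorm_ge0//.
    have KM : 0 <= K * M ^+ 2 by rewrite mulr_ge0 ?sqr_ge0 ?ltW.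
    have ww : `|w0 - w| <= delta *+ 2.
      by rewrite ger0_norm /w; lra.
    have := ler_wpM2r KM ww; rewrite mulr2n mulrDl; lra.
  have h2 : rnorm (P' (w%:C ^+ n *: (T ^+ n) y)) <= 4^-1 * rnorm y.
    rewrite (le_trans (PM' _))// rnormZ cmodX cmod_real (ger0_norm (ltW w_gt0)).
    have h0 : rnorm ((T ^+ n) y) <= w1^-1 ^+ n * rnorm y by exact: NP.
    have h := ler_wpM2l (exprn_ge0 n (ltW w_gt0)) h0.
    rewrite mulrA -exprMn in h.
    have h' := ler_wpM2r (rnorm_ge0 y) (ltW (N2P _ N2n)).
    have := ler_wpM2l (ltW M_gt0) (le_trans h h').
    by have -> : M * ((4 * M)^-1 * rnorm y) = 4^-1 * rnorm y by field; rewrite gt_eqF.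
  by move: h1 h2; move: (rnorm _) (rnorm _) (rnorm _) => a b c; lra.
move=> x.
set y := x - w0%:C ^+ n *: (T ^+ n) x.
have Py : P y = x by exact: Pl.
have h1 : rnorm (x - y) <= 2^-1 * rnorm y by rewrite -{1}Py.
have h2 : rnorm y <= rnorm x + rnorm (x - y).
  by rewrite -{1}[y](subKr x) rnormB.
have : rnorm (x - y) <= rnorm x by lra.
rewrite /y subKr rnormZ cmodX cmod_real gtr0_norm// => h.
by rewrite exprVn ler_pdivlMl ?exprn_gt0.
Qed.

(** At w <= 1 / K the bound is trivial. The admissible step delta depends only on K, M and d, so
    finitely many steps lead from there to d. *)
Lemma pow2_bounded_max : pow2_bounded d.
Proof.
pose w0 := Num.min K^-1 d.
have w0_gt0 : 0 < w0 by rewrite lt_min invr_gt0 K_gt0 d_gt0.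
have KM : 0 < K * M ^+ 2 by rewrite mulr_gt0// exprn_gt0.
pose delta := Num.min (w0 / 2) (8 * (K * M ^+ 2))^-1.
have delta0 : 0 < delta.
  by rewrite lt_min divr_gt0//= invr_gt0 mulr_gt0.
have dw0 : delta *+ 2 <= w0.
  have : delta <= w0 / 2 by rewrite ge_min lexx.
  by move=> h; rewrite [leRHS]splitr mulr2n lerD.
have dK : delta * (K * M ^+ 2) <= 8^-1.
  rewrite -ler_pdivlMr// -invfM.
  by rewrite ge_min lexx orbT.
have w0d : w0 <= d by rewrite ge_min lexx orbT.
have base : pow2_bounded w0.
  exists 0%N => m _; apply: opb_le (opbX _ (ltW K_gt0) TK).
  have Kw : K <= w0^-1.
    by rewrite -[leLHS]invrK lef_pV2 ?posrE ?invr_gt0// ge_min lexx.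
  by rewrite lerXn2r// nnegrE ?(ltW K_gt0)// invr_ge0 ltW.
have step k : pow2_bounded (Num.min (w0 + delta * k%:R) d).
  elim: k => [|k IH]; first by rewrite mulr0 addr0 min_l.
  apply: (@pow2_bounded_step delta _ _ delta0 _ dK _ _ _ IH).
  - by rewrite (le_trans dw0)// le_min w0d andbT lerDl mulr_ge0// ltW.
  - by rewrite le_min !ge_min lexx orbT lerD2l ler_pM2l// ler_nat leqnSn.
  - rewrite -natr1 mulrDr mulr1 addrA -lerBlDr le_min !lerBlDr.
    by rewrite !(ge_min (_ + delta)) lexx/= lerDl (ltW delta0) orbT.
  - by rewrite ge_min lexx orbT.
have := step (Num.bound (d / delta)); rewrite min_r//.
have : d / delta < (Num.bound (d / delta))%:R.
  by rewrite archi_boundP// divr_ge0// ltW.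
rewrite ltr_pdivrMr// mulrC; move: w0_gt0; lra.
Qed.

End rickart.

(** P = P0 + (w - w0) P0 T P, and the last term is at most half of |P x|, so it can be absorbed on
    the left. *)
Lemma inv1_perturb T K M w0 w P0 P : 0 < K -> opb T K -> 0 < M ->
  inv1 (w0 *: T) P0 -> opb P0 M -> inv1 (w *: T) P ->
  cmod (w - w0) * (K * M) <= 2^-1 -> opb P (2 * M).
Proof.
move=> K0 TK M0 [P0l P0r] P0M [Pl Pr] wM x.
have : rnorm (P x) <= rnorm (P0 x) + rnorm ((w - w0) *: P0 (T (P x))).
  suff e : P0 x + (w - w0) *: P0 (T (P x)) = P x by rewrite -{1}e rnormD.
  move: (P x) (Pr x) => y <-; rewrite -op_Z -op_D.
  have -> : y - (w *: T) y + (w - w0) *: T y = y - (w0 *: T) y.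
    by rewrite scalerBl addrA subrK.
  by rewrite P0l.
rewrite rnormZ.
have h1 : rnorm (P0 (T (P x))) <= K * M * rnorm (P x).
  by rewrite (le_trans (P0M _))// [K * M]mulrC -mulrA ler_wpM2l ?(ltW M0).
have h2 := ler_wpM2l (cmod_ge0 (w - w0)) h1.
have h3 := ler_wpM2r (rnorm_ge0 (P x)) wM.
have := P0M x; rewrite mulrA in h2.
move: h2 h3; move: (rnorm _) (rnorm _) (rnorm _) (rnorm _) => a b c e.
rewrite !mulrA; lra.
Qed.

(** Local bounds from [inv1_perturb] are made uniform by compactness. The disc is parametrized
    inside a square of R * R, and the statement to be covered is conditional on lying in the
    disc. *)
Lemma resolvent_bounded T (d : R) : 0 < d ->
  (forall w, cmod w <= d -> exists P, inv1 (w *: T) P) ->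
  exists2 M, 0 < M & forall w, cmod w <= d -> exists P, inv1 (w *: T) P /\ opb P M.
Proof.
move=> d0 res.
have [K' K'0 TK'] := bop_rbound T.
pose K := K' + 1; have K0 : 0 < K by rewrite ltr_wpDl.
have TK : opb T K by apply: opb_le TK'; rewrite lerDl.
pose W (p : R * R) : R[i] := p.1 +i* p.2.
have WE p : cmod (W p) ^+ 2 = p.1 ^+ 2 + p.2 ^+ 2.
  by rewrite /cmod normc_def/= sqr_sqrtr// addr_ge0// sqr_ge0.
pose Sq := (`[- d, d] `*` `[- d, d] : set (R * R)).
have cSq : compact Sq by apply: compact_setX; exact: segment_compact.
have WSq w : cmod w <= d -> exists2 p, Sq p & W p = w.
  move=> wd; exists (complex.Re w, complex.Im w); last by case: w {wd}.
  have := le_trans (Re_le_cmod w) wd; rewrite ler_norml => h1.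
  have := le_trans (Re_le_cmod (- ci R * w)) _; rewrite Re_mulNi cmodM cmodN cmod_i mul1r.
  move=> /(_ _ wd); rewrite ler_norml => h2.
  by split; rewrite /= in_itv.
have := compact_near_coveringP Sq; case=> /(_ cSq) cov _.
have : \forall M \near +oo, Sq `<=` (fun p => cmod (W p) <= d ->
    forall P, inv1 (W p *: T) P -> opb P M).
  apply: cov => p _.
  have Wnear e : 0 < e -> \forall p' \near p, cmod (W p' - W p) < e.
    move=> e0; have e20 : 0 < e / 2 by rewrite divr_gt0.
    apply/nbhs_ballP; exists (e / 2) => //= p' [b1 b2].
    rewrite -(@ltr_pXn2r _ 2)// ?nnegrE ?cmod_ge0 ?ltW//.
    have -> : W p' - W p = W (p'.1 - p.1, p'.2 - p.2) by [].
    rewrite WE/=.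
    move: b1 b2; rewrite /ball/= (distrC p.1) (distrC p.2) => b1 b2.
    have sq (u : R) : `|u| < e / 2 -> u ^+ 2 < (e / 2) ^+ 2.
      move=> ue; rewrite -(real_normK (num_real u)).
      by rewrite ltr_pXn2r// ?nnegrE// ltW.
    have := sq _ b1; have := sq _ b2.
    have := sqr_ge0 (e / 2); rewrite exprMn; lra.
  have [pd|pd] := leP (cmod (W p)) d.
    have [P0 P0I] := res _ pd; have [M0' M0'0 P0M'] := bop_rbound P0.
    pose M0 := M0' + 1; have M00 : 0 < M0 by rewrite ltr_wpDl.
    have P0M : opb P0 M0 by apply: opb_le P0M'; rewrite lerDl.
    have e0 : 0 < 2^-1 / (K * M0) by rewrite divr_gt0// mulr_gt0.
    exists ([set p' | cmod (W p' - W p) < 2^-1 / (K * M0)], [set M | 2 * M0 <= M]).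
      by split; [exact: Wnear|exact: (nbhs_pinfty_ge (num_real _))].
    move=> [p' M] /= [pp' MM] _ P PI; apply: opb_le MM _.
    apply: (inv1_perturb K0 TK M00 P0I P0M PI).
    by rewrite -ler_pdivlMr ?mulr_gt0// ltW.
  (* A point of the square off the closed disc has a neighbourhood that misses the disc, where the
     condition is void. *)
  have e0 : 0 < cmod (W p) - d by rewrite subr_gt0.
  exists ([set p' | cmod (W p' - W p) < cmod (W p) - d], setT).
    by split; [exact: Wnear|exact: filterT].
  move=> [p' M] /= [pp' _] p'd P PI; exfalso.
  have := cmodD (W p') (- (W p' - W p)); rewrite cmodN opprB addrC subrK.
  by move: pp' p'd; lra.
move=> MS; have [M [MSM M0]] := filter_ex (filterI MS (nbhs_pinfty_gt (num_real (0 : R)))).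
exists M => // w wd; have [P PI] := res w wd; exists P; split => //.
by have [p Sp pw] := WSq w wd; apply: (MSM p Sp); rewrite pw.
Qed.

Theorem pow2_bounded_of_resolvent T (d : R) : 0 < d ->
  (forall w, cmod w <= d -> exists P, inv1 (w *: T) P) ->
  exists N : nat, forall m, (N <= m)%N -> opb (T ^+ (2 ^ m)) (d^-1 ^+ (2 ^ m)).
Proof.
move=> d0 res; have [M M0 resM] := resolvent_bounded d0 res.
have [K K0 TK] := bop_rbound T.
have K1 : 0 < K + 1 by rewrite ltr_wpDl.
have TK1 : opb T (K + 1) by apply: opb_le TK; rewrite lerDl.
exact: (pow2_bounded_max K1 TK1 M0 d0 resM).
Qed.

Lemma inv1_spectrum T (z : R[i]) : z != 0 -> ~ spectrum T z <-> exists P, inv1 (z^-1 *: T) P.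
Proof.
move=> z0; rewrite /spectrum/=; split=> [/contrapT[S [S1 S2]]|[P [Pl Pr]]].
  have Sl x : S (T x - z *: x) = x.
    by have /(congr1 (fun A : 'B(H) => A x)) := S1; rewrite bopM bopB bopZ.
  have Sr x : T (S x) - z *: S x = x.
    by have /(congr1 (fun A : 'B(H) => A x)) := S2; rewrite bopM bopB bopZ.
  exists (- z *: S); split => x; rewrite !bopZ.
    have -> : x - z^-1 *: T x = - z^-1 *: (T x - z *: x).
      by rewrite scalerBr !scaleNr scalerA mulVf// scale1r opprK addrC.
    by rewrite op_Z Sl scalerA mulrNN mulfV// scale1r.
  rewrite op_Z scalerA mulrN mulVf// -[RHS]Sr scaleNr scaleN1r opprK addrC.
  by [].
move=> nn; apply: nn; exists (- z^-1 *: P); split; apply: bop_ext => x.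
  rewrite bopM bopB !bopZ bop1E.
  have -> : T x - z *: x = - z *: (x - (z^-1 *: T) x).
    by rewrite bopZ scalerBr !scaleNr scalerA mulfV// scale1r opprK addrC.
  by rewrite op_Z Pl scalerA mulrNN mulVf// scale1r.
rewrite bopM bopB !bopZ !bop1E op_Z scalerA mulrN mulfV// scaleN1r opprK scaleNr.
by rewrite addrC; exact: Pr.
Qed.

End spectral.

(** * Conditionally positive definite sequences *)

Section cpd_sequences.
Variable R : realType.
Implicit Types (g : nat -> R) (p q : {poly R}).

Lemma mom_mul_wide g p q m n : (size p <= m)%N -> (size q <= n)%N ->
  mom g (p * q) = \sum_(i < m) \sum_(j < n) p`_i * q`_j * g (i + j)%N.
Proof.
move=> pm qn.
have wide (r : {poly R}) k : (size r <= k)%N -> r = \sum_(i < k) r`_i *: 'X^i.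
  move=> rk; rewrite -poly_def; apply/polyP => i; rewrite coef_poly.
  by case: ltnP => // /(leq_trans rk)/(nth_default 0).
rewrite {1}(wide p m)// {1}(wide q n)// mulr_suml linear_sum.
apply: eq_bigr => i _; rewrite mulr_sumr linear_sum; apply: eq_bigr => j _.
by rewrite -scalerAr -scalerAl -exprD !linearZ/= momXn; ring.
Qed.

Definition diff2 g n : R := g n.+2 - g n.+1 *+ 2 + g n.

Lemma mom_diff2 g p : mom (diff2 g) p = mom g (('X - 1) ^+ 2 * p).
Proof.
rewrite -mom_mulr; congr mom; apply/funext => n.
have -> : ('X - 1) ^+ 2 * 'X^n = 'X^(n.+2) - 'X^(n.+1) *+ 2 + 'X^n :> {poly R}.
  by rewrite !exprS; ring.
by rewrite linearD linearB linearMn /= !momXn.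
Qed.

Lemma diff2_inj g g' : g 0%N = g' 0%N -> g 1%N = g' 1%N -> diff2 g =1 diff2 g' ->
  g =1 g'.
Proof.
move=> g0 g1 gg n; suff [] : g n = g' n /\ g n.+1 = g' n.+1 by [].
elim: n => [|n [IH1 IH2]]; split => //.
by have := gg n; rewrite /diff2 IH1 IH2 => /addIr/addIr.
Qed.

(** The coefficients of p = (X - 1) q sum to p(1) = 0, so they are admissible in [cpd]; the
    resulting sum is the functional of [diff2 g] at q^2. *)
Lemma cpd_pos_def g : cpd g -> pos_def (diff2 g).
Proof.
move=> gc q; rewrite mom_diff2 -exprMn expr2; set p := ('X - 1) * q.
(* Sums in [cpd] have k + 1 terms: taking k = size p adds a zero coefficient and covers p = 0. *)
have pn : (size p <= (size p).+1)%N by [].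
rewrite (mom_mul_wide _ pn pn) -lecR.
have := gc (size p) (fun i => (p`_i)%:C); rewrite -rmorph_sum/=.
have -> : \sum_(i < (size p).+1) p`_i = 0.
  have : p.[1] = 0 by rewrite hornerM !hornerE subrr mul0r.
  rewrite (horner_coef_wide _ pn); under eq_bigr do rewrite expr1n mulr1.
  by [].
move=> /(_ erefl); congr (0 <= _).
rewrite rmorph_sum; apply: eq_bigr => i _; rewrite rmorph_sum; apply: eq_bigr => j _.
by rewrite conj_real -!rmorphM; congr (_%:C); ring.
Qed.

(** A real tuple with sum 0 is the coefficient list of a polynomial vanishing at 1, hence divisible
    by X - 1. A complex tuple splits into real and imaginary parts, whose cross terms cancel because
    g (i + j) is symmetric. *)
Lemma pos_def_cpd g : pos_def (diff2 g) -> cpd g.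
Proof.
move=> gp k l l0.
have real_case (r : 'I_k.+1 -> R) : \sum_i r i = 0 ->
    0 <= \sum_i \sum_j r i * r j * g (i + j)%N.
  move=> r0; pose p := \poly_(i < k.+1) r (inord i).
  have pk : (size p <= k.+1)%N by exact: size_poly.
  have pE (i : 'I_k.+1) : p`_i = r i by rewrite coef_poly ltn_ord inord_val.
  have : root p 1.
    have -> : root p 1 = (\sum_i r i == 0); last exact/eqP.
    rewrite /root (horner_coef_wide _ pk); congr (_ == 0); apply: eq_bigr => i _.
    by rewrite pE expr1n mulr1.
  move/factor_theorem => [q pq].
  have := gp q; rewrite mom_diff2 -exprMn mulrC -polyC1 -pq expr2.
  rewrite (mom_mul_wide _ pk pk); congr (0 <= _).
  by apply: eq_bigr => i _; apply: eq_bigr => j _; rewrite !pE.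
pose re i := complex.Re (l i); pose im i := complex.Im (l i).
have lE i : l i = (re i)%:C + ci R * (im i)%:C.
  rewrite /re /im /ci; case: (l i) => u v /=; apply/eqP; rewrite eq_complex/=.
  by rewrite !(mul0r, mulr0, mul1r, subr0, addr0, add0r) !eqxx.
have re0 : \sum_i re i = 0.
  by have := congr1 (@complex.Re R) l0; rewrite raddf_sum.
have im0 : \sum_i im i = 0.
  by have := congr1 (@complex.Im R) l0; rewrite raddf_sum.
have -> : \sum_(i < k.+1) \sum_(j < k.+1) (g (i + j)%N)%:C * l i * ((l j)^*)%R =
    (\sum_i \sum_j re i * re j * g (i + j)%N +
     \sum_i \sum_j im i * im j * g (i + j)%N)%:C.
  have -> : \sum_(i < k.+1) \sum_(j < k.+1) (g (i + j)%N)%:C * l i * ((l j)^*)%R =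
    \sum_(i < k.+1) \sum_(j < k.+1) ((re i * re j + im i * im j) * g (i + j)%N)%:C
    + ci R * (\sum_(i < k.+1) \sum_(j < k.+1) ((im i * re j) * g (i + j)%N)%:C -
      \sum_(i < k.+1) \sum_(j < k.+1) ((re i * im j) * g (i + j)%N)%:C).
    rewrite mulrBr !mulr_sumr -sumrB -big_split/=; apply: eq_bigr => i _.
    rewrite !mulr_sumr -sumrB -big_split/=; apply: eq_bigr => j _.
    rewrite (lE i) (lE j) rmorphD rmorphM/= !conj_real conj_i.
    rewrite !(rmorphM, rmorphD)/=.
    have -> : forall a b c d e : R[i], a * (b + ci R * c) * (d + - ci R * e) =
       (b * d - (ci R * ci R) * (c * e)) * a + (ci R * (c * d * a) - ci R * (b * e * a)).
      by move=> *; ring.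
    by rewrite ci_sq mulN1r opprK.
  rewrite [X in _ - X]exchange_big/=.
  rewrite [X in _ + ci R * X](_ : _ = 0) ?mulr0 ?addr0; last first.
    apply/eqP; rewrite subr_eq0; apply/eqP; apply: eq_bigr => i _.
    by apply: eq_bigr => j _; rewrite addnC [in RHS]mulrAC [im i * _]mulrC mulrAC.
  rewrite -big_split/= rmorph_sum; apply: eq_bigr => i _.
  rewrite -big_split/= rmorph_sum; apply: eq_bigr => j _.
  by rewrite mulrDl.
by rewrite lecR addr_ge0// real_case.
Qed.

(** The first difference of Q_m is the geometric sum 1 + x + ... + x^(m - 1). *)
Lemma QpolyS n x : Qpoly n.+2 x - Qpoly n.+1 x *+ 2 + Qpoly n x = x ^+ n :> R.
Proof.
have S1 m : Qpoly m.+1 x = Qpoly m x + \sum_(0 <= j < m) x ^+ j.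
  case: m => [|m]; first by rewrite /Qpoly !big_geq// addr0.
  rewrite /Qpoly/= big_nat_recr//= [in RHS]big_nat_recr//= addrA -big_split/=.
  congr (_ + _); last by rewrite (_ : m.+2 - m - 1 = 1)%N ?mul1r//; lia.
  apply: eq_big_nat => j /andP[_ jm].
  have -> : (m.+2 - j - 1 = (m.+1 - j - 1).+1)%N by lia.
  by rewrite -natr1 mulrDl mul1r.
by rewrite S1 (S1 n) big_nat_recr//=; ring.
Qed.

Lemma Qpoly0 x : Qpoly 0 x = 0 :> R. Proof. by rewrite /Qpoly big_geq. Qed.
Lemma Qpoly1 x : Qpoly 1 x = 0 :> R. Proof. by rewrite /Qpoly big_geq. Qed.

Lemma Qpoly_horner n : exists p : {poly R}, forall x, p.[x] = Qpoly n x.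
Proof.
exists (\sum_(0 <= j < n.-1) (n - j - 1)%N%:R *: 'X^j) => x.
rewrite horner_sum; apply: eq_bigr => j _.
by rewrite hornerZ hornerXn.
Qed.

End cpd_sequences.

(** * Representing triplets and their uniqueness *)

Section representing.
Variable R : realType.
Implicit Types (g : nat -> R) (nu : {finite_measure set R -> \bar R}).

(** A sequence is determined by its first two terms and its second difference. Q_0 and Q_1 vanish,
    n^2 has second difference 2, and Q_n has second difference x^n. *)
Lemma represents_diff2 g b c nu r : nu (~` `[- r, r]%classic) = 0%E ->
  (forall n, g n = g 0%N + b * n%:R + c * n%:R ^+ 2 + \int[nu]_x Qpoly n x) <->
  g 1%N = g 0%N + b + c /\ forall n, diff2 g n = c *+ 2 + \int[nu]_x x ^+ n.
Proof.
move=> nur.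
have iQ n : nu.-integrable setT (EFin \o @Qpoly R n).
  have [p pE] := Qpoly_horner R n.
  have := concentrated_itv_integrable p nur.
  by rewrite (_ : horner p = @Qpoly R n)//; exact/funext.
pose G n := g 0%N + b * n%:R + c * n%:R ^+ 2 + \int[nu]_x Qpoly n x.
have Q0 n : (n <= 1)%N -> \int[nu]_x Qpoly n x = 0.
  case: n => [|[|//]] _.
    by under eq_Rintegral do rewrite Qpoly0; rewrite Rintegral_cst// mul0r.
  by under eq_Rintegral do rewrite Qpoly1; rewrite Rintegral_cst// mul0r.
have G0 : G 0%N = g 0%N by rewrite /G Q0// expr0n/= !mulr0 !addr0.
have G1 : G 1%N = g 0%N + b + c by rewrite /G Q0// expr1n !mulr1 addr0.
have Gd n : diff2 G n = c *+ 2 + \int[nu]_x x ^+ n.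
  have -> : \int[nu]_x x ^+ n = \int[nu]_x Qpoly n.+2 x -
      \int[nu]_x Qpoly n.+1 x *+ 2 + \int[nu]_x Qpoly n x.
    under eq_Rintegral do rewrite -QpolyS.
    have i2 : nu.-integrable setT (EFin \o (fun x => Qpoly n.+1 x *+ 2)).
      rewrite (_ : (fun x => _) = (fun x => 2 * Qpoly n.+1 x)); last first.
        by apply/funext => x; rewrite mulr_natl.
      have := integrableZl measurableT 2 (iQ n.+1).
      by apply: eq_integrable => // x _; rewrite /= EFinM.
    have iB : nu.-integrable setT (EFin \o (fun x => Qpoly n.+2 x - Qpoly n.+1 x *+ 2)).
      have := integrableB measurableT (iQ n.+2) i2.
      by apply: eq_integrable.
    rewrite RintegralD// RintegralB//; congr (_ - _ + _).
    under eq_Rintegral do rewrite -mulr_natl.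
    by rewrite RintegralZl// mulr_natl.
  by rewrite /diff2 /G -!natr1; ring.
split => [gG|[g1 gd]].
  split; first by rewrite -G1 gG.
  move=> n; rewrite -Gd /diff2; congr (_ - _ *+ 2 + _); exact: gG.
move=> n; apply: (@diff2_inj _ g G) => //; first by rewrite G1.
by move=> m; rewrite gd Gd.
Qed.

Lemma momDl (a b : nat -> R) p : mom (fun n => a n + b n) p = mom a p + mom b p.
Proof. by rewrite /mom -big_split; apply: eq_bigr => i _; rewrite mulrDr. Qed.

Lemma mom_expr (x : R) p : mom (fun n => x ^+ n) p = p.[x].
Proof. by rewrite /mom horner_coef. Qed.

Lemma represents_cpd g (c : R) nu r : nu (~` `[- r, r]%classic) = 0%E -> 0 <= c ->
  (forall n, diff2 g n = c *+ 2 + \int[nu]_x x ^+ n) -> cpd g.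
Proof.
move=> nur c0 gd; apply: pos_def_cpd => q.
have -> : diff2 g = fun n => c *+ 2 * 1 ^+ n + \int[nu]_x x ^+ n.
  by apply/funext => n; rewrite gd expr1n mulr1.
rewrite momDl momZl mom_expr -(Rintegral_horner _ nur) horner_exp.
apply: addr_ge0; first by rewrite mulr_ge0 ?sqr_ge0 ?mulrn_wge0.
by apply: Rintegral_ge0 => x _; rewrite horner_exp sqr_ge0.
Qed.

Lemma half_line_unique (m1 m2 : {measure set R -> \bar R}) :
  (m1 setT < +oo)%E -> (forall t : R, m1 `]-oo, t[%classic = m2 `]-oo, t[%classic) ->
  forall A, measurable A -> m1 A = m2 A.
Proof.
move=> m1fin key.
have cover : \bigcup_k `]-oo, (k%:R : R)[%classic = setT.
  apply/seteqP; split => // x _; exists (Num.bound `|x|) => //=.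
  by rewrite in_itv/= (le_lt_trans (ler_norm x))// archi_boundP.
apply: (@measure_unique _ _ _ (@RGenInftyO.G R) (fun k => `]-oo, (k%:R : R)[%classic)) => //.
- exact: RGenInftyO.measurableE.
- move=> _ _ [x ->] [y ->]; exists (Num.min x y).
  by apply/seteqP; split => z /=; rewrite !in_itv/= lt_min => /andP.
- by move=> k; exists k%:R.
- by move=> _ [x ->]; exact: key.
- by move=> k; apply: le_lt_trans m1fin; apply: le_measure; rewrite ?inE.
Qed.

(** The constant 2 c is absorbed as an atom: nu + 2 c delta_1 has moments [diff2 g] and is therefore
    determined. Its mass at 1 is 2 c since nu does not charge 1. The condition r >= 1 places the
    atom inside [- r, r]. *)
Lemma represents_diff2_unique g (c c' : R) nu nu' r : 1 <= r ->
  nu (~` `[- r, r]%classic) = 0%E -> nu' (~` `[- r, r]%classic) = 0%E ->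
  nu [set 1] = 0%E -> nu' [set 1] = 0%E -> 0 <= c -> 0 <= c' ->
  (forall n, diff2 g n = c *+ 2 + \int[nu]_x x ^+ n) ->
  (forall n, diff2 g n = c' *+ 2 + \int[nu']_x x ^+ n) ->
  c = c' /\ forall A, measurable A -> nu A = nu' A.
Proof.
move=> r1 nur nur' nu1 nu1' c0 c0' gd gd'.
pose k : {nonneg R} := NngNum (mulrn_wge0 2 c0).
pose k' : {nonneg R} := NngNum (mulrn_wge0 2 c0').
pose dir : {measure set R -> \bar R} := dirac (1 : R).
pose m : {measure set R -> \bar R} := measure_add nu (mscale k dir).
pose m' : {measure set R -> \bar R} := measure_add nu' (mscale k' dir).
have mE A : m A = (nu A + (c *+ 2)%:E * dirac (1%R : R) A)%E.
  exact: (measure_addE nu (mscale k dir) A).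
have mE' A : m' A = (nu' A + (c' *+ 2)%:E * dirac (1%R : R) A)%E.
  exact: (measure_addE nu' (mscale k' dir) A).
have fdir A : dirac (1 : R) A \is a fin_num by rewrite diracE.
have mm A : measurable A -> m A = m' A.
  apply: half_line_unique => [|t].
    by rewrite mE ltey_eq fin_numD fin_num_measure ?fin_numM.
  rewrite mE mE'.
  have [p hp] := half_line_moments r t.
  have dr : dirac (1 : R) (~` `[- r, r]%classic) = 0%E :> \bar R.
    rewrite diracE memNset//= => /(_ _) []; rewrite in_itv/= r1 andbT.
    by rewrite (le_trans _ ler01)// oppr_le0 (le_trans ler01).
  have key (d : R) (n : {finite_measure set R -> \bar R}) : n (~` `[- r, r]%classic) = 0%E ->
      (forall j, diff2 g j = d *+ 2 + \int[n]_x x ^+ j) ->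
      mom (diff2 g) (p j) @[j --> \oo] -->
      fine (n `]-oo, t[%classic) + d *+ 2 * fine (dirac (1 : R) `]-oo, t[%classic : \bar R).
    move=> nr gdn.
    have -> : diff2 g = fun j => \int[n]_x x ^+ j + d *+ 2 * \int[dirac (1 : R)]_x x ^+ j.
      apply/funext => j; rewrite gdn addrC; congr (_ + _).
      rewrite /Rintegral integral_dirac//; last first.
        by apply/measurable_EFinP; exact: exprn_measurable.
      by rewrite diracE in_setT mul1e/= expr1n mulr1.
    under eq_fun do rewrite momDl momZl.
    apply: cvgD; first exact: hp.
    by apply: cvgMl_tmp; exact: (hp (dirac (1 : R)) dr).
  have e := cvg_unique _ (key c nu nur gd) (key c' nu' nur' gd').
  rewrite -[nu _]fineK ?fin_num_measure// -[nu' _]fineK ?fin_num_measure//.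
  rewrite -[dirac _ _ in LHS]fineK// -[dirac _ _ in RHS]fineK//.
  rewrite -!EFinM -!EFinD; congr EFin; apply: e; exact: norm_hausdorff.
have cc : c = c'.
  have := mm _ (measurable_set1 1); rewrite mE mE' nu1 nu1' !add0e diracE mem_set//=.
  by rewrite !mule1 => -[]; clear; move=> h; lra.
split => // A mA; have := mm A mA; rewrite mE mE' -cc.
have fk : ((c *+ 2)%:E * dirac (1%R : R) A)%E \is a fin_num by rewrite fin_numM.
move: fk; case: (_ * _)%E => // u _; rewrite -[nu A]fineK ?fin_num_measure//.
by rewrite -[nu' A]fineK ?fin_num_measure// -!EFinD => -[/addIr ->].
Qed.

End representing.

(** * Semispectral measures *)

Section operator_measures.
Variables (R : realType) (H : hilbertType R).
Implicit Types (h x y : H) (S L : 'B(H)).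

Lemma bop_sum (I : Type) (s : seq I) (P : pred I) (S : I -> 'B(H)) x :
  (\sum_(i <- s | P i) S i) x = \sum_(i <- s | P i) S i x.
Proof. by apply: (big_morph (fun L : 'B(H) => L x)). Qed.

Lemma inner_suml (I : Type) (s : seq I) (P : pred I) (u : I -> H) y :
  '[\sum_(i <- s | P i) u i, y] = \sum_(i <- s | P i) '[u i, y].
Proof.
by apply: (big_morph (fun x => '[x, y])) => [a b|]; rewrite ?innerDl ?inner0l.
Qed.

Lemma inner_op_sum (I : Type) (s : seq I) (P : pred I) (S : I -> 'B(H)) x y :
  '[(\sum_(i <- s | P i) S i) x, y] = \sum_(i <- s | P i) '[S i x, y].
Proof. by rewrite bop_sum inner_suml. Qed.

Lemma quad_weak_cvg (S : nat -> 'B(H)) L :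
  (forall h, (fun n => '[S n h, h] : R[i]^o) @ \oo --> ('[L h, h] : R[i]^o)) ->
  forall x y, (fun n => '[S n x, y] : R[i]^o) @ \oo --> ('[L x, y] : R[i]^o).
Proof.
move=> SL x y; rewrite op_polar; under eq_fun do rewrite op_polar.
rewrite /polar; apply: (@cvgMl_tmp R[i]); apply: cvgD; first by apply: cvgB; exact: SL.
by apply: (@cvgMl_tmp R[i]); apply: cvgB; exact: SL.
Qed.

Lemma quad_real_bound S (q : H -> R) : (forall h, '[S h, h] = (q h)%:C) ->
  exists2 M, 0 <= M & forall h, `|q h| <= M * rnorm h ^+ 2.
Proof.
move=> Sq; have [M M0 SM] := bop_rbound S; exists M => // h.
rewrite -cmod_real -Sq (le_trans (cmod_inner_le _ _))// expr2 mulrA.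
by rewrite ler_wpM2r ?rnorm_ge0.
Qed.

Lemma fine_sigma_additive (nu : {finite_measure set R -> \bar R}) (A : (set R)^nat) :
  (forall i, measurable (A i)) -> trivIset setT A ->
  \sum_(0 <= i < n) fine (nu (A i)) @[n --> \oo] --> fine (nu (\bigcup_i A i)).
Proof.
move=> mA tA; have mUA : measurable (\bigcup_i A i) by exact: bigcupT_measurable.
have : (\sum_(0 <= i < n) nu (A i))%E @[n --> \oo] --> (fine (nu (\bigcup_i A i)))%:E.
  rewrite fineK ?fin_num_measure//; exact: measure_semi_sigma_additive.
move=> /fine_cvg; apply: cvg_trans; apply: near_eq_cvg; near=> n => /=.
by rewrite sum_fine// => i _; rewrite fin_num_measure.
Unshelve. all: by end_near. Qed.

Lemma concentrated_sym (nu : {measure set R -> \bar R}) (r : R) :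
  nu (~` `[0, r]%classic) = 0%E -> nu (~` `[- r, r]%classic) = 0%E.
Proof.
move=> nur; apply/eqP; rewrite eq_le measure_ge0 andbT -nur; apply: le_measure; rewrite ?inE.
- exact: measurableC.
- exact: measurableC.
apply: subsetC => x /=; rewrite !in_itv/= => /andP[x0 xr]; rewrite xr andbT.
by rewrite (le_trans _ x0)// oppr_le0 (le_trans x0).
Qed.

Variables (mu : H -> {finite_measure set R -> \bar R}) (r : R) (D : nat -> 'B(H)).
Hypothesis mur : forall h, mu h (~` `[0, r]%classic) = 0%E.
Hypothesis DE : forall n h, '[D n h, h] = (\int[mu h]_x x ^+ n)%:C.

Let has_op (A : set R) := exists L, forall h, '[L h, h] = (fine (mu h A))%:C.

Let mom_op (p : {poly R}) : 'B(H) := \sum_(i < size p) (p`_i)%:C *: D i.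

Let mom_opE p h : '[mom_op p h, h] = (mom (fun n => \int[mu h]_x x ^+ n) p)%:C.
Proof.
rewrite inner_op_sum /mom rmorph_sum; apply: eq_bigr => i _.
by rewrite bopZ innerZl DE -rmorphM.
Qed.

Let D0E h : '[D 0 h, h] = (fine (mu h setT))%:C.
Proof.
rewrite DE; congr (_%:C); under eq_Rintegral do rewrite expr0.
by rewrite Rintegral_cst// mul1r.
Qed.

Let mu_bound : exists M, forall A h, measurable A -> `|fine (mu h A)| <= M * rnorm h ^+ 2.
Proof.
have [M M0 DM] := quad_real_bound D0E; exists M => A h mA.
apply: le_trans (DM h); rewrite !ger0_norm ?fine_ge0//.
by rewrite fine_le ?fin_num_measure// le_measure ?inE.
Qed.

Let muNr h : mu h (~` `[- r, r]%classic) = 0%E.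
Proof. exact: (@concentrated_sym (mu h) r (mur h)). Qed.

(** The form of the total mass [D 0] bounds the masses of all measurable sets at once; this is the
    bound that [quad_limit] asks for, both for half-lines and for countable unions. *)
Lemma operator_measure_exists A : measurable A -> has_op A.
Proof.
have [M muM] := mu_bound.
suff G_op B : (@RGenInftyO.G R).-sigma.-measurable B -> has_op B.
  by move=> mA; apply: G_op; rewrite -RGenInftyO.measurableE.
move: B; apply: (@dynkin_induction _ (measurableTypeR R) (@RGenInftyO.G R) has_op).
- exact: RGenInftyO.measurableE.
- move=> _ _ [x ->] [y ->]; exists (Num.min x y).
  by apply/seteqP; split => z /=; rewrite !in_itv/= lt_min => /andP.
- by exists (D 0); exact: D0E.
- move=> _ [t ->]; have [p pcvg] := half_line_moments r t.
  have [|L LE] := quad_limit (S := fun n => mom_op (p n)) (fun n h => mom_opE (p n) h)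
    (fun h => pcvg _ (muNr h)) (M := M); last by exists L.
  by move=> h; apply: muM.
- move=> {}A mA [L LE]; exists (D 0 - L) => h.
  rewrite bopB innerDl innerNl D0E LE -rmorphB/=; congr (_%:C).
  rewrite -fineB ?fin_num_measure//; congr fine.
  rewrite -setTD measureD// ?setTI//.
  by rewrite ltey_eq fin_num_measure.
- move=> {}A mA tA LA.
  have /choice [L LE] : forall i, exists L, forall h, '[L h, h] = (fine (mu h (A i)))%:C by [].
  have mUA : measurable (\bigcup_i A i) by exact: bigcupT_measurable.
  have [||h|L' L'E] := @quad_limit R H nat \oo _ (fun n => \sum_(0 <= i < n) L i)
     (fun n h => \sum_(0 <= i < n) fine (mu h (A i))) (fun h => fine (mu h (\bigcup_i A i))) M.
  + by move=> n h; rewrite inner_op_sum rmorph_sum; apply: eq_bigr => i _; rewrite LE.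
  + by move=> h; exact: fine_sigma_additive.
  + exact: muM.
  + by exists L'.
Qed.

(** The point [a] is removed from every mu_h at the outset. With a = 1 this gives F({1}) = 0, and
    the removed atom is left for C. *)
Lemma semispectral_of_measures (a : R) : exists F : semispectral H,
  forall h A, measurable A -> quad_measure F h A = mu h (A `\ a).
Proof.
pose isM A := [set L : 'B(H) | forall h, '[L h, h] = (fine (mu h (A `\ a)))%:C].
pose M A : 'B(H) := xget (0 : 'B(H)) (isM A).
have mDa A : measurable A -> measurable (A `\ a).
  by move=> mA; apply: measurableD => //; exact: measurable_set1.
have ME A : measurable A -> forall h, '[M A h, h] = (fine (mu h (A `\ a)))%:C.
  move=> mA; have [L LE] := operator_measure_exists (mDa A mA).
  exact: (@xgetPex _ 0 (isM A) (ex_intro _ L LE)).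
have M_ge0 A : measurable A -> A `<=` @Rplus R -> op_ge0 (M A).
  by move=> mA _ h; rewrite ME// lecR fine_ge0.
have M_add (A : (set R)^nat) : (forall i, measurable (A i)) ->
    (forall i, A i `<=` @Rplus R) -> trivIset setT A ->
    forall x y, (fun n => \sum_(0 <= i < n) '[M (A i) x, y] : R[i]^o)
      @ \oo --> ('[M (\bigcup_i A i) x, y] : R[i]^o).
  move=> mA _ tA x y.
  have mUA : measurable (\bigcup_i A i) by exact: bigcupT_measurable.
  under eq_fun do rewrite -inner_op_sum.
  apply: quad_weak_cvg => h; rewrite ME//.
  under eq_fun do rewrite inner_op_sum (eq_bigr _ (fun i _ => ME _ (mA i) h)) -rmorph_sum.
  apply: cvg_complexr.
  have mB i : measurable (A i `\ a) by exact: mDa.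
  have tB : trivIset setT (fun i => A i `\ a) by exact: trivIset_setIr.
  by have := @fine_sigma_additive (mu h) _ mB tB; rewrite -setI_bigcupl.
exists (Semispectral M_ge0 M_add) => h A mA.
have mAp : measurable (A `&` @Rplus R) by apply: measurableI => //; exact: measurable_itv.
rewrite /quad_measure asboolT//= ME//= fineK ?fin_num_measure//; last exact: mDa.
rewrite -[LHS](measure_concentrated _ (mur h))//; last exact: mDa.
rewrite -[RHS](measure_concentrated _ (mur h))//; last exact: mDa.
congr (mu h _); apply/seteqP; split => x /= [] [].
  by move=> [].
move=> Ax xa x0r; split => //; split => //; split => //.
by move: x0r; rewrite /Rplus/= !in_itv/= => /andP[->].
Unshelve. all: by end_near. Qed.

End operator_measures.

Section concentrated_bound.
Context d (T : measurableType d) (R : realType).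
Variables (mu : {finite_measure set T -> \bar R}) (D : set T).
Hypotheses (mD : measurable D) (muD : mu (~` D) = 0%E).

Lemma Rintegral_bound (f : T -> R) (M : R) : measurable_fun setT f ->
  (forall x, D x -> `|f x| <= M) -> `|\int[mu]_x f x| <= M * fine (mu setT).
Proof.
move=> mf fM; rewrite (Rintegral_concentrated mD muD mf fM).
have If : mu.-integrable D (EFin \o f).
  by apply: integrableS (bounded_on_integrable mD muD mf fM).
rewrite (le_trans (le_normr_Rintegral mD If))//.
rewrite -(measure_concentrated mD muD measurableT) setTI -Rintegral_cst//.
apply: le_Rintegral => //.
- exact: (integrable_norm If).
- apply: (integrableS measurableT) => //; exact: finite_measure_integrable_cst.
Qed.

End concentrated_bound.

(** * Integrals and supports of semispectral measures *)

Section semispectral_integrals.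
Variables (R : realType) (H : hilbertType R) (F : semispectral H).
Implicit Types h : H.

Lemma measurable_Rplus : measurable (@Rplus R).
Proof. exact: measurable_itv. Qed.

Lemma op_ge0E (S : 'B(H)) h : op_ge0 S -> '[S h, h] = (complex.Re '[S h, h])%:C.
Proof. by move=> /(_ h) S0; rewrite RRe_real// ger0_real. Qed.

Lemma op_ge0_Re (S : 'B(H)) h : op_ge0 S -> 0 <= complex.Re '[S h, h].
Proof. by move=> /(_ h); rewrite lecE => /andP[]. Qed.

Lemma quad_measureE h A : measurable A ->
  '[F (A `&` @Rplus R) h, h] = (fine (quad_measure F h A))%:C.
Proof.
move=> mA; rewrite /quad_measure asboolT//=; apply: op_ge0E; apply: sm_ge0 => //.
by apply: measurableI => //; exact: measurable_Rplus.
Qed.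

Lemma quad_measure_neg h : quad_measure F h (~` @Rplus R) = 0%E.
Proof.
rewrite /quad_measure asboolT; last by apply: measurableC; exact: measurable_Rplus.
by rewrite setICl sm0.
Qed.

Lemma sm_null A : measurable A -> (forall h, quad_measure F h A = 0%E) ->
  F (A `&` @Rplus R) = 0.
Proof.
by move=> mA A0; apply: bop_eq => h; rewrite quad_measureE// A0/= inner0l.
Qed.

Lemma sm_null_quad A h : measurable A -> F (A `&` @Rplus R) = 0 -> quad_measure F h A = 0%E.
Proof.
by move=> mA A0; rewrite /quad_measure asboolT// A0 inner0l.
Qed.

Lemma op_integralE (f : R -> R) (S : 'B(H)) :
  (forall h, '[S h, h] = (\int[quad_measure F h]_(x in @Rplus R) f x)%:C) ->
  forall h, '[op_integral F f h, h] = (\int[quad_measure F h]_(x in @Rplus R) f x)%:C.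
Proof.
move=> SE; exact: (@xgetPex _ 0 [set S : 'B(H) | forall h,
  '[S h, h] = (\int[quad_measure F h]_(x in @Rplus R) f x)%:C] (ex_intro _ S SE)).
Qed.

Import HBNNSimple.

Let simple_op (g : {nnsfun R >-> R}) : 'B(H) :=
  \sum_(y <- finmap.enum_fset (fset_set (range g))) y%:C *: F (g @^-1` [set y] `&` @Rplus R).

Let simple_opE (g : {nnsfun R >-> R}) h :
  '[simple_op g h, h] = (fine (sintegral (quad_measure F h) g))%:C.
Proof.
rewrite inner_op_sum sintegralE fsbig_finite//.
rewrite -sum_fine => [|y _]; last by rewrite fin_numM// fin_num_measure.
rewrite rmorph_sum; apply: eq_bigr => y _.
rewrite bopZ innerZl quad_measureE// -rmorphM; congr (_%:C).
by rewrite fineM// fin_num_measure.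
Qed.

(** As [op_integral] is an [xget], an operator with the right form has to be produced: simple
    functions give finite sums of values of F, and monotone convergence with [quad_limit] gives the
    limit. *)
Lemma op_integralP (r M : R) (f : R -> R) :
  (forall h, quad_measure F h (~` `[0, r]%classic) = 0%E) ->
  measurable_fun setT f -> (forall t, Rplus t -> 0 <= f t) ->
  (forall t, `[0, r]%classic t -> f t <= M) ->
  forall h, '[op_integral F f h, h] = (\int[quad_measure F h]_(x in @Rplus R) f x)%:C.
Proof.
move=> Fr mf f0 fM.
suff [S SE] : exists S : 'B(H), forall h,
    '[S h, h] = (\int[quad_measure F h]_(x in @Rplus R) f x)%:C by exact: (op_integralE SE).
(* Increasing simple approximations need a function nonnegative on the whole line, whereas [f] may
   be negative off [Rplus]. *)
pose f' := f \_ (@Rplus R).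
have mf' : measurable_fun setT f'.
  by apply/(measurable_restrictT _ measurable_Rplus); exact: measurable_funTS.
have f'0 x : 0 <= f' x.
  by rewrite /f' patchE; case: ifPn => // /set_mem/f0.
have f'M x : `[0, r]%classic x -> `|f' x| <= M.
  move=> x0r; rewrite ger0_norm// /f' patchE ifT ?fM// inE.
  by move: x0r; rewrite /= /Rplus/= !in_itv/= => /andP[->].
have mF' : measurable_fun setT (EFin \o f') by exact/measurable_EFinP.
pose g := nnsfun_approx measurableT mF'.
pose q n h := fine (sintegral (quad_measure F h) (g n)).
have m0r : measurable `[0, r]%classic by exact: measurable_itv.
have If' h := bounded_on_integrable m0r (Fr h) mf' f'M.
have qcvg h : q n h @[n --> \oo] --> \int[quad_measure F h]_x f' x.
  have : (\int[quad_measure F h]_x (g n x)%:E)%E @[n --> \oo] -->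
      (\int[quad_measure F h]_x f' x)%:E.
    rewrite /Rintegral fineK; last first.
      exact: (integrable_fin_num measurableT (If' h)).
    have -> : (\int[quad_measure F h]_x (f' x)%:E =
        \int[quad_measure F h]_x (limn (fun n => (g n x)%:E)))%E.
      apply: eq_integral => x _; apply/esym/cvg_lim => //.
      by apply: (cvg_nnsfun_approx measurableT mF') => // y _; rewrite lee_fin.
    apply: cvg_monotone_convergence => //.
    - by move=> n; apply/measurable_EFinP; exact: measurable_funP.
    - by move=> n x _; rewrite lee_fin.
    - by move=> x _ m n mn; rewrite lee_fin; apply/lefP/nd_nnsfun_approx.
  under eq_fun do rewrite integralT_nnsfun.
  exact: fine_cvg.
have [K K0 FK] := quad_real_bound (fun h => quad_measureE h measurableT).
have [|L LE] := quad_limit (F := \oo) (fun n => simple_opE (g n)) qcvg (M := `|M| * K); last first.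
- by exists L => h; rewrite LE [in RHS]Rintegral_mkcond.
- move=> h; rewrite -mulrA.
  apply: le_trans (Rintegral_bound m0r (Fr h) mf' f'M) _.
  apply: le_trans (_ : `|M| * fine (quad_measure F h setT) <= _).
    by rewrite ler_wpM2r ?fine_ge0// ler_norm.
  by rewrite ler_wpM2l// (le_trans (ler_norm _) (FK h)).
Qed.
Lemma op_suppP (x : R) : op_supp F x <-> Rplus x /\
  forall U, open U -> U x -> exists h, quad_measure F h U <> 0%E.
Proof.
split => -[x0 xS]; split => // U oU Ux.
  have mU := open_measurable oU.
  apply: contrapT => /forallNP U0; apply: (xS U oU Ux); apply: sm_null => // h.
  by apply: contrapT; exact: U0.
have mU := open_measurable oU.
have [h Uh] := xS U oU Ux; contra: Uh => UF.
exact: sm_null_quad.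
Qed.

Lemma closed_op_supp : closed (op_supp F).
Proof.
move=> x cx; split => [|U oU Ux].
  rewrite /Rplus/= in_itv/= andbT leNgt; apply/negP => x0.
  have [y [[+ _] /=]] := cx _ (open_nbhs_nbhs (conj (@open_lt R 0) x0)).
  by rewrite /Rplus/= in_itv/= andbT leNgt => /negP.
by have [y [[_ yS] Uy]] := cx _ (open_nbhs_nbhs (conj oU Ux)); exact: yS.
Qed.

Lemma notin_op_supp x : ~ op_supp F x ->
  exists U, [/\ open U, U x & forall h, quad_measure F h U = 0%E].
Proof.
have [x0|/negP x0] := boolP (0 <= x); last first.
  move=> _; exists [set y | y < 0]; split; first exact: open_lt.
    by rewrite /= ltNge; apply/negP.
  move=> h; rewrite -(quad_measure_neg h); congr (quad_measure F h _).
  by apply/seteqP; split => y /=; rewrite /Rplus/= in_itv/= andbT ltNge => /negP.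
move=> /op_suppP/not_andP[[]|]; first by rewrite /Rplus/= in_itv/= x0.
move=> /existsNP[U /not_implyP[oU /not_implyP[Ux /forallNP U0]]].
by exists U; split => // h; apply: contrapT; exact: U0.
Qed.

Lemma op_supp_sub r : (forall h, quad_measure F h (~` `[0, r]%classic) = 0%E) ->
  op_supp F `<=` `[0, r].
Proof.
move=> F0 x /op_suppP[x0 xS]; apply: contrapT => xr.
have xr' : r < x.
  by rewrite ltNge; apply/negP => h; apply: xr; move: x0; rewrite /Rplus/= !in_itv/= h => /andP[->].
have [h] := xS _ (@open_gt R r) xr'; apply.
apply/eqP; rewrite eq_le measure_ge0 andbT -(F0 h) le_measure ?inE//.
- by apply: open_measurable; exact: open_gt.
- by apply: measurableC; exact: measurable_itv.
by move=> y /= ry; rewrite in_itv/= => /andP[_]; rewrite leNgt ry.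
Qed.

Lemma compact_null (mu : {measure set R -> \bar R}) (K : set R) : compact K ->
  (forall x, K x -> exists U, [/\ open U, U x & mu U = 0%E]) -> mu.-negligible K.
Proof.
move=> + Knull; rewrite compact_cover.
have /choice [f fP] x : exists U, K x -> [/\ open U, U x & mu U = 0%E].
  have [/Knull[U UP]|nK] := pselect (K x); first by exists U.
  by exists set0.
move=> /(_ R K f) [x /fP[]//|x Kx|D DK KD].
  by exists x => //; have [] := fP x Kx.
apply: negligibleS KD _; rewrite /cover bigcup_fset big_seq.
apply: (big_ind (fun A => mu.-negligible A)) => [|A B|x xD].
- exact: negligible_set0.
- exact: negligibleU.
have [oU _ U0] := fP x (set_mem (DK _ xD)).
by apply/negligibleP => //; exact: open_measurable.
Qed.

(** Beyond r the line is exhausted by the compact intervals [r, k], which miss the support and so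
    are covered by finitely many null open sets. The strict s < r keeps the endpoint r off the
    support. *)
Lemma op_supp_concentrated s r : op_supp F `<=` `]-oo, s]%classic -> s < r ->
  forall h, quad_measure F h (~` `[0, r]%classic) = 0%E.
Proof.
move=> Fs sr h; apply/negligibleP; first by apply: measurableC; exact: measurable_itv.
apply: (@negligibleS _ _ _ _ (~` @Rplus R `|` \bigcup_k `[r, (k%:R : R)]%classic)).
  move=> x /=; rewrite /Rplus/= !in_itv/= andbT => /negP; rewrite negb_and -ltNge => /orP[|].
    by move=> x0; left; apply/negP; rewrite -ltNge.
  rewrite -ltNge => rx; right; exists (Num.bound `|x|) => //=.
  by rewrite in_itv/= (ltW rx)/= (le_trans (ler_norm x))// (ltW (archi_boundP _)).
apply: negligibleU.
  apply/negligibleP; last exact: quad_measure_neg.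
  by apply: measurableC; exact: measurable_Rplus.
apply: negligible_bigcup => k; apply: compact_null; first exact: segment_compact.
move=> x /=; rewrite in_itv/= => /andP[rx _].
have [|U [oU Ux U0]] := @notin_op_supp x; last by exists U.
by move=> /Fs /=; rewrite in_itv/= leNgt (lt_le_trans sr rx).
Qed.

Lemma measure_supp_sub h : measure_supp (quad_measure F h) `<=` op_supp F.
Proof.
by move=> x xS; apply: contrapT => /notin_op_supp[U [oU Ux U0]]; exact: (xS U).
Qed.

Lemma closed_measure_supp (mu : set R -> \bar R) : closed (measure_supp mu).
Proof.
move=> x cx U oU Ux.
by have [y [yS Uy]] := cx _ (open_nbhs_nbhs (conj oU Ux)); exact: yS.
Qed.

Lemma compact_measure_supp h : compact (op_supp F) -> compact (measure_supp (quad_measure F h)).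
Proof.
by move=> cF; apply: subclosed_compact cF _; [exact: closed_measure_supp|exact: measure_supp_sub].
Qed.

End semispectral_integrals.

(** * Conditionally positive definite operators *)

Section adjoint_powers.
Variables (R : realType) (H : hilbertType R).
Implicit Types (h x y : H) (S T B C : 'B(H)).

Lemma adjointP' T x y : '[adjoint T x, y] = '[x, T y].
Proof. by rewrite innerC -adjointP -innerC. Qed.

Lemma adjoint_exp T n x y : '[(adjoint T ^+ n) x, y] = '[x, (T ^+ n) y].
Proof.
elim: n x y => [|n IH] x y; first by rewrite !expr0.
by rewrite bop_expS bop_expSr adjointP' IH.
Qed.

Lemma adjoint_exp_quad T n h :
  '[(adjoint T ^+ n * T ^+ n) h, h] = (rnorm ((T ^+ n) h) ^+ 2)%:C.
Proof. by rewrite bopM adjoint_exp inner_rnorm. Qed.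

Lemma selfadjoint_quad B h : adjoint B = B -> '[B h, h] = (complex.Re '[B h, h])%:C.
Proof.
move=> BB; have : '[B h, h] = ('[B h, h]^*)%R by rewrite -innerC -{1}BB adjointP'.
case: '[B h, h] => a b /= /eqP; rewrite eq_complex/= => /andP[_ /eqP bN].
by apply/eqP; rewrite eq_complex/= eqxx; apply/eqP; move: bN; clear; lra.
Qed.

Lemma quad_selfadjoint B (q : H -> R) : (forall h, '[B h, h] = (q h)%:C) -> adjoint B = B.
Proof. by move=> Bq; apply: bop_eq => h; rewrite adjointP' innerC Bq conj_real. Qed.

Lemma quad_ge0 C (q : H -> R) : (forall h, '[C h, h] = (q h)%:C) -> (forall h, 0 <= q h) ->
  op_ge0 C.
Proof. by move=> Cq q0 h; rewrite Cq lecR. Qed.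

End adjoint_powers.

Section representation.
Variables (R : realType) (H : hilbertType R).
Implicit Types (h : H) (T B C : 'B(H)) (F : semispectral H).

Lemma Qpoly_ge0 n (x : R) : 0 <= x -> 0 <= Qpoly n x.
Proof. by move=> x0; apply: sumr_ge0 => i _; rewrite mulr_ge0 ?exprn_ge0. Qed.

Lemma le_Qpoly n (x y : R) : 0 <= x -> x <= y -> Qpoly n x <= Qpoly n y.
Proof.
move=> x0 xy; apply: ler_sum => i _; rewrite ler_wpM2l//.
by rewrite lerXn2r// nnegrE// (le_trans x0).
Qed.

Lemma measurable_Qpoly n : measurable_fun setT (@Qpoly R n).
Proof.
by apply: measurable_sum => i; apply: measurable_funM => //; exact: exprn_measurable.
Qed.

Lemma Rintegral_Rplus (mu : {finite_measure set R -> \bar R}) r (f : R -> R) (M : R) :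
  mu (~` `[0, r]%classic) = 0%E -> measurable_fun setT f ->
  (forall x, `[0, r]%classic x -> `|f x| <= M) ->
  \int[mu]_(x in @Rplus R) f x = \int[mu]_x f x.
Proof.
move=> mur mf fM; have m0r : measurable `[0, r]%classic by exact: measurable_itv.
pose f' := f \_ (@Rplus R).
have mf' : measurable_fun setT f'.
  by apply/(measurable_restrictT _ (@measurable_Rplus R)); exact: measurable_funTS.
have -> : \int[mu]_(x in @Rplus R) f x = \int[mu]_x f' x by rewrite [LHS]Rintegral_mkcond.
have sub x : `[0, r]%classic x -> x \in @Rplus R.
  by rewrite inE /Rplus/= !in_itv/= => /andP[->].
rewrite (@Rintegral_concentrated _ _ _ mu _ m0r mur f' M mf'); last first.
  by move=> x xr; rewrite /f' patchE sub//; exact: fM.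
rewrite (@Rintegral_concentrated _ _ _ mu _ m0r mur f M)//.
by apply: eq_Rintegral => x /set_mem/sub xr; rewrite /f' patchE xr.
Qed.

Lemma op_integral_Qpoly F r n h :
  (forall h, quad_measure F h (~` `[0, r]%classic) = 0%E) ->
  '[op_integral F (@Qpoly R n) h, h] = (\int[quad_measure F h]_x Qpoly n x)%:C.
Proof.
move=> Fr; rewrite (op_integralP (M := Qpoly n r) Fr (measurable_Qpoly n)).
- congr (_%:C); apply: (@Rintegral_Rplus _ r _ (Qpoly n r) (Fr h) (measurable_Qpoly n)) => x.
  by rewrite /= in_itv/= => /andP[x0 xr]; rewrite ger0_norm ?Qpoly_ge0// le_Qpoly.
- by move=> x; rewrite /Rplus/= in_itv/= andbT; exact: Qpoly_ge0.
- by move=> x; rewrite /= in_itv/= => /andP[x0 xr]; exact: le_Qpoly.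
Qed.

Lemma innerMnl (x y : H) k : '[x *+ k, y] = '[x, y] * k%:R.
Proof.
elim: k => [|k IH]; rewrite ?mulr0n ?inner0l ?mulr0//.
by rewrite mulrSr innerDl IH -natr1 mulrDr mulr1.
Qed.

Lemma representation_quad B C F r n h : adjoint B = B -> op_ge0 C ->
  (forall h, quad_measure F h (~` `[0, r]%classic) = 0%E) ->
  '[(1 + B *+ n + C *+ (n ^ 2)%N + op_integral F (@Qpoly R n)) h, h] =
  (rnorm h ^+ 2 + complex.Re '[B h, h] * n%:R +
    complex.Re '[C h, h] * n%:R ^+ 2 + \int[quad_measure F h]_x Qpoly n x)%:C.
Proof.
move=> BB C0 Fr; move: (selfadjoint_quad h BB) (op_ge0E h C0).
set b := complex.Re '[B h, h]; set c := complex.Re '[C h, h] => bE cE.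
rewrite !bopD !bopMn !innerDl bop1E inner_rnorm (op_integral_Qpoly n h Fr).
rewrite !innerMnl bE cE -!(rmorph_nat (@real_complex R)) natrX.
by rewrite !(rmorphD, rmorphM, rmorphXn)/=.
Qed.

Lemma op_represents_quad T B C F : op_represents T B C F -> exists2 r, 1 <= r &
  (forall h, quad_measure F h (~` `[0, r]%classic) = 0%E) /\
  (forall h n, rnorm ((T ^+ n) h) ^+ 2 = rnorm h ^+ 2 + complex.Re '[B h, h] * n%:R +
    complex.Re '[C h, h] * n%:R ^+ 2 + \int[quad_measure F h]_x Qpoly n x).
Proof.
move=> [BB C0 cF F1 TE].
have [M [_ FM]] := compact_bounded cF.
(* [compact_bounded] bounds the support by any number strictly above M; the further increment gives
   the strict inequality of [op_supp_concentrated]. Moreover r >= 1, as the atom at 1 will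
   require. *)
pose s := `|M| + 1; have Ms : M < s by rewrite (le_lt_trans (ler_norm M))// ltrDl.
have Fs : op_supp F `<=` `]-oo, s]%classic.
  by move=> x xF; rewrite /= in_itv/= (le_trans (ler_norm x))// (FM s Ms x xF).
have s1 : s < s + 1 by rewrite ltrDl.
have Fr := op_supp_concentrated Fs s1.
exists (s + 1) => [|]; first by rewrite lerDr addr_ge0.
split=> // h n.
by apply: complexr_inj; rewrite -adjoint_exp_quad TE (representation_quad n h BB C0 Fr).
Qed.

Lemma quad_op_represents T B C F r : adjoint B = B -> op_ge0 C -> F [set 1] = 0 ->
  (forall h, quad_measure F h (~` `[0, r]%classic) = 0%E) ->
  (forall h n, rnorm ((T ^+ n) h) ^+ 2 = rnorm h ^+ 2 + complex.Re '[B h, h] * n%:R +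
    complex.Re '[C h, h] * n%:R ^+ 2 + \int[quad_measure F h]_x Qpoly n x) ->
  op_represents T B C F.
Proof.
move=> BB C0 F1 Fr TE; split => //.
  apply: subclosed_compact (op_supp_sub Fr); [exact: closed_op_supp|exact: segment_compact].
by move=> n; apply: bop_eq => h; rewrite adjoint_exp_quad TE (representation_quad n h BB C0 Fr).
Qed.

End representation.

Section existence.
Variables (R : realType) (H : hilbertType R).
Implicit Types (h : H) (T B C : 'B(H)) (F : semispectral H).

Lemma Rintegral_split_atom (mu nu : {finite_measure set R -> \bar R}) (a r M : R) (f : R -> R) :
  mu (~` `[0, r]%classic) = 0%E -> (forall A, measurable A -> nu A = mu (A `\ a)) ->
  measurable_fun setT f -> (forall x, `[0, r]%classic x -> `|f x| <= M) ->
  \int[mu]_x f x = f a * fine (mu [set a]) + \int[nu]_x f x.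
Proof.
move=> mur nuE mf fM.
have m0r : measurable `[0, r]%classic by exact: measurable_itv.
have ma : measurable [set a] by exact: measurable_set1.
(* The point [a] may lie outside [0, r], whence the carrier E with [a] adjoined and the bound by a
   maximum below. *)
pose E := `[0, r]%classic `\ a.
have mE : measurable E by exact: measurableD.
have mur' : mu (~` (E `|` [set a])) = 0%E.
  apply/eqP; rewrite eq_le measure_ge0 andbT -mur; apply: le_measure; rewrite ?inE.
  - by apply: measurableC; exact: measurableU.
  - exact: measurableC.
  apply: subsetC => x xr; have [->|xa] := pselect (x = a); first by right.
  by left; split.
have nuN : nu (~` E) = 0%E.
  rewrite nuE; last exact: measurableC.
  apply/eqP; rewrite eq_le measure_ge0 andbT -mur; apply: le_measure; rewrite ?inE.
  - by apply: measurableD => //; exact: measurableC.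
  - exact: measurableC.
  by move=> x [/= nE xa] xr; apply: nE; split.
have fM' x : (E `|` [set a]) x -> `|f x| <= Num.max M `|f a|.
  by move=> [[/fM fx _]|->]; rewrite le_max ?fx// lexx orbT.
have fME x : E x -> `|f x| <= M by move=> [/fM].
have mEa := measurableU _ _ mE ma.
rewrite (Rintegral_concentrated mEa mur' mf fM') Rintegral_setU//; last 2 first.
- by apply: integrableS (bounded_on_integrable mEa mur' mf fM').
- by apply/disj_set2P/seteqP; split => // x [[_ xa] /xa].
rewrite addrC (Rintegral_concentrated mE nuN mf fME); congr (_ + _).
  rewrite -Rintegral_cst//; apply: eq_Rintegral => x /set_mem ->//.
congr fine; apply: eq_measure_integral => A mA AE.
apply: etrans (esym (nuE A mA)).
by congr (mu _); apply/seteqP; split => [x Ax|x []//]; split => // xa; case: (AE x Ax).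
Qed.

Variable T : 'B(H).
Hypothesis Tcpd : cpd_op T.

Let g h n := rnorm ((T ^+ n) h) ^+ 2.
Let L n := adjoint T ^+ n * T ^+ n.
Let D n := L n.+2 - L n.+1 *+ 2 + L n.

Let DE n h : '[D n h, h] = (diff2 (g h) n)%:C.
Proof.
rewrite /D !bopD bopN bopMn !innerDl innerNl innerMnl !adjoint_exp_quad /diff2.
by rewrite -[RHS]/(real_complex R _) !(rmorphD, rmorphB, rmorphN, rmorphMn)/= mulr_natr.
Qed.

Let moments : exists2 r : R, 0 < r & forall h, exists mu : {finite_measure set R -> \bar R},
  mu (~` `[0, r]%classic) = 0%E /\ forall n, \int[mu]_x x ^+ n = diff2 (g h) n.
Proof.
have [K' K'0 TK'] := bop_rbound T; pose K := K' + 1.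
have K0 : 0 < K by rewrite ltr_wpDl.
have TK : opb T K by move=> x; rewrite (le_trans (TK' x))// ler_wpM2r ?rnorm_ge0// lerDl.
exists (K ^+ 2) => [|h]; first exact: exprn_gt0.
have gb n : 0 <= g h n <= rnorm h ^+ 2 * (K ^+ 2) ^+ n.
  rewrite sqr_ge0/= -exprM mulnC exprM -exprMn mulrC lerXn2r// ?nnegrE ?rnorm_ge0//.
    by rewrite mulr_ge0 ?rnorm_ge0 ?exprn_ge0 ?(ltW K0).
  exact: (opbX n (ltW K0) TK).
(* The constant comes from K^4 + 2 K^2 + 1 = (K^2 + 1)^2, a bound for the three terms of the second
   difference after dividing by |h|^2 K^(2 n). *)
apply: (@stieltjes_moment _ _ (rnorm h ^+ 2 * (K ^+ 2 + 1) ^+ 2)); first exact: exprn_gt0.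
- exact: (cpd_pos_def (Tcpd h)).
- have -> : (fun n => diff2 (g h) n.+1) = diff2 (g (T h)).
    by apply/funext => n; rewrite /diff2 /g -!bop_expSr.
  exact: (cpd_pos_def (Tcpd (T h))).
- move=> n; have := gb n.+2; have := gb n.+1; have := gb n.
  rewrite /diff2 !exprS; move: (g h n) (g h n.+1) (g h n.+2) (K ^+ 2 ^+ n) (sqr_ge0 K).
  move: (rnorm h ^+ 2) => z; move: (K ^+ 2) => k; clear => u0 u1 u2 kn k0.
  move=> /andP[u00 u01] /andP[u10 u11] /andP[u20 u21].
  rewrite ler_norml; apply/andP; split; nra.
Qed.

Lemma cpd_op_represents : exists B C F, op_represents T B C F.
Proof.
have [r r0 /choice[mu muP]] := moments.
have mur h : mu h (~` `[0, r]%classic) = 0%E by have [] := muP h.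
have muD h n : \int[mu h]_x x ^+ n = diff2 (g h) n by have [] := muP h.
have DE' n h : '[D n h, h] = (\int[mu h]_x x ^+ n)%:C by rewrite DE muD.
have [F FE] := semispectral_of_measures mur DE' 1.
have [M ME] := operator_measure_exists mur DE' (measurable_set1 1).
have Fr h : quad_measure F h (~` `[0, r]%classic) = 0%E.
  have m0r : measurable (~` `[0, r]%classic) by apply: measurableC; exact: measurable_itv.
  rewrite FE//; apply/eqP; rewrite eq_le measure_ge0 andbT -(mur h).
  by apply: le_measure; rewrite ?inE//; apply: measurableD => //; exact: measurable_set1.
pose C := (2^-1)%:C *: M; pose c h := 2^-1 * fine (mu h [set 1]).
have CE h : '[C h, h] = (c h)%:C by rewrite bopZ innerZl ME -rmorphM.
pose B := L 1%N - 1 - C; pose b h := g h 1%N - rnorm h ^+ 2 - c h.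
have BE h : '[B h, h] = (b h)%:C.
  rewrite !bopB !innerDl !innerNl CE bop1E inner_rnorm adjoint_exp_quad.
  by rewrite -[RHS]/(real_complex R _) !(rmorphD, rmorphN).
have c0 h : 0 <= c h by rewrite mulr_ge0// fine_ge0.
exists B, C, F; apply: (@quad_op_represents _ _ _ _ _ _ r) => //.
- exact: quad_selfadjoint BE.
- exact: quad_ge0 CE c0.
- rewrite (_ : [set 1] = [set 1] `&` @Rplus R); last first.
    by apply/seteqP; split => [x ->|x []//]; split => //; rewrite /Rplus/= in_itv/= ler01.
  apply: sm_null => [|h]; first exact: measurable_set1.
  by rewrite FE; [rewrite setDv|exact: measurable_set1].
- move=> h; rewrite CE BE/=.
  have g0 : g h 0%N = rnorm h ^+ 2 by rewrite /g expr0.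
  have [_ TE n] := represents_diff2 (g h) (b h) (c h) (concentrated_sym (Fr h)).
  rewrite -g0; apply: TE; split; first by rewrite g0 /b -addrA subrK addrC subrK.
  move=> {}n; rewrite -muD (@Rintegral_split_atom _ (quad_measure F h) 1 r (r ^+ n))//.
  + by rewrite expr1n mul1r /c; congr (_ + _); field.
  + exact: FE.
  + move=> x; rewrite /= in_itv/= => /andP[x0 xr].
    by rewrite ger0_norm ?exprn_ge0// lerXn2r// nnegrE// ltW.
Qed.

End existence.

(** * Spectral radius and growth of powers *)

Section spectral_radius.
Variables (R : realType) (H : hilbertType R) (T : 'B(H)).

(** This makes [spectral_radius] a genuine supremum when the spectrum is nonempty: for |z| > K the
    Neumann series of T / z converges. *)
Lemma spectrum_bounded : has_ubound [set complex.Re `|z| | z in spectrum T].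
Proof.
have [K K0 TK] := bop_rbound T; exists K => _ [z zT <-]; rewrite -/(cmod z) leNgt.
apply/negP => Kz; have z0 : 0 < cmod z by exact: le_lt_trans Kz.
have zn0 : z != 0 by apply: contraTneq z0 => ->; rewrite cmod0 ltxx.
apply: ((inv1_spectrum T zn0).2 _) zT.
apply: (@neumann _ _ _ 1 (K / cmod z)).
  by rewrite divr_ge0 ?cmod_ge0// ltr_pdivrMr ?mul1r.
move=> n h; rewrite bop_expZ rnormZ cmodX cmodV mul1r mulrC expr_div_n mulrAC exprVn.
rewrite ler_wpM2r ?invr_ge0 ?exprn_ge0 ?cmod_ge0//.
exact: (opbX n K0 TK).
Qed.

Lemma le_spectral_radius z : spectrum T z -> cmod z <= spectral_radius T.
Proof. by move=> zT; apply: ub_le_sup; [exact: spectrum_bounded|exists z]. Qed.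

Lemma spectral_radius_ge0 : 0 <= spectral_radius T.
Proof.
have [E|/set0P[z zT]] := eqVneq (spectrum T) set0.
  by rewrite /spectral_radius E image_set0 sup0.
exact: le_trans (cmod_ge0 z) (le_spectral_radius zT).
Qed.

Lemma spectral_radius_le (s : R) : 0 <= s ->
  (forall z, s < cmod z -> ~ spectrum T z) -> spectral_radius T <= s.
Proof.
move=> s0 sT; have [E|/set0P[z zT]] := eqVneq (spectrum T) set0.
  by rewrite /spectral_radius E image_set0 sup0.
apply: ge_sup; first by exists (complex.Re `|z|), z.
by move=> _ [w wT <-]; rewrite -/(cmod w) leNgt; apply/negP => /sT.
Qed.

Lemma spectral_pow2_bounded (r : R) : spectral_radius T < r ->
  exists N, forall m, (N <= m)%N -> opb (T ^+ (2 ^ m)%N) (r ^+ (2 ^ m)%N).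
Proof.
move=> Tr; have r0 : 0 < r := le_lt_trans spectral_radius_ge0 Tr.
have [||N] := @pow2_bounded_of_resolvent _ _ T r^-1.
- by rewrite invr_gt0.
- move=> w wr; have [->|w0] := eqVneq w 0.
    by exists 1; split => x; rewrite scale0r !bop1E subr0.
  rewrite -(invrK w); apply/inv1_spectrum; first by rewrite invr_eq0.
  move=> /le_spectral_radius; rewrite cmodV leNgt => /negP; apply.
  apply: lt_le_trans Tr _; rewrite -[leLHS]invrK lef_pV2 ?posrE ?invr_gt0//.
  rewrite lt_neqAle cmod_ge0 andbT eq_sym; apply: contraNneq w0 => /cmod_eq0 ->//.
by rewrite invrK; exists N.
Qed.

Local Notation g := (fun h n => rnorm ((T ^+ n) h) ^+ 2).

(** Only |T^n h| with n = 2^m is controlled by r. The term of index n + 2 costs a factor K^4, and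
    the one of index n + 1 enters negatively and is dropped, so the bound is one-sided. *)
Lemma diff2_pow2_bounded (r : R) : spectral_radius T < r ->
  exists M N, forall h m, (N <= m)%N ->
    diff2 (g h) (2 ^ m)%N <= M * rnorm h ^+ 2 * (r ^+ 2) ^+ (2 ^ m)%N.
Proof.
move=> Tr; have [N TN] := spectral_pow2_bounded Tr.
have r0 : 0 < r := le_lt_trans spectral_radius_ge0 Tr.
have [K K0 TK] := bop_rbound T.
exists (K ^+ 2 ^+ 2 + 1), N => h m Nm; set n := (2 ^ m)%N.
have gn : rnorm ((T ^+ n) h) ^+ 2 <= rnorm h ^+ 2 * (r ^+ 2) ^+ n.
  rewrite -exprM mulnC exprM -exprMn mulrC lerXn2r// ?nnegrE ?rnorm_ge0//.
    by rewrite mulr_ge0 ?rnorm_ge0 ?exprn_ge0 ?(ltW r0).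
  exact: TN.
have gn2 : rnorm ((T ^+ n.+2) h) ^+ 2 <= K ^+ 2 ^+ 2 * rnorm ((T ^+ n) h) ^+ 2.
  rewrite -exprMn lerXn2r// ?nnegrE ?rnorm_ge0//.
    by rewrite mulr_ge0 ?rnorm_ge0 ?exprn_ge0.
  rewrite !bop_expS (le_trans (TK _))// expr2 -mulrA ler_wpM2l//.
have gn1 : 0 <= rnorm ((T ^+ n.+1) h) ^+ 2 by exact: sqr_ge0.
have K4 : 0 <= K ^+ 2 ^+ 2 by rewrite exprn_ge0// exprn_ge0.
rewrite /diff2; move: gn gn2 gn1 K4.
move: (rnorm _ ^+ 2) (rnorm _ ^+ 2) (rnorm _ ^+ 2) (rnorm _ ^+ 2) (K ^+ 2 ^+ 2) (r ^+ 2 ^+ n).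
by clear => a b c d e f; nra.
Qed.

Lemma pow2_decay (u M q : R) (N : nat) : 0 <= q < 1 ->
  (forall m, (N <= m)%N -> u <= M * q ^+ (2 ^ m)%N) -> u <= 0.
Proof.
move=> q01 uM; apply: (@le0_of_cvg _ u (fun m => `|M| * q ^+ m)).
  move=> m; rewrite (le_trans (uM (N + m)%N _)) ?leq_addr//.
  move/andP: q01 => [q0 q1].
  rewrite (le_trans (ler_wpM2r _ (ler_norm M))) ?exprn_ge0// ler_wpM2l//.
  by rewrite ler_wiXn2l ?(ltW q1)// (leq_trans (leq_addl N m))// ltnW// ltn_expl.
by rewrite -(mulr0 `|M|); apply: cvgMl_tmp; exact: cvg_expr0.
Qed.

End spectral_radius.

Section measure_support.
Variable R : realType.

Lemma concentratedW (mu : {measure set R -> \bar R}) (A B : set R) : measurable A -> measurable B ->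
  A `<=` B -> mu (~` A) = 0%E -> mu (~` B) = 0%E.
Proof.
move=> mA mB AB muA; apply/eqP; rewrite eq_le measure_ge0 andbT -muA.
by apply: le_measure; rewrite ?inE; [exact: measurableC|exact: measurableC|exact: subsetC].
Qed.

Lemma le_itv_sym (r s : R) : r <= s -> `[- r, r]%classic `<=` `[- s, s]%classic.
Proof.
move=> rs x /=; rewrite !in_itv/= => /andP[rx xr].
by rewrite (le_trans xr rs) andbT (le_trans _ rx)// lerN2.
Qed.

Lemma compact_supp_concentrated (mu : {measure set R -> \bar R}) :
  compact (measure_supp mu) -> exists r, mu (~` `[- r, r]%classic) = 0%E.
Proof.
move=> cmu; have [M [_ muM]] := compact_bounded cmu.
pose s := `|M| + 1; have Ms : M < s by rewrite (le_lt_trans (ler_norm M))// ltrDl.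
have ss : s < s + 1 by rewrite ltrDl.
have far x : s < `|x| -> exists U, [/\ open U, U x & mu U = 0%E].
  move=> sx; have : ~ measure_supp mu x by move=> /(muM s Ms)/=; rewrite leNgt sx.
  move=> /existsNP[U /not_implyP[oU /not_implyP[Ux U0]]].
  by exists U; split => //; apply: contrapT; exact: U0.
exists (s + 1); apply/negligibleP; first by apply: measurableC; exact: measurable_itv.
apply: (@negligibleS _ _ _ _ (\bigcup_k (`[- (k%:R : R), - (s + 1)]%classic `|`
    `[s + 1, (k%:R : R)]%classic))).
  move=> x /=; rewrite in_itv/= => /negP; rewrite negb_and -!ltNge => xs.
  have := archi_boundP (normr_ge0 x); rewrite ltr_norml => /andP[kx xk].
  exists (Num.bound `|x|) => //=; rewrite !in_itv/=.
  by case/orP: xs => h; [left|right]; rewrite (ltW h) ?(ltW kx) ?(ltW xk).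
apply: negligible_bigcup => k; apply: negligibleU.
  apply: compact_null; [exact: segment_compact|move=> x /=; rewrite in_itv/= => /andP[_ xs]].
  by apply: far; rewrite ltr_normr; apply/orP; right; rewrite ltrNr (le_lt_trans xs)// ltrN2.
apply: compact_null; [exact: segment_compact|move=> x /=; rewrite in_itv/= => /andP[xs _]].
by apply: far; rewrite ltr_normr (lt_le_trans ss xs).
Qed.

End measure_support.

Section consequences.
Variables (R : realType) (H : hilbertType R) (T : 'B(H)).
Implicit Types (h : H) (B C : 'B(H)) (F : semispectral H).
Local Notation g := (fun h n => rnorm ((T ^+ n) h) ^+ 2).

Lemma op_represents_diff2 B C F : op_represents T B C F -> exists2 r, 1 <= r & forall h,
  [/\ quad_measure F h (~` `[0, r]%classic) = 0%E,
    g h 1%N = g h 0%N + complex.Re '[B h, h] + complex.Re '[C h, h] &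
    forall n, diff2 (g h) n = complex.Re '[C h, h] *+ 2 + \int[quad_measure F h]_x x ^+ n].
Proof.
move=> /op_represents_quad[r r1 [Fr TE]]; exists r => // h.
have [TE' _] := represents_diff2 (g h) (complex.Re '[B h, h]) (complex.Re '[C h, h])
  (concentrated_sym (Fr h)).
by have [|g1 gd] := TE'; [move=> n; rewrite TE expr0|split].
Qed.

Lemma op_represents_cpd B C F : op_represents T B C F -> cpd_op T.
Proof.
move=> rep; have [_ C0 _ _ _] := rep.
have [r r1 TE] := op_represents_diff2 rep => h; have [Fr _ gd] := TE h.
exact: (represents_cpd (concentrated_sym Fr) (op_ge0_Re h C0) gd).
Qed.

Lemma quad_measure_atom B C F h : op_represents T B C F -> quad_measure F h [set 1] = 0%E.
Proof.
move=> [_ _ _ F1 _]; apply: sm_null_quad; first exact: measurable_set1.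
rewrite (_ : _ `&` _ = [set 1])//.
by apply/seteqP; split => [x []//|x ->]; split => //; rewrite /Rplus/= in_itv/= ler01.
Qed.

Lemma op_represents_unique B C F B' C' F' : op_represents T B C F -> op_represents T B' C' F' ->
  [/\ B' = B, C' = C & forall D : set R, measurable D -> D `<=` @Rplus R -> F' D = F D].
Proof.
move=> rep rep'; have [BB C0 _ _ _] := rep; have [BB' C0' _ _ _] := rep'.
have [r r1 TE] := op_represents_diff2 rep; have [r' r1' TE'] := op_represents_diff2 rep'.
have key h : complex.Re '[B h, h] = complex.Re '[B' h, h] /\
    complex.Re '[C h, h] = complex.Re '[C' h, h] /\
    forall A, measurable A -> quad_measure F h A = quad_measure F' h A.
  have [Fr g1 gd] := TE h; have [Fr' g1' gd'] := TE' h.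
  pose s := Num.max r r'.
  have conc G u : u <= s -> quad_measure G h (~` `[0, u]%classic) = 0%E ->
      quad_measure G h (~` `[- s, s]%classic) = 0%E.
    move=> us /concentrated_sym.
    apply: concentratedW; [exact: measurable_itv|exact: measurable_itv|].
    exact: le_itv_sym.
  have s1 : 1 <= s by rewrite le_max r1.
  have rs : r <= s by rewrite le_max lexx.
  have rs' : r' <= s by rewrite le_max lexx orbT.
  have [cc FF] := represents_diff2_unique s1 (conc F r rs Fr) (conc F' r' rs' Fr')
    (quad_measure_atom h rep) (quad_measure_atom h rep') (op_ge0_Re h C0) (op_ge0_Re h C0') gd gd'.
  split; last by split.
  by move: g1; rewrite g1' cc => /addIr/addrI.
split.
- by apply: bop_eq => h; rewrite (selfadjoint_quad h BB) (selfadjoint_quad h BB') (key h).1.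
- by apply: bop_eq => h; rewrite (op_ge0E h C0) (op_ge0E h C0') (key h).2.1.
- move=> D mD Dp; have -> : D = D `&` @Rplus R by rewrite setIidl.
  by apply: bop_eq => h; rewrite !quad_measureE// (key h).2.2.
Qed.

Lemma limn_esup_bounded (u : nat -> \bar R) (M : \bar R) : (forall n, (u n <= M)%E) ->
  (limn_esup u <= M)%E.
Proof.
move=> uM; apply: (@le_trans _ _ (ereal_sup (u @` setT))).
  by apply: ereal_inf_lbound; exists setT => //; exact: filterT.
by apply: ge_ereal_sup => _ [n _ <-].
Qed.

Lemma quad_growth h : (limn_esup (fun n => (`|g h n| `^ n%:R^-1)%:E) < +oo)%E.
Proof.
have [K K0 TK] := bop_rbound T.
pose z := Num.max 1 (rnorm h ^+ 2); have z1 : 1 <= z by rewrite le_max lexx.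
have z0 : 0 <= z := le_trans ler01 z1.
apply: (@le_lt_trans _ _ (Num.max 1 (z * K ^+ 2))%:E); last exact: ltry.
apply: limn_esup_bounded => n; rewrite lee_fin le_max.
(* At n = 0 the exponent is 0^-1 = 0 and the term is 1; this is the reason for the maximum with 1.
   For n > 0, z >= 1 gives z^(1/n) <= z. *)
case: n => [|n]; first by rewrite invr0 powRr0 lexx.
apply/orP; right; rewrite ger0_norm ?sqr_ge0//.
apply: (@le_trans _ _ ((z * (K ^+ 2) ^+ n.+1) `^ n.+1%:R^-1)).
  apply: ge0_ler_powR; rewrite ?nnegrE ?invr_ge0 ?sqr_ge0 ?mulr_ge0 ?exprn_ge0//.
  apply: (@le_trans _ _ (rnorm h ^+ 2 * (K ^+ 2) ^+ n.+1)); last first.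
    by rewrite ler_wpM2r ?exprn_ge0 ?le_max ?lexx ?orbT//.
  rewrite -exprM mulnC exprM -exprMn mulrC lerXn2r// ?nnegrE ?rnorm_ge0//.
    by rewrite mulr_ge0 ?rnorm_ge0 ?exprn_ge0.
  exact: opbX.
rewrite powRM ?exprn_ge0// ler_pM ?powR_ge0//.
  by rewrite -[leRHS]powRr1// ler_powR// invf_le1// ler1n.
by rewrite -powR_mulrn ?exprn_ge0// -powRrM mulfV// powRr1 ?exprn_ge0.
Qed.

(** A competing measure lives on R and may charge the negative half-line. This is why determinacy is
    set up on the symmetric intervals [- t, t]. *)
Lemma op_represents_triplet B C F h : op_represents T B C F ->
  representing_triplet (g h) (complex.Re '[B h, h]) (complex.Re '[C h, h]) (quad_measure F h).
Proof.
move=> rep; have [BB C0 cF F1 _] := rep.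
have [r r1 TE] := op_represents_diff2 rep; have [Fr g1 gd] := TE h.
have [r' r1' [_ gE]] := op_represents_quad rep.
split; [exact: (op_represents_cpd rep)|exact: quad_growth| |].
  split; [exact: op_ge0_Re|exact: compact_measure_supp|exact: (quad_measure_atom h rep)|].
  by move=> n; rewrite gE expr0.
move=> b c nu [c0 cnu nu1 gE'].
have [s nus] := compact_supp_concentrated cnu.
pose t := Num.max r s.
have nut : nu (~` `[- t, t]%classic) = 0%E.
  move: nus; apply: concentratedW; [exact: measurable_itv|exact: measurable_itv|].
  by apply: le_itv_sym; rewrite le_max lexx orbT.
have Ft : quad_measure F h (~` `[- t, t]%classic) = 0%E.
  move: (concentrated_sym Fr); apply: concentratedW; [exact: measurable_itv|exact: measurable_itv|].
  by apply: le_itv_sym; rewrite le_max lexx.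
have [/(_ gE')[g1' gd'] _] := represents_diff2 (g h) b c nut.
have t1 : 1 <= t by rewrite le_max r1.
have [cc nuF] := represents_diff2_unique t1 nut Ft nu1 (quad_measure_atom h rep) c0
  (op_ge0_Re h C0) gd' gd.
split => //; move: g1; rewrite g1' cc => /addIr/addrI//.
Qed.

(** Markov's inequality for x^n. *)
Lemma tail_moment_le (nu : {finite_measure set R -> \bar R}) (r t : R) n : 0 <= t ->
  nu (~` `[0, r]%classic) = 0%E -> t ^+ n * fine (nu `]t, +oo[%classic) <= \int[nu]_x x ^+ n.
Proof.
move=> t0 nur; have m0r : measurable `[0, r]%classic by exact: measurable_itv.
have mt : measurable `]t, +oo[%classic by exact: measurable_itv.
have mX : measurable_fun setT (fun x : R => x ^+ n) by exact: exprn_measurable.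
have bX x : `[0, r]%classic x -> `|x ^+ n| <= r ^+ n.
  rewrite /= in_itv/= => /andP[x0 xr].
  by rewrite ger0_norm ?exprn_ge0// lerXn2r// nnegrE// (le_trans x0).
have iX := bounded_on_integrable m0r nur mX bX.
rewrite (Rintegral_concentrated m0r nur mX bX).
rewrite -(measure_concentrated m0r nur mt).
have mE : measurable (`]t, +oo[%classic `&` `[0, r]%classic) by exact: measurableI.
set E := _ `&` _ in mE *.
have iS A : measurable A -> nu.-integrable A (EFin \o (fun x : R => x ^+ n)).
  by move=> mA; exact: integrableS iX.
have mD : measurable (`[0, r]%classic `\` `]t, +oo[%classic) by exact: measurableD.
have -> : \int[nu]_(x in `[0, r]) x ^+ n =
    \int[nu]_(x in E) x ^+ n + \int[nu]_(x in `[0, r] `\` `]t, +oo[) x ^+ n.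
  rewrite -Rintegral_setU//.
  - by rewrite /E setIC setUIDK.
  - by apply: iS; exact: measurableU.
  - by apply/disj_set2P/seteqP; split => // x [[tx _] [_ /(_ tx)]].
rewrite -[leLHS]addr0; apply: lerD.
  rewrite -Rintegral_cst//; apply: le_Rintegral => //.
  - by apply: (integrableS measurableT) => //; exact: finite_measure_integrable_cst.
  - exact: iS.
  - move=> x [/=]; rewrite in_itv/= andbT => tx _.
    by rewrite lerXn2r// ?nnegrE// ?(ltW tx)// (le_trans t0 (ltW tx)).
apply: Rintegral_ge0 => x [/=]; rewrite in_itv/= => /andP[x0 _] _; exact: exprn_ge0.
Qed.

Lemma moment_ge0 (nu : {finite_measure set R -> \bar R}) (r : R) n :
  nu (~` `[0, r]%classic) = 0%E -> 0 <= \int[nu]_x x ^+ n.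
Proof.
move=> nur; have := tail_moment_le n (lexx 0) nur.
by apply: le_trans; rewrite mulr_ge0 ?exprn_ge0 ?fine_ge0.
Qed.

Lemma op_supp_le_spectral B C F : op_represents T B C F ->
  op_supp F `<=` `[0, spectral_radius T ^+ 2].
Proof.
move=> rep; have [_ C0 _ _ _] := rep; have [r r1 TE] := op_represents_diff2 rep.
move=> x xF; have [x0 xS] := (op_suppP _ _).1 xF.
move: x0; rewrite /Rplus/= !in_itv/= andbT => x0; rewrite x0/= leNgt; apply/negP => Tx.
pose s := Num.sqrt x; have T0 := spectral_radius_ge0 T.
have Ts : spectral_radius T < s.
  by rewrite -(ltr_pXn2r (_ : 0 < 2)%N) ?nnegrE ?sqrtr_ge0// sqr_sqrtr.
(* Two intermediate values: rho > r(T) controls a_n(h) at n = 2^m, and sig > rho defines the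
   neighbourhood ]sig^2, +oo[ of x. Its mass is O((rho / sig)^(2 n)), hence 0. *)
pose rho := (spectral_radius T + s) / 2; pose sig := (rho + s) / 2.
have Trho : spectral_radius T < rho by rewrite /rho; move: Ts; clear; lra.
have rs : rho < sig by rewrite /sig /rho; move: Ts; clear; lra.
have ss : sig < s by rewrite /sig /rho; move: Ts; clear; lra.
clearbody sig rho.
have rho0 : 0 <= rho by apply: le_trans T0 (ltW Trho).
have sig0 : 0 < sig by exact: le_lt_trans rho0 rs.
have sx : sig ^+ 2 < x.
  by rewrite -(sqr_sqrtr x0) ltr_pXn2r ?nnegrE ?sqrtr_ge0// ltW.
have [h] := xS _ (@open_gt R (sig ^+ 2)) sx; apply.
have [Fr _ gd] := TE h.
have mt : measurable `]sig ^+ 2, +oo[%classic by exact: measurable_itv.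
have [M [N hM]] := diff2_pow2_bounded Trho.
have -> : [set y | sig ^+ 2 < y] = `]sig ^+ 2, +oo[%classic.
  by apply/seteqP; split => y /=; rewrite in_itv/= andbT.
rewrite -[quad_measure _ _ _]fineK ?fin_num_measure//; congr EFin.
apply/eqP; rewrite eq_le fine_ge0// andbT.
apply: (@pow2_decay _ _ (M * rnorm h ^+ 2) (rho ^+ 2 / sig ^+ 2) N).
  rewrite divr_ge0 ?sqr_ge0//= ltr_pdivrMr ?exprn_gt0// mul1r.
  by rewrite ltr_pXn2r ?nnegrE// ltW.
move=> m Nm; rewrite expr_div_n [leRHS]mulrA ler_pdivlMr ?exprn_gt0// mulrC.
apply: le_trans (hM h m Nm); rewrite gd.
apply: le_trans (tail_moment_le _ (sqr_ge0 sig) Fr) _.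
by rewrite lerDr mulrn_wge0// op_ge0_Re.
Qed.

Lemma spectral_radius_ge1 B C F : op_represents T B C F -> C <> 0 -> 1 <= spectral_radius T.
Proof.
move=> rep; have [_ C0 _ _ _] := rep; have [r r1 TE] := op_represents_diff2 rep.
move=> CN; rewrite leNgt; apply/negP => T1; apply: CN.
have T0 := spectral_radius_ge0 T; pose rho := (spectral_radius T + 1) / 2.
have Trho : spectral_radius T < rho by rewrite /rho; move: T1; clear; lra.
have rho0 : 0 <= rho by apply: le_trans T0 (ltW Trho).
have rho1 : rho < 1 by rewrite /rho; move: T1; clear; lra.
have [M [N hM]] := diff2_pow2_bounded Trho.
apply: bop_eq => h; rewrite inner0l op_ge0E//; congr (_%:C).
apply/eqP; rewrite eq_le op_ge0_Re// andbT.
apply: (@pow2_decay _ _ (M * rnorm h ^+ 2) (rho ^+ 2) N).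
  by rewrite sqr_ge0/= expr_lt1.
move=> m Nm; apply: le_trans (hM h m Nm); have [Fr _ gd] := TE h; rewrite gd mulr2n -addrA lerDl.
by rewrite addr_ge0 ?op_ge0_Re// (moment_ge0 _ Fr).
Qed.

End consequences.

Section support_bound.
Variables (R : realType) (H : hilbertType R) (T : 'B(H)).
Implicit Types (h : H) (B C : 'B(H)) (F : semispectral H).
Local Notation g := (fun h n => rnorm ((T ^+ n) h) ^+ 2).

Lemma Qpoly_le n (s : R) : 1 <= s -> Qpoly n s <= n%:R ^+ 2 * s ^+ n.
Proof.
move=> s1; have s0 : 0 <= s by exact: le_trans s1.
apply: (@le_trans _ _ (\sum_(0 <= j < n.-1) n%:R * s ^+ n)).
  rewrite /Qpoly !big_nat; apply: ler_sum => j /andP[_ jn].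
  rewrite ler_pM ?exprn_ge0//.
    by rewrite ler_nat -subnDA leq_subr.
  by rewrite ler_weXn2l// ltnW// (leq_trans jn)// leq_pred.
rewrite sumr_const_nat subn0 -[leLHS]mulr_natr expr2 -!mulrA ler_wpM2l//.
by rewrite mulrC ler_wpM2r ?exprn_ge0// ler_nat leq_pred.
Qed.

(** Since s >= 1, each of 1, n, n^2 and Q_n(s) is at most (n + 1)^2 s^n; the shift to n + 1 covers n
    = 0. The constant L does not depend on h, as the Neumann series requires. *)
Lemma op_represents_growth B C F (s : R) : op_represents T B C F -> 1 <= s ->
  (forall h, quad_measure F h (~` `[0, s]%classic) = 0%E) ->
  exists2 L, 0 <= L & forall h n, g h n <= L * (n.+1%:R ^+ 2 * s ^+ n) * rnorm h ^+ 2.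
Proof.
move=> rep s1 Fs; have [BB C0 _ _ _] := rep; have [r r1 [_ TE]] := op_represents_quad rep.
have [b b0 Bb] := quad_real_bound (fun h => selfadjoint_quad h BB).
have [c c0 Cc] := quad_real_bound (fun h => op_ge0E h C0).
have [f f0 Ff] := quad_real_bound (fun h => quad_measureE F h measurableT).
exists (1 + b + c + f) => [|h n]; first by rewrite !addr_ge0.
have m0s : measurable `[0, s]%classic by exact: measurable_itv.
have I : \int[quad_measure F h]_x Qpoly n x <= n%:R ^+ 2 * s ^+ n * (f * rnorm h ^+ 2).
  rewrite (le_trans (ler_norm _))//.
  rewrite (le_trans (Rintegral_bound m0s (Fs h) (@measurable_Qpoly R n) (M := Qpoly n s) _))//.
    by move=> x /=; rewrite in_itv/= => /andP[x0 xs]; rewrite ger0_norm ?Qpoly_ge0// le_Qpoly.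
  rewrite ler_pM ?Qpoly_ge0 ?fine_ge0 ?(le_trans ler01 s1) ?Qpoly_le//.
  exact: le_trans (ler_norm _) (Ff h).
have Bh := le_trans (ler_norm _) (Bb h); have Ch := le_trans (ler_norm _) (Cc h).
rewrite TE; have sn : 1 <= s ^+ n by exact: exprn_ege1.
have n0 : 0 <= n%:R :> R by [].
have h0 := sqr_ge0 (rnorm h).
rewrite -natr1; move: I Bh Ch sn n0 h0.
move: (\int[_]_x _) (complex.Re _) (complex.Re _) (rnorm h ^+ 2) (s ^+ n) (n%:R : R) b0 c0 f0.
clear => I B C z t n b0 c0 f0 Iz Bz Cz t1 n0 z0.
have bz : 0 <= b * z by exact: mulr_ge0.
have cz : 0 <= c * z by exact: mulr_ge0.
have fz : 0 <= f * z by exact: mulr_ge0.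
have w1 : n ^+ 2 * t <= (n + 1) ^+ 2 * t by nra.
have w2 : n <= (n + 1) ^+ 2 * t by nra.
have w3 : 1 <= (n + 1) ^+ 2 * t by nra.
have w4 : n ^+ 2 <= (n + 1) ^+ 2 * t by nra.
move: w1 w2 w3 w4; move: ((n + 1) ^+ 2 * t) => w w1 w2 w3 w4.
have -> : (1 + b + c + f) * w * z = w * z + (b * z) * w + (c * z) * w + w * (f * z) by ring.
apply: lerD; [apply: lerD; [apply: lerD|]|].
- by rewrite ler_peMl.
- by rewrite (le_trans (ler_wpM2r n0 Bz))// ler_wpM2l.
- by rewrite (le_trans (ler_wpM2r (sqr_ge0 n) Cz))// ler_wpM2l.
- by rewrite (le_trans Iz)// ler_wpM2r.
Qed.

(** Each of the n + 1 terms q^i with i <= n is at least q^n, and their sum is at most 1 / (1 -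
    q). *)
Lemma natmul_expr_le (q : R) n : 0 <= q < 1 -> n.+1%:R * q ^+ n <= (1 - q)^-1.
Proof.
move=> /andP[q0 q1]; have q1' : 0 < 1 - q by rewrite subr_gt0.
rewrite -[leRHS]mul1r ler_pdivlMr// mulr_natl.
apply: (@le_trans _ _ ((\sum_(i < n.+1) q ^+ i) * (1 - q))).
  rewrite ler_wpM2r ?(ltW q1')// -[n.+1 in leLHS]card_ord -sumr_const.
  by apply: ler_sum => i _; rewrite ler_wiXn2l ?(ltW q1)// -ltnS ltn_ord.
by rewrite mulrC -opprB mulNr -subrX1 opprB lerBlDr lerDl exprn_ge0.
Qed.

Lemma spectral_radius_le_supp B C F (s : R) : op_represents T B C F -> 1 <= s ->
  op_supp F `<=` `]-oo, s]%classic -> spectral_radius T ^+ 2 <= s.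
Proof.
move=> rep s1 Fs; have s0 : 0 <= s by exact: le_trans s1.
suff Ts : spectral_radius T <= Num.sqrt s.
  by rewrite -(sqr_sqrtr s0) lerXn2r// nnegrE ?sqrtr_ge0// spectral_radius_ge0.
apply: spectral_radius_le => [|z sz]; first exact: sqrtr_ge0.
have z0 : 0 < cmod z by exact: le_lt_trans (sqrtr_ge0 s) sz.
have zn0 : z != 0 by apply: contraTneq z0 => ->; rewrite cmod0 ltxx.
have sz2 : s < cmod z ^+ 2.
  by rewrite -(sqr_sqrtr s0) ltr_pXn2r ?nnegrE ?sqrtr_ge0 ?cmod_ge0.
(* A support below s yields a measure carried by [0, t] only for t > s, so room is made between s
   and |z|^2. *)
pose t := (s + cmod z ^+ 2) / 2.
have st : s < t by rewrite /t; move: sz2; move: (cmod z ^+ 2); clear; move=> *; lra.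
have tz : t < cmod z ^+ 2 by rewrite /t; move: sz2; move: (cmod z ^+ 2); clear; move=> *; lra.
clearbody t; have t1 : 1 <= t by rewrite (le_trans s1)// ltW.
have t0 : 0 <= t by exact: le_trans t1.
have [L L0 gL] := op_represents_growth rep t1 (op_supp_concentrated Fs st).
pose w := t / cmod z ^+ 2; have w0 : 0 <= w by rewrite divr_ge0 ?sqr_ge0.
have w1 : w < 1 by rewrite ltr_pdivrMr ?exprn_gt0// mul1r.
(* A fourth root, because |(T / z)^n h|^2 <= L (n + 1)^2 w^n |h|^2 and w^n = q^(2 n) q^(2 n): one
   factor absorbs (n + 1)^2, the other provides the geometric decay. *)
pose q := Num.sqrt (Num.sqrt w); have q0 : 0 <= q by exact: sqrtr_ge0.
have q4 : q ^+ 2 ^+ 2 = w by rewrite /q !sqr_sqrtr// sqrtr_ge0.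
have q1 : q < 1.
  rewrite -(ltr_pXn2r (_ : 0 < 2)%N) ?nnegrE// expr1n -(ltr_pXn2r (_ : 0 < 2)%N) ?nnegrE ?sqr_ge0//.
  by rewrite q4 expr1n.
apply/(inv1_spectrum T zn0); apply: (@neumann _ _ _ (Num.sqrt L / (1 - q)) q); first by rewrite q0.
move=> n h; rewrite bop_expZ rnormZ cmodX cmodV.
have rhs0 : 0 <= Num.sqrt L / (1 - q) * q ^+ n * rnorm h.
  by rewrite !mulr_ge0 ?sqrtr_ge0 ?invr_ge0 ?subr_ge0 ?(ltW q1) ?exprn_ge0 ?rnorm_ge0.
have lhs0 : 0 <= (cmod z)^-1 ^+ n * rnorm ((T ^+ n) h).
  by rewrite mulr_ge0 ?rnorm_ge0 ?exprn_ge0 ?invr_ge0 ?cmod_ge0.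
rewrite -(ler_pXn2r (_ : 0 < 2)%N) ?nnegrE// !exprMn sqr_sqrtr//.
have zn : 0 <= (cmod z)^-1 ^+ n ^+ 2 by rewrite sqr_ge0.
rewrite (le_trans (ler_wpM2l zn (gL h n)))// mulrA ler_wpM2r ?sqr_ge0//.
have -> : (cmod z)^-1 ^+ n ^+ 2 * (L * (n.+1%:R ^+ 2 * t ^+ n)) =
    L * (n.+1%:R * q ^+ n) ^+ 2 * q ^+ n ^+ 2.
  have -> : (cmod z)^-1 ^+ n ^+ 2 * (L * (n.+1%:R ^+ 2 * t ^+ n)) = L * n.+1%:R ^+ 2 * w ^+ n.
    by rewrite /w exprMn -exprVn -!exprM (mulnC n 2); ring.
  have -> : w ^+ n = q ^+ n ^+ 2 * q ^+ n ^+ 2.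
    by rewrite -q4 -!exprM -exprD; congr (_ ^+ _); clear; lia.
  by rewrite exprMn !mulrA.
rewrite ler_wpM2r ?sqr_ge0// ler_wpM2l//.
rewrite lerXn2r ?nnegrE ?mulr_ge0 ?exprn_ge0 ?invr_ge0 ?subr_ge0 ?(ltW q1)//.
by apply: natmul_expr_le; rewrite q0.
Qed.

Lemma spectral_radius_supp B C F : op_represents T B C F ->
  (1 <= ereal_sup [set x%:E | x in op_supp F])%E ->
  (spectral_radius T ^+ 2)%:E = ereal_sup [set x%:E | x in op_supp F].
Proof.
move=> rep; have [E|/set0P F0] := eqVneq (op_supp F) set0.
  (* For an empty support the extended supremum is -oo, and the hypothesis fails. *)
  by rewrite E image_set0 ereal_sup0 leeNy_eq.
have Fub x : op_supp F x -> x <= spectral_radius T ^+ 2.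
  by move=> /(op_supp_le_spectral rep)/=; rewrite in_itv/= => /andP[].
have Fb : has_ubound (op_supp F) by exists (spectral_radius T ^+ 2).
rewrite ereal_sup_EFin// lee_fin => s1; congr EFin; apply/eqP; rewrite eq_le.
rewrite ge_sup// andbT (spectral_radius_le_supp rep s1)// => x xF.
by rewrite /= in_itv/=; exact: ub_le_sup.
Qed.

End support_bound.

Theorem theorem3p1p1 (R : realType) (H : hilbertType R) (T : 'B(H)) :
  (cpd_op T <->
     exists (B C : 'B(H)) (F : semispectral H), op_represents T B C F) /\
  (forall (B C : 'B(H)) (F : semispectral H), op_represents T B C F ->
    [/\ (forall (B' C' : 'B(H)) (F' : semispectral H),
          op_represents T B' C' F' ->
          [/\ B' = B, C' = C &
            forall D : set R, measurable D -> D `<=` @Rplus R -> F' D = F D]),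
        [/\ op_supp F `<=` `[0, spectral_radius T ^+ 2],
          (C <> 0 -> 1 <= spectral_radius T) &
          ((1 <= ereal_sup [set x%:E | x in op_supp F])%E ->
            (spectral_radius T ^+ 2)%:E =
              ereal_sup [set x%:E | x in op_supp F])] &
        forall h : H, representing_triplet (fun n => rnorm ((T ^+ n) h) ^+ 2)
          (complex.Re '[B h, h]) (complex.Re '[C h, h]) (quad_measure F h)]).
Proof.
split; first split.
- exact: cpd_op_represents.
- by move=> [B [C [F rep]]]; exact: op_represents_cpd rep.
move=> B C F rep; split.
- by move=> B' C' F' rep'; exact: op_represents_unique rep rep'.
- split; [exact: op_supp_le_spectral rep|exact: spectral_radius_ge1 rep|].
  exact: spectral_radius_supp rep.
- by move=> h; exact: op_represents_triplet.
Qed.
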